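(* Let $\lambda>0$, $\mu_0\in\mathbb R$, let $\sigma:\mathbb R\to\mathbb R$ be Lipschitz continuous and let $X_0\in L^2(\mathbb P)$ be independent of $W$. Let $(X_t)_{t\ge0}$ be a solution of $$X_t = X_0+\int_0^t K(t-s)(\mu_0-\lambda X_s)\,ds+\int_0^tK(t-s)\sigma(X_s)\,dW_s,\qquad t\ge 0,$$ satisfying, for some real constants $v_0\ge0$ and $\bar\sigma_0^2\ge 0$, $$\forall\,t\ge0,\qquad \mathbb E\,X_t=\frac{\mu_0}{\lambda},\qquad \mathrm{Var}(X_t)=v_0\qquad\text{and}\qquad \mathbb E\,\sigma^2(X_t)=\bar\sigma_0^2 .$$ Then only two situations can occur: (i) If $\bar\sigma_0^2>0$, then the kernel $K$ is constant, with $K=\dfrac{2\lambda v_0}{\bar\sigma_0^2}$, so that the equation $X_t = X_0+\int_0^t K(t-s)(\mu_0-\lambda X_s)\,ds+\int_0^tK(t-s)\sigma(X_s)\,dW_s$, $t\ge0$, is a standard Brownian stochastic differential equation and $(X_t)_{t\ge0}$ is a (Markov) Brownian diffusion process with constant mean and variance. (ii) If $\bar\sigma_0^2=0$, then $\sigma\big(\frac{\mu_0}{\lambda}\big)=0$ and $X_t=\frac{\mu_0}{\lambda}$ $\mathbb P$-a.s. for every $t\ge 0$.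
   Context: $W$ is a standard Brownian motion on a probability space $(\Omega,\mathcal A,\mathbb P)$ with a filtration $(\mathcal F_t)_{t\ge0}$ satisfying the usual conditions, $W$ is an $(\mathcal F_t)$-Brownian motion, $X_0$ is $\mathcal F_0$-measurable. Solutions are adapted and pathwise continuous. Convolution: $(f*g)(t)=\int_0^tf(t-s)g(s)ds$. Standing assumptions on the kernel $K:\mathbb R_+\to\mathbb R_+$ (considered up to Lebesgue-a.e. equality): - $\int_0^{+\infty}e^{-tu}K(u)du<+\infty$ for every $t>0$; - $K\in L^{2q}_{loc}(\mathbb R_+,\mathrm{Leb})$ for some $q>1$; - for every $T>0$ there exist $\kappa_T<+\infty$ and $\theta_T>0$ such that for all $\delta\in(0,T)$, $\sup_{t\in[0,T]}\big[\int_0^t|K((s+\delta)\wedge T)-K(s)|^2ds\big]^{1/2}\le\kappa_T\,\delta^{\theta_T}$; - $0\le K(t)\le Ce^{bt}t^{a-1}$, $t>0$, for some $a,b,C>0$; - for every $\lambda>0$, the resolvent $R_\lambda$, i.e. the unique solution of $R_\lambda(t)+\lambda\int_0^tK(t-s)R_\lambda(s)ds=1$, $t\ge0$ (so $R_\lambda(0)=1$), decreases to $0$ as $t\to+\infty$, is differentiable on $(0,+\infty)$ with $f_\lambda:=-R_\lambda'>0$ on $(0,+\infty)$, and $f_\lambda\in L^2_{loc}(\mathbb R_+,\mathrm{Leb})$. *)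

(* Defs.v *)
From HB Require Import structures.
From mathcomp Require Import all_boot all_order all_algebra.
From mathcomp Require Import all_classical all_reals all_analysis.

Set Implicit Arguments.
Unset Strict Implicit.
Unset Printing Implicit Defensive.

Import Order.TTheory GRing.Theory Num.Theory.
Import numFieldNormedType.Exports.

Local Open Scope classical_set_scope.
Local Open Scope ring_scope.

(* Times are real numbers and only the values at times t >= 0 matter: K, the
   processes and the filtrations below are functions on R whose restrictions to
   [0, +oo[ are the objects of interest. *)

Section kernels.
Context {R : realType}.
Implicit Types K f g Rl : R -> R.
Local Notation mu := (@lebesgue_measure R).

Definition convolution f g (t : R) : R :=
  \int[mu]_(s in `[0, t]) (f (t - s) * g s).

Definition resolvent K (lambda : R) Rl : Prop :=
  forall t : R, 0 <= t ->
    mu.-integrable `[0, t] (fun s => (K (t - s) * Rl s)%:E) /\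
    Rl t + lambda * convolution K Rl t = 1.

(* Under the other conditions on K the resolvent equation has exactly one
   solution, so "there is a solution such that ..." is a statement about the
   resolvent.  With f := - Rl', f > 0 reads Rl' < 0 and f ^+ 2 = Rl' ^+ 2. *)
Definition good_resolvent K (lambda : R) : Prop :=
  exists Rl : R -> R,
    [/\ resolvent K lambda Rl,
        {in `[0, +oo[ &, {homo Rl : s t / s <= t >-> t <= s}},
        Rl t @[t --> +oo] --> 0,
        forall t : R, 0 < t -> derivable Rl t 1 /\ derive1 Rl t < 0 &
        forall T : R, 0 < T ->
          (\int[mu]_(u in `]0%R, T]) (derive1 Rl u ^+ 2)%:E < +oo)%E].

Definition laplace_finite K : Prop :=
  forall t : R, 0 < t ->
    (\int[mu]_(u in `[0%R, +oo[) (expR (- t * u) * K u)%:E < +oo)%E.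

Definition locally_L2q K : Prop :=
  exists q : R, 1 < q /\
    forall T : R, 0 < T ->
      (\int[mu]_(u in `[0%R, T]) (`|K u| `^ (2 * q))%:E < +oo)%E.

Definition L2_shift_hoelder K : Prop :=
  forall T : R, 0 < T ->
    exists kappa theta : R, 0 < theta /\
      forall delta : R, 0 < delta < T ->
        (ereal_sup
           [set (\int[mu]_(s in `[0%R, t])
                   (`|K (Num.min (s + delta) T) - K s| ^+ 2)%:E) `^ 2^-1
           | t in `[0%R, T]] <= (kappa * delta `^ theta)%:E)%E.

Definition power_exp_bound K : Prop :=
  exists a b C : R, [/\ 0 < a, 0 < b, 0 < C &
    {ae mu, forall t : R, 0 < t -> K t <= C * expR (b * t) * t `^ (a - 1)}].

Record admissible_kernel K : Prop := AdmissibleKernel {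
  kernel_measurable : measurable_fun (`[0, +oo[ : set R) K ;
  kernel_ge0 : forall t : R, 0 <= t -> 0 <= K t ;
  kernel_laplace : laplace_finite K ;
  kernel_L2q : locally_L2q K ;
  kernel_hoelder : L2_shift_hoelder K ;
  kernel_bound : power_exp_bound K ;
  kernel_resolvent : forall lambda : R, 0 < lambda -> good_resolvent K lambda }.

End kernels.

Section processes.
Context {R : realType} {d : measure_display} {Omega : measurableType d}.
Variable P : probability Omega R.
Local Notation mu := (@lebesgue_measure R).

Implicit Types (F : R -> set (set Omega)) (G H : set (set Omega)).
Implicit Types (W X : R -> Omega -> R).

Definition sigma_of (Y : Omega -> R) : set (set Omega) :=
  preimage_set_system setT Y measurable.

Definition sigma_of_process X : set (set Omega) :=
  <<s \bigcup_(t in `[0%R, +oo[) sigma_of (X t) >>.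

Definition independent_systems G H : Prop :=
  forall A B, G A -> H B -> P (A `&` B) = (P A * P B)%E.

Definition measurable_wrt G (Y : Omega -> R) : Prop := sigma_of Y `<=` G.

(* The last condition includes the completeness of P, since every member of
   F 0 is measurable. *)
Definition usual_filtration F : Prop :=
  [/\ forall t : R, 0 <= t -> sigma_algebra setT (F t) /\ F t `<=` measurable,
      forall s t : R, 0 <= s -> s <= t -> F s `<=` F t,
      forall t : R, 0 <= t -> \bigcap_(s in `]t, +oo[) F s `<=` F t &
      forall N, P.-negligible N -> F 0 N].

Definition adapted F X : Prop :=
  forall t : R, 0 <= t -> measurable_wrt (F t) (X t).

Definition brownian_motion F W : Prop :=
  [/\ adapted F W,
      {ae P, forall w, W 0 w = 0},
      {ae P, forall w, {within `[0, +oo[, continuous (fun t => W t w)}},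
      forall s t : R, 0 <= s -> s < t ->
        independent_systems (sigma_of (W t \- W s)) (F s) &
      forall s t : R, 0 <= s -> s < t -> forall B : set R, measurable B ->
        P ((W t \- W s) @^-1` B) = normal_prob 0 (Num.sqrt (t - s)) B].

(* The process sum_(i < n) xi_i 1_(]tau_i, tau_i+1]). *)
Record simple_process := SimpleProcess {
  sp_size : nat ;
  sp_time : nat -> R ;
  sp_coef : nat -> Omega -> R }.

Definition simple_adapted F (S : simple_process) : Prop :=
  [/\ 0 <= sp_time S 0,
      forall i, sp_time S i <= sp_time S i.+1,
      forall i, measurable_wrt (F (sp_time S i)) (sp_coef S i) &
      exists M : R, forall i w, `|sp_coef S i w| <= M].

Definition simple_value (S : simple_process) (s : R) (w : Omega) : R :=
  \sum_(i < sp_size S)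
    sp_coef S i w * \1_(`]sp_time S i, sp_time S i.+1]) s.

Definition simple_integral (S : simple_process) W (t : R) (w : Omega) : R :=
  \sum_(i < sp_size S)
    sp_coef S i w *
    (W (Num.min (sp_time S i.+1) t) w - W (Num.min (sp_time S i) t) w).

(* I is (a version of) the L^2 Ito integral of (Y_s)_(0 <= s <= t) against W:
   the L^2(P)-limit of the integrals of simple processes that converge to Y in
   L^2(ds (x) P) on [0, t] x Omega. *)
Definition ito_integral F W (Y : R -> Omega -> R) (t : R) (I : Omega -> R) :
    Prop :=
  [/\ measurable_fun ((`[0, t] : set R) `*` setT)
        (fun z : R * Omega => Y z.1 z.2),
      forall s : R, 0 <= s <= t -> measurable_wrt (F s) (Y s),
      measurable_fun setT I &
      exists S : nat -> simple_process,
        [/\ forall n, simple_adapted F (S n),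
            (\int[P]_w \int[mu]_(s in `[0%R, t])
               ((simple_value (S n) s w - Y s w) ^+ 2)%:E)%E
              @[n --> \oo] --> 0%E &
            'E_P[(fun w => (simple_integral (S n) W t w - I w) ^+ 2)%R]%E
              @[n --> \oo] --> 0%E]].

Definition continuous_paths X : Prop :=
  forall w, {within `[0, +oo[, continuous (fun t => X t w)}.

(* X_t = X_0 + int_0^t K(t-s) b(X_s) ds + int_0^t K(t-s) sigma(X_s) dW_s *)
Definition volterra_solution F W (K b sigma : R -> R) X : Prop :=
  [/\ adapted F X, continuous_paths X &
      forall t : R, 0 <= t -> exists I : Omega -> R,
        ito_integral F W (fun s w => K (t - s) * sigma (X s w)) t I /\
        {ae P, forall w,
           X t w = X 0 w + convolution K (fun s => b (X s w)) t + I w}].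

(* dX_t = b(X_t) dt + sigma(X_t) dW_t *)
Definition sde_solution F W (b sigma : R -> R) X : Prop :=
  [/\ adapted F X, continuous_paths X &
      forall t : R, 0 <= t -> exists I : Omega -> R,
        ito_integral F W (fun s w => sigma (X s w)) t I /\
        {ae P, forall w,
           X t w = X 0 w + \int[mu]_(s in `[0, t]) b (X s w) + I w}].

(* E[phi(X_t) | F_s] = g(X_s) for some Borel function g, for every bounded
   Borel function phi. *)
Definition markov_process F X : Prop :=
  forall s t : R, 0 <= s -> s <= t ->
  forall phi : R -> R, measurable_fun setT phi ->
  (exists M : R, forall x, `|phi x| <= M) ->
  exists g : R -> R,
    [/\ measurable_fun setT g,
        P.-integrable setT (fun w => (g (X s w))%:E) &
        forall A, F s A ->
          (\int[P]_(w in A) (phi (X t w))%:E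
           = \int[P]_(w in A) (g (X s w))%:E)%E].

End processes.

(* Main.v *)
(* Write m = mu0 / lambda, Y = X - m, R for the resolvent and f = - R'.  Testing the
   Volterra equation against Y_0, then against the stochastic integral M_t, then
   against Y_s turns it into scalar Volterra equations that R solves:
     E[Y_0 Y_t] = v0 R(t),
     E[M_t Y_s] = (sb2 / lambda) int_0^(min s t) f(s - u) K(t - u) du,
     v0 = E[Y_t ^ 2] = v0 R(t)^2 + (sb2 / lambda^2) int_0^t f(u)^2 du.
   If sb2 > 0, differentiating the last identity gives f = alpha R a.e. with
   alpha = 2 lambda^2 v0 / sb2; then f + lambda K * f = lambda K becomes
   alpha (R + lambda K * R) = lambda K, that is K = alpha / lambda.  If sb2 = 0 the
   same identity and R -> 0 give v0 = 0.

   For the Markov property, run an Euler scheme from X_s at time s.  By independence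
   of the increments, for A in F_s the variables 1_A and E[1_A | X_s] have the same
   correlation with every function of each iterate.  The scheme converges to X_t in
   L^2, so the same holds for X_t, and this characterises E[phi(X_t) | F_s] as a
   function of X_s. *)

Require Import Defs.
From HB Require Import structures.
From mathcomp Require Import all_boot all_order all_algebra.
From mathcomp Require Import all_classical all_reals all_analysis.
From mathcomp Require Import measurable_realfun.
From mathcomp Require Import ring lra.

Import Order.TTheory GRing.Theory Num.Theory.
Import numFieldNormedType.Exports.

Local Open Scope classical_set_scope.
Local Open Scope ring_scope.

Set Implicit Arguments.
Unset Strict Implicit.
Unset Printing Implicit Defensive.

(** * Square-integrable functions *)

(** The stochastic convolution M_t is not a martingale in t, since its integrand contains K(t - s),
    so E[M_t Y_s] cannot be computed by conditioning on F_s. It is studied for fixed t as a function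
    of s, over all s >= 0: there it solves a Volterra equation whose source E[M_t M_s] is given by
    the Ito isometry. The symmetry of int f(s - u) K(t - u) du in its two factors then turns the
    answer into a source term in t. The analytic obstacle is that K has no regularity and is fixed
    only up to null sets. The identity f + lambda K * f = lambda K is obtained almost everywhere, by
    differentiating its primitive; this requires R to be the integral of its derivative, which comes
    from two opposite Fatou estimates. Convolutions are integrals of [0, +oo]-valued functions over
    the whole line, so that Tonelli's theorem gives associativity at once. For the Markov property,
    the exact argument is made on the Euler scheme, where the Brownian increments appear explicitly;
    the scheme is compared with the given solution itself, whose second moments are constant in
    time. *)

Lemma ge0_integral_mulEFin d (T : measurableType d) (R : realType)
    (m : {measure set T -> \bar R}) (D : set T) (k : R) (f : T -> R) :
  measurable D -> 0 <= k -> measurable_fun D f -> (forall x, D x -> 0 <= f x) ->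
  (\int[m]_(x in D) (k * f x)%:E = k%:E * \int[m]_(x in D) (f x)%:E)%E.
Proof.
move=> mD k0 mf f0; under eq_integral do rewrite EFinM.
by rewrite ge0_integralZl//; exact/measurable_EFinP.
Qed.

Section square_integrable.
Context d (T : measurableType d) (R : realType).
Variable m : {measure set T -> \bar R}.
Implicit Types f g h : T -> R.

Definition sqint f :=
  measurable_fun setT f /\ m.-integrable setT (fun x => (f x ^+ 2)%:E).

(** The L^2 inner product on actual functions rather than on classes. It is total: an infinite
    integral is sent to 0 by [fine], which is why the algebraic rules carry [sqint] hypotheses. *)
Definition ip f g : R := \int[m]_x (f x * g x).

Lemma sqintP f : measurable_fun setT f ->
  (\int[m]_x (f x ^+ 2)%:E < +oo)%E -> sqint f.
Proof.
move=> mf foo; split => //; apply/integrableP; split.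
  by apply/measurable_EFinP; exact: measurable_funX.
by under eq_integral do rewrite gee0_abs ?lee_fin ?sqr_ge0//.
Qed.

Lemma sqint_le f (g : T -> R) : measurable_fun setT f ->
  m.-integrable setT (EFin \o g) -> (forall x, f x ^+ 2 <= g x) -> sqint f.
Proof.
move=> mf ig fg; split => //.
apply: (le_integrable _ _ _ ig) => //.
  by apply/measurable_EFinP; exact: measurable_funX.
move=> x _ /=; rewrite lee_fin ger0_norm ?sqr_ge0//.
by rewrite (le_trans (fg x))// ler_norm.
Qed.

Lemma sqintM_integrable f g : sqint f -> sqint g ->
  m.-integrable setT (fun x => (f x * g x)%:E).
Proof.
move=> [mf i_f] [mg i_g].
apply: (le_integrable _ _ _ (integrableD measurableT i_f i_g)) => //.
  by apply/measurable_EFinP; exact: measurable_funM.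
move=> x _ /=; rewrite lee_fin [leRHS]ger0_norm ?addr_ge0 ?sqr_ge0//.
rewrite ler_norml; apply/andP; split; nra.
Qed.

Lemma sqintZ a f : sqint f -> sqint (fun x => a * f x).
Proof.
move=> [mf i_f]; split; first exact: measurable_funM.
rewrite (_ : (fun _ => _) = (fun x => (a ^+ 2)%:E * (f x ^+ 2)%:E)%E); last first.
  by apply/funext => x; rewrite exprMn.
exact: integrableZl.
Qed.

Lemma sqintD f g : sqint f -> sqint g -> sqint (fun x => f x + g x).
Proof.
move=> [mf i_f] [mg i_g].
have ? := integrableZl measurableT 2 i_f.
have ? := integrableZl measurableT 2 i_g.
apply: (@sqint_le _ (fun x => 2 * f x ^+ 2 + 2 * g x ^+ 2)).
- exact: measurable_funD.
- rewrite (_ : _ \o _ = (fun x => (2%:E * (f x ^+ 2)%:E + 2%:E * (g x ^+ 2)%:E)%E)) //.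
  exact: integrableD.
- move=> x; have := sqr_ge0 (f x - g x); nra.
Qed.

Lemma sqintN f : sqint f -> sqint (fun x => - f x).
Proof.
move=> /(sqintZ (-1)); rewrite (_ : (fun _ => _) = (fun x => - f x))//.
by apply/funext => x; rewrite mulN1r.
Qed.

Lemma sqintB f g : sqint f -> sqint g -> sqint (fun x => f x - g x).
Proof. by move=> hf /sqintN; exact: sqintD. Qed.

Lemma sqint0 : sqint (fun=> 0).
Proof.
split; first exact: measurable_cst.
by under eq_fun do rewrite expr0n/=; exact: integrable0.
Qed.

Lemma sqint_sum (I : Type) (s : seq I) (f : I -> T -> R) :
  (forall i, sqint (f i)) -> sqint (fun x => \sum_(i <- s) f i x).
Proof.
move=> hf; elim: s => [|i s ih].
  by under eq_fun do rewrite big_nil; exact: sqint0.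
by under eq_fun do rewrite big_cons; exact: sqintD.
Qed.

Lemma ipC f g : ip f g = ip g f.
Proof. by apply: eq_Rintegral => x _; rewrite mulrC. Qed.

Lemma ipDl f g h : sqint f -> sqint g -> sqint h ->
  ip (fun x => f x + g x) h = ip f h + ip g h.
Proof.
move=> hf hg hh; rewrite /ip -RintegralD//; [|exact: sqintM_integrable..].
by apply: eq_Rintegral => x _; rewrite mulrDl.
Qed.

Lemma ipZl a f h : sqint f -> sqint h -> ip (fun x => a * f x) h = a * ip f h.
Proof.
move=> hf hh; rewrite /ip -RintegralZl//; last exact: sqintM_integrable.
by apply: eq_Rintegral => x _; rewrite mulrA.
Qed.

Lemma ipNl f h : sqint f -> sqint h -> ip (fun x => - f x) h = - ip f h.
Proof.
move=> hf hh; rewrite -mulN1r -ipZl//.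
by congr ip; apply/funext => x; rewrite mulN1r.
Qed.

Lemma ipBl f g h : sqint f -> sqint g -> sqint h ->
  ip (fun x => f x - g x) h = ip f h - ip g h.
Proof. by move=> hf hg hh; rewrite ipDl ?ipNl//; exact: sqintN. Qed.

Lemma ipDr f g h : sqint f -> sqint g -> sqint h ->
  ip h (fun x => f x + g x) = ip h f + ip h g.
Proof. by move=> *; rewrite ipC ipDl// !(ipC h). Qed.

Lemma ipBr f g h : sqint f -> sqint g -> sqint h ->
  ip h (fun x => f x - g x) = ip h f - ip h g.
Proof. by move=> *; rewrite ipC ipBl// !(ipC h). Qed.

Lemma ipZr a f h : sqint f -> sqint h -> ip h (fun x => a * f x) = a * ip h f.
Proof. by move=> *; rewrite ipC ipZl// (ipC h). Qed.

Lemma ip_suml (I : Type) (s : seq I) (f : I -> T -> R) h :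
  (forall i, sqint (f i)) -> sqint h ->
  ip (fun x => \sum_(i <- s) f i x) h = \sum_(i <- s) ip (f i) h.
Proof.
move=> hf hh; elim: s => [|i s ih].
  rewrite big_nil /ip; under eq_Rintegral do rewrite big_nil mul0r.
  by rewrite Rintegral_cst// mul0r.
rewrite big_cons -ih -ipDl//; last exact: sqint_sum.
by congr ip; apply/funext => x; rewrite big_cons.
Qed.

Lemma ip_ge0 f : 0 <= ip f f.
Proof. by apply: Rintegral_ge0 => x _; rewrite -expr2 sqr_ge0. Qed.

Lemma ip_sqr f : ip f f = \int[m]_x (f x ^+ 2).
Proof. by []. Qed.

Lemma ip_EFin f : sqint f -> (\int[m]_x (f x ^+ 2)%:E)%E = (ip f f)%:E.
Proof.
move=> [mf i_f]; rewrite ip_sqr /Rintegral fineK//.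
exact: integrable_fin_num.
Qed.

Lemma ipD_sqr f g : sqint f -> sqint g ->
  ip (fun x => f x + g x) (fun x => f x + g x) = ip f f + 2 * ip f g + ip g g.
Proof.
move=> hf hg; rewrite ipDl ?ipDr//; [|exact: sqintD..].
by rewrite (ipC g f); ring.
Qed.

Lemma ipB_sqr f g : sqint f -> sqint g ->
  ip (fun x => f x - g x) (fun x => f x - g x) = ip f f - 2 * ip f g + ip g g.
Proof.
move=> hf hg; rewrite ipBl ?ipBr//; [|exact: sqintB..].
by rewrite (ipC g f); ring.
Qed.

(** The quadratic form (a, b) |-> |a f + b g|^2 is nonnegative; at ([ip g g], - [ip f g]) it equals
    [ip g g] times the difference of the two sides. *)
Lemma ip_CS f g : sqint f -> sqint g -> ip f g ^+ 2 <= ip f f * ip g g.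
Proof.
move=> hf hg.
have key a b : 0 <= a ^+ 2 * ip f f + 2 * a * b * ip f g + b ^+ 2 * ip g g.
  have := ip_ge0 (fun x => a * f x + b * g x).
  rewrite ipD_sqr ?ipZl ?ipZr//; do ? exact: sqintZ.
  by move=> /le_trans; apply; rewrite le_eqVlt; apply/orP; left; apply/eqP; ring.
have g0 := ip_ge0 g.
have f0 := ip_ge0 f.
have [gg0|gn0] := eqVneq (ip g g) 0.
  (* With [ip g g] = 0 the form at this point equals - ([ip f f] + 2) * [ip f g] ^+ 2, which forces
     [ip f g] = 0. *)
  have k1 := key (- ip f g) ((1 + ip f f)).
  rewrite gg0 mulr0 in k1 *.
  have : 0 <= ip f g ^+ 2 by exact: sqr_ge0.
  nra.
have gp : 0 < ip g g by rewrite lt_def gn0.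
have := key (ip g g) (- ip f g).
rewrite (_ : _ + _ = ip g g * (ip f f * ip g g - ip f g ^+ 2)); last by ring.
by rewrite pmulr_rge0// subr_ge0.
Qed.

Lemma ip_abs f g : sqint f -> sqint g -> `|ip f g| <= Num.sqrt (ip f f) * Num.sqrt (ip g g).
Proof.
move=> hf hg; rewrite -sqrtrM ?ip_ge0// -sqrtr_sqr ler_wsqrtr//.
exact: ip_CS.
Qed.

(** Cauchy-Schwarz applied to <fn - f, gn - g> + <fn - f, g> + <f, gn - g>. Every identity known for
    simple processes or for Euler iterates reaches its L^2 limit through this lemma. *)
Lemma ip_cvg (fn gn : nat -> T -> R) f g :
  (forall n, sqint (fn n)) -> (forall n, sqint (gn n)) -> sqint f -> sqint g ->
  ip (fun x => fn n x - f x) (fun x => fn n x - f x) @[n --> \oo] --> 0 ->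
  ip (fun x => gn n x - g x) (fun x => gn n x - g x) @[n --> \oo] --> 0 ->
  ip (fn n) (gn n) @[n --> \oo] --> ip f g.
Proof.
move=> hfn hgn hf hg ca cb.
pose a n := ip (fun x => fn n x - f x) (fun x => fn n x - f x).
pose b n := ip (fun x => gn n x - g x) (fun x => gn n x - g x).
have {}ca : a n @[n --> \oo] --> 0 by exact: ca.
have {}cb : b n @[n --> \oo] --> 0 by exact: cb.
pose e n := Num.sqrt (a n) * Num.sqrt (b n) + Num.sqrt (a n) * Num.sqrt (ip g g)
  + Num.sqrt (ip f f) * Num.sqrt (b n).
have ce : e n @[n --> \oo] --> 0.
  have sa : Num.sqrt (a n) @[n --> \oo] --> 0.
    by rewrite -sqrtr0; apply: continuous_cvg => //; exact: sqrt_continuous.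
  have sb : Num.sqrt (b n) @[n --> \oo] --> 0.
    by rewrite -sqrtr0; apply: continuous_cvg => //; exact: sqrt_continuous.
  rewrite (_ : 0 = 0 * 0 + 0 * Num.sqrt (ip g g) + Num.sqrt (ip f f) * 0); last by ring.
  apply: cvgD; first apply: cvgD.
  - exact: cvgM.
  - by apply: cvgM => //; exact: cvg_cst.
  - by apply: cvgM => //; exact: cvg_cst.
have efg n : `|ip f g - ip (fn n) (gn n)| <= e n.
  rewrite distrC (_ : ip (fn n) (gn n) - ip f g =
    ip (fun x => fn n x - f x) (fun x => gn n x - g x) +
    ip (fun x => fn n x - f x) g + ip f (fun x => gn n x - g x)); last first.
    rewrite ipBl// ?ipBr//; last exact: sqintB.
    by rewrite ipBl//; ring.
  rewrite (le_trans (ler_normD _ _))// lerD//; last exact/ip_abs/sqintB.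
  rewrite (le_trans (ler_normD _ _))// lerD//.
    exact: ip_abs (sqintB _ _) (sqintB _ _).
  exact: ip_abs (sqintB _ _) _.
apply/cvgrPdist_le => eps eps0.
move/cvgrPdist_le : ce => /(_ _ eps0); apply: filterS => n.
rewrite sub0r normrN => /(le_trans (ler_norm _)).
exact: le_trans.
Qed.

Lemma ae_eq_Rintegral f g : measurable_fun setT f -> measurable_fun setT g ->
  {ae m, forall x, f x = g x} -> \int[m]_x f x = \int[m]_x g x.
Proof.
move=> mf mg fg; congr fine; apply: ae_eq_integral => //.
- exact/measurable_EFinP.
- exact/measurable_EFinP.
- by apply: filterS fg => x -> _.
Qed.

Lemma ip_ae_eq f g h : measurable_fun setT f -> measurable_fun setT g ->
  measurable_fun setT h ->
  {ae m, forall x, f x = g x} -> ip f h = ip g h.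
Proof.
move=> mf mg mh fg; apply: ae_eq_Rintegral; [exact: measurable_funM..|].
by apply: filterS fg => x ->.
Qed.

Lemma ip_eq0 f : sqint f -> ip f f = 0 -> {ae m, forall x, f x = 0}.
Proof.
move=> hf f0; have mf := hf.1.
have : ae_eq m setT (fun x => (f x ^+ 2)%:E) (cst 0%E).
  apply/ae_eq_integral_abs => //.
    by apply/measurable_EFinP; exact: measurable_funX.
  under eq_integral do rewrite gee0_abs ?lee_fin ?sqr_ge0//.
  by rewrite ip_EFin// f0.
by apply: filterS => x /(_ Logic.I)[] /eqP; rewrite sqrf_eq0 => /eqP.
Qed.

End square_integrable.

Lemma sqint_cst d (T : measurableType d) (R : realType) (P : probability T R)
  (c : R) : sqint P (fun=> c).
Proof.
apply: sqintP; first exact: measurable_cst.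
by rewrite integral_cst//= probability_setT mule1 ltry.
Qed.

(** * Convolution on the real line *)

Section lebesgue_invariance.
Context {R : realType}.
Local Notation mu := (@lebesgue_measure R).

Lemma measurable_reflect (a : R) : measurable_fun setT (fun x : R => a - x).
Proof. exact: measurable_funB. Qed.

(** Lebesgue measure is characterised by its values on the intervals ]b, c]; the preimage of such an
    interval is [a - c, a - b[, of the same length. *)
Lemma lebesgue_measure_reflect (a : R) (A : set R) : measurable A ->
  pushforward mu ((fun x => a - x) : _ -> measurableTypeR R) A = mu A.
Proof.
move=> mA; apply/esym/lebesgue_measure_unique => //=.
  exact: measurable_reflect.
move=> mf _ [[b c] /= bc <-]; rewrite /pushforward.
rewrite [RHS](_ : _ = mu `[a - c, a - b[%classic); last first.
  congr (mu _); apply/seteqP; split => x /=; rewrite !in_itv/= => /andP[? ?]; apply/andP; split; lra.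
rewrite !lebesgue_measure_itv/= !lte_fin ltrD2l ltrN2; case: ifPn => // _.
by rewrite -!EFinD; congr EFin; ring.
Qed.

Lemma ge0_integral_reflect (a : R) (f : R -> \bar R) :
  measurable_fun setT f -> (forall x, 0 <= f x)%E ->
  (\int[mu]_x f (a - x)%R = \int[mu]_x f x)%E.
Proof.
move=> mf f0.
transitivity (\int[mu]_(x in ((fun x => a - x)%R : _ -> measurableTypeR R) @^-1` setT) f (a - x)%R)%E => //.
rewrite -(ge0_integral_pushforward _ _ (D := setT))//=; last exact: measurable_reflect.
by apply: eq_measure_integral => [|mphi A mA _]; [exact: measurable_reflect|exact: lebesgue_measure_reflect].
Qed.

(** A translation is the composite of two reflections. *)
Lemma ge0_integral_shift (a : R) (f : R -> \bar R) :
  measurable_fun setT f -> (forall x, 0 <= f x)%E ->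
  (\int[mu]_x f (x - a)%R = \int[mu]_x f x)%E.
Proof.
move=> mf f0; rewrite -(ge0_integral_reflect 0 mf f0).
rewrite -(@ge0_integral_reflect a (fun x => f (0 - x)))//; last first.
  by apply: measurableT_comp => //; exact: measurable_reflect.
by apply: eq_integral => x _; congr f; ring.
Qed.

Lemma negligible_reflect (a : R) (N : set R) : mu.-negligible N ->
  mu.-negligible ((fun x => a - x) @^-1` N).
Proof.
move=> [A [mA A0 NA]]; exists ((fun x => a - x) @^-1` A); split.
- by rewrite -[X in measurable X]setTI; exact: measurable_reflect.
- by rewrite -[RHS]A0; exact: lebesgue_measure_reflect.
- by move=> x /= /NA.
Qed.

Lemma ae_reflect (a : R) (P : R -> Prop) : {ae mu, forall x, P x} ->
  {ae mu, forall x, P (a - x)}.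
Proof. exact: negligible_reflect. Qed.

Local Open Scope ereal_scope.

(** The integral runs over the whole line and takes extended values: for nonnegative functions it
    always makes sense, and causality will be encoded by functions that vanish on negative times. *)
Definition econv (f g : R -> \bar R) (t : R) : \bar R :=
  \int[mu]_s (f (t - s)%R * g s).

Implicit Types f g h : R -> \bar R.

Lemma econv_ge0 f g : (forall x, 0 <= f x) -> (forall x, 0 <= g x) ->
  forall t, 0 <= econv f g t.
Proof. by move=> f0 g0 t; apply: integral_ge0 => s _; exact: mule_ge0. Qed.

Lemma measurable_translation2 f : measurable_fun setT f ->
  measurable_fun setT (fun z : R * R => f (z.1 - z.2)%R).
Proof. by move=> mf; apply: measurableT_comp => //; exact: measurable_funB. Qed.

Lemma measurable_econv f g : measurable_fun setT f -> measurable_fun setT g ->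
  (forall x, 0 <= f x) -> (forall x, 0 <= g x) ->
  measurable_fun setT (econv f g).
Proof.
move=> mf mg f0 g0.
have := @measurable_fun_fubini_tonelli_F _ _ (measurableTypeR R) (measurableTypeR R) R mu
  (fun z : R * R => f (z.1 - z.2)%R * g z.2).
apply.
  apply: emeasurable_funM; first exact: measurable_translation2.
  exact: measurableT_comp.
by move=> z; exact: mule_ge0.
Qed.

Lemma econvC f g : measurable_fun setT f -> measurable_fun setT g ->
  (forall x, 0 <= f x) -> (forall x, 0 <= g x) -> econv f g = econv g f.
Proof.
move=> mf mg f0 g0; apply/funext => t; rewrite /econv.
rewrite -(@ge0_integral_reflect t (fun s => f (t - s)%R * g s)).
- by apply: eq_integral => s _; rewrite subKr muleC.
- apply: emeasurable_funM => //.
  by apply: measurableT_comp => //; exact: measurable_reflect.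
- by move=> x; exact: mule_ge0.
Qed.

(** Tonelli exchanges the two integrals, and the shift s = r + u turns the inner one into (f * g)(t
    - u). *)
Lemma econvA f g h : measurable_fun setT f -> measurable_fun setT g ->
  measurable_fun setT h ->
  (forall x, 0 <= f x) -> (forall x, 0 <= g x) -> (forall x, 0 <= h x) ->
  econv f (econv g h) = econv (econv f g) h.
Proof.
move=> mf mg mh f0 g0 h0; apply/funext => t.
rewrite /econv.
transitivity (\int[mu]_s \int[mu]_u (f (t - s)%R * (g (s - u)%R * h u))).
  apply: eq_integral => s _; rewrite ge0_integralZl//.
  - apply: emeasurable_funM => //.
    by apply: measurableT_comp => //; exact: measurable_reflect.
  - by move=> x _; exact: mule_ge0.
pose F (z : R * R) := f (t - z.1)%R * (g (z.1 - z.2)%R * h z.2).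
have mF : measurable_fun setT F.
  apply: emeasurable_funM.
    apply: (measurableT_comp mf); apply: measurable_funB => //.
  apply: emeasurable_funM; first exact: measurable_translation2.
  exact: measurableT_comp.
have F0 z : 0 <= F z by rewrite !mule_ge0.
rewrite (@fubini_tonelli _ _ (measurableTypeR R) (measurableTypeR R) R mu mu F mF F0).
apply: eq_integral => u _; rewrite /F/=.
under eq_integral do rewrite muleA.
rewrite ge0_integralZr//; last first.
- by move=> x _; exact: mule_ge0.
- apply: emeasurable_funM.
    by apply: measurableT_comp => //; exact: measurable_reflect.
  by apply: measurableT_comp => //; exact: measurable_funB.
congr (_ * _).
rewrite -(@ge0_integral_shift u (fun r => f (t - u - r)%R * g r)).
- by apply: eq_integral => s _; congr (f _ * _); ring.
- apply: emeasurable_funM => //.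
  by apply: measurableT_comp => //; exact: measurable_reflect.
- by move=> x; exact: mule_ge0.
Qed.

Lemma econvDl f g h : measurable_fun setT f -> measurable_fun setT g ->
  measurable_fun setT h ->
  (forall x, 0 <= f x) -> (forall x, 0 <= g x) -> (forall x, 0 <= h x) ->
  econv (f \+ g) h = econv f h \+ econv g h.
Proof.
move=> mf mg mh f0 g0 h0; apply/funext => t; rewrite /econv.
have mr (k : R -> \bar R) : measurable_fun setT k -> measurable_fun setT (fun s : R => k (t - s)%R).
  by move=> mk; apply: measurableT_comp => //; exact: measurable_reflect.
rewrite -ge0_integralD//.
- by apply: eq_integral => s _; rewrite ge0_muleDl.
- by move=> x _; exact: mule_ge0.
- by apply: emeasurable_funM => //; exact: mr.
- by move=> x _; exact: mule_ge0.
- by apply: emeasurable_funM => //; exact: mr.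
Qed.

Lemma econvZl (c : R) f g : measurable_fun setT f -> measurable_fun setT g ->
  (forall x, 0 <= f x) -> (forall x, 0 <= g x) -> (0 <= c)%R ->
  econv (fun x => c%:E * f x) g = (fun x => c%:E * econv f g x).
Proof.
move=> mf mg f0 g0 c0; apply/funext => t; rewrite /econv.
rewrite -ge0_integralZl//.
- by apply: eq_integral => s _; rewrite muleA.
- apply: emeasurable_funM => //.
  by apply: measurableT_comp => //; exact: measurable_reflect.
- by move=> x _; exact: mule_ge0.
Qed.

(** The equality holds at every t, not merely almost everywhere, because s |-> t - s preserves null
    sets. *)
Lemma econv_ae_eql f f' g : measurable_fun setT f -> measurable_fun setT f' ->
  measurable_fun setT g ->
  (forall x, 0 <= f x) -> (forall x, 0 <= f' x) -> (forall x, 0 <= g x) ->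
  {ae mu, forall x, f x = f' x} -> econv f g = econv f' g.
Proof.
move=> mf mf' mg f0 f'0 g0 ff'; apply/funext => t; rewrite /econv.
have mr (k : R -> \bar R) : measurable_fun setT k -> measurable_fun setT (fun s : R => k (t - s)%R).
  by move=> mk; apply: measurableT_comp => //; exact: measurable_reflect.
apply: ge0_ae_eq_integral => //.
- by apply: emeasurable_funM => //; exact: mr.
- by apply: emeasurable_funM => //; exact: mr.
- by move=> x _; exact: mule_ge0.
- by move=> x _; exact: mule_ge0.
- by apply: (@filterS _ _ (ae_filter_ringOfSetsType mu) _ _ _ (ae_reflect t ff')) => x /= ->.
Qed.

End lebesgue_invariance.

(** * Independence *)

Section independence.
Context d (Omega : measurableType d) (R : realType) (P : probability Omega R).
Variable G : set (set Omega).
Hypothesis Gm : G `<=` measurable.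

(** Measurability with respect to a bare family [G] of sets, for maps into any measurable space;
    pairs of variables are needed as well as real ones. *)
Definition preim_in d' (T' : measurableType d') (U : Omega -> T') :=
  forall B, measurable B -> G (U @^-1` B).

Lemma measurable_wrtP (U : Omega -> R) : measurable_wrt G U <-> preim_in U.
Proof.
split=> [h B mB|h _ [B mB <-]].
  by apply: h; exists B => //; rewrite setTI.
by rewrite setTI; exact: h.
Qed.

Lemma preim_in_measurable d' (T' : measurableType d') (U : Omega -> T') :
  preim_in U -> measurable_fun setT U.
Proof. by move=> h _ B mB; rewrite setTI; exact/Gm/h. Qed.

(** The joint law of (U, V) agrees with the product of the marginal laws on rectangles, hence
    everywhere, and Tonelli applies. Letting U take values in an arbitrary space allows it to be a
    pair. *)
Lemma indep_integral d' (T' : measurableType d') (U : Omega -> T')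
    (V : Omega -> R) (f : T' * R -> \bar R) :
  preim_in U -> measurable_fun setT V ->
  independent_systems P (sigma_of V) G ->
  measurable_fun setT f -> (forall z, 0 <= f z)%E ->
  (\int[P]_w f (U w, V w) = \int[P]_w \int[P]_w' f (U w, V w'))%E.
Proof.
move=> GU mV iVG mf f0.
have mU := preim_in_measurable GU.
pose Up : {mfun Omega >-> T'} := HB.pack U (isMeasurableFun.Build _ _ _ _ U mU).
pose Vp : {mfun Omega >-> R} := HB.pack V (isMeasurableFun.Build _ _ _ _ V mV).
have mUV : measurable_fun setT (fun w => (U w, V w)) by exact/measurable_fun_pair.
pose UVp : {mfun Omega >-> (T' * R)%type} :=
  HB.pack (fun w => (U w, V w)) (isMeasurableFun.Build _ _ _ _ _ mUV).
transitivity (\int[distribution P UVp]_z f z)%E.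
  by rewrite ge0_integral_distribution.
transitivity (\int[(distribution P Up \x distribution P Vp)%E]_z f z)%E.
  apply: eq_measure_integral => A mA _; apply/esym.
  apply: product_measure_unique => // B C mB mC.
  rewrite muleC -(iVG (V @^-1` C) (U @^-1` B)).
  - by rewrite setIC.
  - by exists C => //; rewrite setTI.
  - exact: GU.
rewrite fubini_tonelli1//.
rewrite ge0_integral_distribution//; last 2 first.
- exact: measurable_fun_fubini_tonelli_F.
- by move=> y; exact: integral_ge0.
apply: eq_integral => w _ /=.
rewrite /fubini_F ge0_integral_distribution//.
exact: measurableT_comp.
Qed.

(** The integrand U V is signed, so Fubini replaces Tonelli: integrability under the product law is
    transported from the joint law, and each inner integral is x * E[V] = 0. *)
Lemma indep_ip0 (U V : Omega -> R) :
  preim_in U -> measurable_fun setT V ->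
  independent_systems P (sigma_of V) G ->
  sqint P U -> sqint P V -> \int[P]_w V w = 0 -> ip P U V = 0.
Proof.
move=> GU mV iVG sU sV EV0.
have mU := preim_in_measurable GU.
pose Up : {mfun Omega >-> R} := HB.pack U (isMeasurableFun.Build _ _ _ _ U mU).
pose Vp : {mfun Omega >-> R} := HB.pack V (isMeasurableFun.Build _ _ _ _ V mV).
have mUV : measurable_fun setT (fun w => (U w, V w)) by exact/measurable_fun_pair.
pose UVp : {mfun Omega >-> (R * R)%type} :=
  HB.pack (fun w => (U w, V w)) (isMeasurableFun.Build _ _ _ _ _ mUV).
pose f (z : R * R) := (z.1 * z.2)%:E.
have mf : measurable_fun setT f.
  by apply/measurable_EFinP; exact: measurable_funM.
have prodE A : measurable A ->
    (distribution P Up \x distribution P Vp)%E A = distribution P UVp A.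
  move=> mA; apply: product_measure_unique => // B C mB mC.
  rewrite muleC -(iVG (V @^-1` C) (U @^-1` B)).
  - by rewrite setIC.
  - by exists C => //; rewrite setTI.
  - exact: GU.
have ifUV : P.-integrable setT (f \o UVp) by exact: sqintM_integrable.
have int_f : (distribution P UVp).-integrable setT f.
  by apply: integrable_pushforward => //; rewrite preimage_setT.
have int_f' : (distribution P Up \x distribution P Vp)%E.-integrable setT f.
  apply/integrableP; split => //.
  rewrite (eq_measure_integral (distribution P UVp)).
    by case/integrableP : int_f.
  by move=> A mA _; exact: prodE.
have -> : ip P U V = fine (\int[P]_w f (UVp w))%E by [].
rewrite (_ : \int[P]_w f (UVp w) = \int[distribution P UVp]_z f z)%E; last first.
  by rewrite integral_distribution.
rewrite -(@eq_measure_integral _ _ _ _ (distribution P UVp) (distribution P Up \x distribution P Vp)%E); last first.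
  by move=> A mA _; exact: prodE.
rewrite -integral12_prod_meas1//.
rewrite (_ : (\int[_]_x _)%E = 0%E)//.
apply: integral0_eq => x _; rewrite /fubini_F/f/=.
under eq_integral do rewrite EFinM.
have iV : P.-integrable setT (EFin \o V).
  have := sqintM_integrable sV (sqint_cst P 1).
  by under eq_fun do rewrite mulr1.
rewrite integralZl//; last first.
  by apply: integrable_pushforward => //; rewrite preimage_setT.
rewrite integral_distribution//=.
rewrite (_ : (\int[P]_x _)%E = 0%E) ?mule0//.
rewrite -[LHS]fineK; last exact: integrable_fin_num.
by congr EFin.
Qed.

(** A product of two square-integrable functions is in general only integrable; here independence
    factors E[U^2 V^2]. *)
Lemma indep_sqintM (U V : Omega -> R) :
  preim_in U -> measurable_fun setT V ->
  independent_systems P (sigma_of V) G ->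
  sqint P U -> sqint P V ->
  sqint P (fun w => U w * V w) /\
  ip P (fun w => U w * V w) (fun w => U w * V w) = ip P U U * ip P V V.
Proof.
move=> GU mV iVG sU sV.
have mU := preim_in_measurable GU.
have E : (\int[P]_w ((U w * V w) ^+ 2)%:E = (ip P U U * ip P V V)%:E)%E.
  rewrite (@indep_integral _ _ U V (fun z => ((z.1 * z.2) ^+ 2)%:E))//; first last.
  - by move=> z; rewrite lee_fin sqr_ge0.
  - by apply/measurable_EFinP; apply: measurable_funX; exact: measurable_funM.
  transitivity (\int[P]_w ((U w ^+ 2)%:E * (ip P V V)%:E))%E.
    apply: eq_integral => w _; rewrite -ip_EFin// -ge0_integralZl//.
    - by apply: eq_integral => w' _ /=; rewrite exprMn EFinM.
    - by apply/measurable_EFinP; exact: measurable_funX.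
    - by move=> x _; rewrite lee_fin sqr_ge0.
    - by rewrite lee_fin sqr_ge0.
  rewrite ge0_integralZr//; first last.
  - by rewrite lee_fin ip_ge0.
  - by move=> x _; rewrite lee_fin sqr_ge0.
  - by apply/measurable_EFinP; exact: measurable_funX.
  by rewrite ip_EFin.
have sUV : sqint P (fun w => U w * V w).
  apply: sqintP; first exact: measurable_funM.
  by rewrite E ltry.
by split => //; apply: EFin_inj; rewrite -ip_EFin// E.
Qed.

(** Polarisation of [indep_sqintM]. The sum U + U' has its own hypothesis because [G] is only a
    family of sets here, not a sigma-algebra. *)
Lemma indep_ipM (U U' V : Omega -> R) :
  preim_in U -> preim_in U' -> preim_in (fun w => U w + U' w) ->
  measurable_fun setT V ->
  independent_systems P (sigma_of V) G ->
  sqint P U -> sqint P U' -> sqint P V ->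
  ip P (fun w => U w * V w) (fun w => U' w * V w) = ip P U U' * ip P V V.
Proof.
move=> GU GU' GUU' mV iVG sU sU' sV.
have [s1 e1] := indep_sqintM GU mV iVG sU sV.
have [s2 e2] := indep_sqintM GU' mV iVG sU' sV.
have [s3] := indep_sqintM GUU' mV iVG (sqintD sU sU') sV.
rewrite (_ : (fun w => (U w + U' w) * V w) = (fun w => U w * V w + U' w * V w)).
  by rewrite !ipD_sqr// e1 e2; lra.
by apply/funext => w; rewrite mulrDl.
Qed.

End independence.

(** * Moments of the normal law *)

Section normal_moments.
Context {R : realType}.
Local Notation mu := (@lebesgue_measure R).

Lemma continuous_expR_sqr (c : R) : continuous (fun x : R => expR (- (c * x ^+ 2))).
Proof.
move=> x; apply: (@continuous_comp _ _ _ (fun x : R => - (c * x ^+ 2)) expR).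
  apply: cvgN; apply: cvgM; first exact: cvg_cst.
  exact: exprn_continuous.
exact: continuous_expR.
Qed.

Lemma is_derive_expR_sqr (c x : R) :
  is_derive x 1 (fun x : R => - (2 * c)^-1 * expR (- (c * x ^+ 2)))
    ((2 * c)^-1 * (2 * c) * (x * expR (- (c * x ^+ 2)))).
Proof.
apply: is_derive_eq.
rewrite /GRing.scale/=; ring.
Qed.

Lemma cvg_expR_sqr (c : R) : 0 < c ->
  expR (- (c * x ^+ 2)) @[x --> +oo] --> (0 : R).
Proof.
move=> c0.
apply: (cvg_comp (fun x => c * x ^+ 2) (fun x => expR (- x))); last exact: cvgr_expR.
apply: gt0_cvgMry => //; exact: cvgr_expr2.
Qed.

Lemma integral_x_expR_sqr (c y : R) : 0 < c -> 0 <= y ->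
  (\int[mu]_(x in `[y, +oo[) (x * expR (- (c * x ^+ 2)))%:E =
   ((2 * c)^-1 * expR (- (c * y ^+ 2)))%:E)%E.
Proof.
move=> c0 y0.
have cn0 : 2 * c != 0 by rewrite mulf_neq0// gt_eqF.
pose F (x : R) := - (2 * c)^-1 * expR (- (c * x ^+ 2)).
have dF (x : R) : is_derive x 1 F (x * expR (- (c * x ^+ 2))).
  by have := is_derive_expR_sqr c x; rewrite mulVf// mul1r.
have cF : continuous F.
  by move=> x; apply: cvgM; [exact: cvg_cst|exact: continuous_expR_sqr].
rewrite (@ge0_continuous_FTC2y _ _ F _ 0).
- by rewrite -EFinB sub0r /F mulNr opprK.
- by move=> x yx; rewrite mulr_ge0 ?expR_ge0// (le_trans y0).
- apply: continuous_subspaceT => x; apply: cvgM; first exact: cvg_id.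
  exact: continuous_expR_sqr.
- rewrite -(mulr0 (- (2 * c)^-1)); apply: cvgM; first exact: cvg_cst.
  exact: cvg_expR_sqr.
- by move=> x _; have := dF x => -[].
- exact/cvg_at_right_filter/cF.
- by move=> x _; rewrite derive1E; have := dF x => -[].
Qed.

(** An integration by parts done by Tonelli: write x^2 as the integral of x over y in [0, x],
    exchange the integrals, and evaluate the one over x >= y with [integral_x_expR_sqr]. *)
Lemma integral0y_sqr_expR_sqr (c : R) : 0 < c ->
  (\int[mu]_(x in `[0%R, +oo[) (x ^+ 2 * expR (- (c * x ^+ 2)))%:E =
   ((2 * c)^-1)%:E * \int[mu]_(x in `[0%R, +oo[) (expR (- (c * x ^+ 2)))%:E)%E.
Proof.
move=> c0.
have c20 : 0 <= (2 * c)^-1 by rewrite invr_ge0 mulr_ge0// ltW.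
have mq : measurable_fun setT (fun x : R => expR (- (c * x ^+ 2))).
  by apply: continuous_measurable_fun; exact: continuous_expR_sqr.
pose f (z : R * R) : \bar R :=
  ((if (0 <= z.2) && (z.2 <= z.1) then 1 else 0) * (z.1 * expR (- (c * z.1 ^+ 2))))%:E.
have mf : measurable_fun setT f.
  apply/measurable_EFinP; apply: measurable_funM.
    apply: measurable_fun_ifT => //; apply: measurable_and;
      exact: measurable_fun_ler.
  apply: (@measurableT_comp _ _ _ _ _ _ (fun x : R => x * expR (- (c * x ^+ 2)))) => //.
  exact: measurable_funM.
have f0 z : (0 <= f z)%E.
  rewrite /f lee_fin; case: ifPn => [/andP[z0 z1]|_]; last by rewrite mul0r.
  by rewrite mul1r mulr_ge0 ?expR_ge0// (le_trans z0).
transitivity (\int[mu]_x \int[mu]_y f (x, y))%E.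
  rewrite [LHS]integral_mkcond; apply: eq_integral => x _.
  rewrite patchE; case: ifPn.
    rewrite inE/= in_itv/= andbT => x0.
    transitivity (\int[mu]_(y in `[0%R, x]) (x * expR (- (c * x ^+ 2)))%:E)%E.
      rewrite integral_cst//= lebesgue_measure_itv/= lte_fin oppr0 adde0.
      move: x0; rewrite le_eqVlt => /predU1P[<-|->].
        by rewrite ltxx expr0n/= mul0r mule0.
      by rewrite -EFinM expr2; congr EFin; ring.
    rewrite integral_mkcond; apply: eq_integral => y _.
    rewrite patchE /f/=; case: ifPn; rewrite ?inE ?notin_setE/= in_itv/=.
      by move=> ->; rewrite mul1r.
    by move/negP/negbTE => ->; rewrite mul0r.
  rewrite notin_setE/= in_itv/= andbT => /negP; rewrite -ltNge => x0.
  rewrite integral0_eq// => y _; rewrite /f/=.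
  case: ifPn => [/andP[y0 yx]|_]; last by rewrite mul0r.
  by move: (le_lt_trans (le_trans y0 yx) x0); rewrite ltxx.
rewrite (@fubini_tonelli _ _ (measurableTypeR R) (measurableTypeR R) R mu mu f mf f0).
rewrite -ge0_integralZl; last 4 first.
- by [].
- by apply/measurable_EFinP/measurable_funTS.
- by move=> x _; rewrite lee_fin expR_ge0.
- by rewrite lee_fin.
rewrite [RHS]integral_mkcond; apply: eq_integral => y _.
rewrite patchE; case: ifPn; rewrite ?inE ?notin_setE/= in_itv/= andbT.
  move=> y0; rewrite -EFinM -integral_x_expR_sqr// [RHS]integral_mkcond.
  apply: eq_integral => x _; rewrite patchE /f/= y0/=.
  rewrite mem_setE in_itv/= andbT.
  by case: ifPn => yx; rewrite ?mul1r ?mul0r.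
move/negP/negbTE => y0; rewrite integral0_eq// => x _.
by rewrite /f/= y0 mul0r.
Qed.

Lemma integral_sqr_expR_sqr (c : R) : 0 < c ->
  (\int[mu]_x (x ^+ 2 * expR (- (c * x ^+ 2)))%:E =
   ((2 * c)^-1)%:E * \int[mu]_x (expR (- (c * x ^+ 2)))%:E)%E.
Proof.
move=> c0.
have E : [set x : R | 0 <= x] = `[0, +oo[%classic.
  by apply/seteqP; split => x/=; rewrite in_itv/= andbT.
rewrite (@ge0_symfun_integralT _ (fun x => x ^+ 2 * expR (- (c * x ^+ 2)))); first last.
- by move=> x /=; rewrite sqrrN.
- move=> x; apply: (@continuousM _ _ (fun x : R => x ^+ 2)).
    exact: exprn_continuous.
  exact: continuous_expR_sqr.
- by move=> x; rewrite mulr_ge0 ?sqr_ge0 ?expR_ge0.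
rewrite (@ge0_symfun_integralT _ (fun x => expR (- (c * x ^+ 2)))); first last.
- by move=> x /=; rewrite sqrrN.
- exact: continuous_expR_sqr.
- by move=> x; rewrite expR_ge0.
by rewrite E integral0y_sqr_expR_sqr// muleCA.
Qed.

Lemma normal_pdf0E (s x : R) : s != 0 ->
  normal_pdf 0 s x = normal_peak s * expR (- ((2 * s ^+ 2)^-1 * x ^+ 2)).
Proof.
move=> s0; rewrite normal_pdfE//; congr (_ * expR _).
by rewrite subr0 mulNr mulrC mulr_natl.
Qed.

(** For c = 1 / (2 s^2) the factor 1 / (2 c) of [integral_sqr_expR_sqr] is s^2; what remains is the
    total mass 1 of the density. *)
Lemma integral_sqr_normal_pdf (s : R) : 0 < s ->
  (\int[mu]_x (x ^+ 2 * normal_pdf 0 s x)%:E = (s ^+ 2)%:E)%E.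
Proof.
move=> s0; have sn0 : s != 0 by rewrite gt_eqF.
pose c := (2 * s ^+ 2)^-1.
have c0 : 0 < c by rewrite invr_gt0 mulr_gt0// exprn_gt0.
have mq : measurable_fun setT (fun x : R => expR (- (c * x ^+ 2))).
  by apply: continuous_measurable_fun; exact: continuous_expR_sqr.
have p0 := normal_peak_ge0 s.
have : (\int[mu]_x (normal_pdf 0 s x)%:E = 1)%E by exact: integral_normal_pdf.
under eq_integral do rewrite normal_pdf0E//.
rewrite ge0_integral_mulEFin//.
move=> E.
under eq_integral do rewrite normal_pdf0E// mulrCA.
rewrite ge0_integral_mulEFin//; last 2 first.
- by apply: measurable_funM => //; exact: measurable_funX.
- by move=> x _; rewrite mulr_ge0 ?sqr_ge0 ?expR_ge0.
rewrite integral_sqr_expR_sqr// muleCA E mule1; congr EFin.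
by rewrite /c invfM invrK mulrA mulVf// mul1r.
Qed.

Lemma normal_probN (s : R) (B : set R) : 0 < s -> measurable B ->
  normal_prob 0 s (-%R @^-1` B) = normal_prob 0 s B.
Proof.
move=> s0 mB; rewrite /normal_prob.
rewrite integral_mkcond [RHS]integral_mkcond.
rewrite -(@ge0_integral_reflect _ 0 ((fun x => (normal_pdf 0 s x)%:E) \_ B)); last 2 first.
- apply/(measurable_restrictT _ _).1 => //.
  by apply/measurable_EFinP/measurable_funTS; exact: measurable_normal_pdf.
- by move=> x; rewrite patchE; case: ifPn => // _; rewrite lee_fin normal_pdf_ge0.
apply: eq_integral => x _; rewrite !patchE sub0r.
rewrite (_ : (x \in -%R @^-1` B) = (- x \in B)); last by apply/idP/idP => /[!inE].
by case: ifPn => // _; rewrite !normal_pdf0E ?gt_eqF// sqrrN.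
Qed.

(** The second moment is an integral against the density. For the mean, [normal_probN] says that V
    and -V have the same law, so E[V] = - E[V]. *)
Lemma normal_moments d (Omega : measurableType d) (P : probability Omega R)
    (V : Omega -> R) (s : R) : 0 < s -> measurable_fun setT V ->
  (forall B : set R, measurable B -> P (V @^-1` B) = normal_prob 0 s B) ->
  [/\ sqint P V, ip P V V = s ^+ 2 & \int[P]_w V w = 0].
Proof.
move=> s0 mV lV.
have mV' : measurable_fun (U := measurableTypeR R) setT V by exact: mV.
have mN : measurable_fun (U := measurableTypeR R) setT (fun w => - V w).
  by apply: (measurableT_comp (@oppr_measurable R setT)).
pose Vp : {mfun Omega >-> measurableTypeR R} :=
  HB.pack (V : Omega -> measurableTypeR R) (isMeasurableFun.Build _ _ _ _ _ mV').
pose Np : {mfun Omega >-> measurableTypeR R} :=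
  HB.pack ((fun w => - V w) : Omega -> measurableTypeR R)
    (isMeasurableFun.Build _ _ _ _ _ mN).
have E2 : (\int[P]_w (V w ^+ 2)%:E = (s ^+ 2)%:E)%E.
  rewrite -[LHS](@ge0_integral_distribution _ _ _ _ _ P Vp (fun x => (x ^+ 2)%:E)); last 2 first.
  - by apply/measurable_EFinP; exact: measurable_funX.
  - by move=> y; rewrite lee_fin sqr_ge0.
  transitivity (\int[normal_prob 0 s]_x (x ^+ 2)%:E)%E.
    by apply: eq_measure_integral => A mA _; exact: lV.
  rewrite -(integral_sqr_normal_pdf s0).
  rewrite -(@Radon_Nikodym_SigmaFinite.change_of_variables _ _ _
      (normal_prob 0 s) mu (normal_prob_dominates 0 s))//; last 2 first.
  - by move=> x; rewrite lee_fin sqr_ge0.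
  - by apply/measurable_EFinP; exact: measurable_funX.
  have dom := normal_prob_dominates 0 s.
  have mh := measurable_int _ (Radon_Nikodym_SigmaFinite.f_integrable dom).
  under [RHS]eq_integral do rewrite EFinM.
  have mp : measurable_fun setT (fun x : R => (normal_pdf 0 s x)%:E).
    by apply/measurable_EFinP; exact: measurable_normal_pdf.
  have mx2 : measurable_fun setT (fun x : R => (x ^+ 2)%:E).
    by apply/measurable_EFinP; exact: measurable_funX.
  apply: ae_eq_integral => //; [exact: emeasurable_funM..|].
  apply: ae_eqe_mul2l.
  (* The Radon-Nikodym derivative is known only through its integrals over measurable sets;
     comparing them identifies it with [normal_pdf] almost everywhere. *)
  apply: integral_ae_eq => //.
    exact: Radon_Nikodym_SigmaFinite.f_integrable.
  by move=> E _ mE; rewrite -Radon_Nikodym_SigmaFinite.f_integral.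
have sV : sqint P V by apply: sqintP => //; rewrite E2 ltry.
split => //.
  by apply: EFin_inj; rewrite -ip_EFin// E2.
have iV : P.-integrable setT (EFin \o V).
  have := sqintM_integrable sV (sqint_cst P 1).
  by under eq_fun do rewrite mulr1.
have EN : \int[P]_w (- V w) = \int[P]_w V w.
  have iN : P.-integrable setT (EFin \o (fun w => - V w)).
    have := sqintM_integrable (sqintN sV) (sqint_cst P 1).
    by under eq_fun do rewrite mulr1.
  have imE (Y : {mfun Omega >-> measurableTypeR R}) : P.-integrable setT (EFin \o Y) ->
      \int[P]_w Y w = fine (\int[distribution P Y]_x x%:E)%E.
    move=> iY; rewrite integral_distribution//; exact/measurable_EFinP.
  rewrite (imE Np)// (imE Vp)//; congr fine.
  apply: eq_measure_integral => A mA _.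
  rewrite /distribution /pushforward.
  rewrite [RHS]lV// -normal_probN// -lV//.
  by rewrite -[X in measurable X]setTI; exact: oppr_measurable.
have := @RintegralZl _ _ _ P setT V (-1) measurableT iV.
under eq_Rintegral do rewrite mulN1r.
by rewrite EN; lra.
Qed.
End normal_moments.

(** * Ito isometry *)

Section preim_in_sigma_algebra.
Context d (Omega : measurableType d) (G : set (set Omega)).
Hypothesis sG : sigma_algebra setT G.

(** The bridge to ordinary measurability: once [G] is a sigma-algebra, closure under pairing and
    composition is inherited from measurable functions on the space that carries [G]. *)
Lemma preim_in_g_sigma d' (T' : measurableType d') (U : Omega -> T') :
  preim_in G U <-> measurable_fun (T := g_sigma_algebraType G) setT U.
Proof.
split=> [h _ B mB|h B mB].
  by rewrite setTI; apply: sub_sigma_algebra; exact: h.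
have := h measurableT B mB; rewrite setTI => mU.
rewrite -(sigma_algebra_id sG); exact: mU.
Qed.

Lemma preim_in_comp d1 d2 (T1 : measurableType d1) (T2 : measurableType d2)
    (U : Omega -> T1) (f : T1 -> T2) :
  measurable_fun setT f -> preim_in G U -> preim_in G (fun w => f (U w)).
Proof.
move=> mf hU B mB; have := hU (f @^-1` B); apply.
by rewrite -[X in measurable X]setTI; exact: mf.
Qed.

Lemma preim_in_pair d1 d2 (T1 : measurableType d1) (T2 : measurableType d2)
    (U : Omega -> T1) (V : Omega -> T2) :
  preim_in G U -> preim_in G V -> preim_in G (fun w => (U w, V w)).
Proof.
by rewrite !preim_in_g_sigma => hU hV; exact/measurable_fun_pair.
Qed.

Lemma preim_in_comp2 d1 d2 d3 (T1 : measurableType d1) (T2 : measurableType d2)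
    (T3 : measurableType d3) (U : Omega -> T1) (V : Omega -> T2)
    (f : T1 * T2 -> T3) :
  measurable_fun setT f -> preim_in G U -> preim_in G V ->
  preim_in G (fun w => f (U w, V w)).
Proof. by move=> mf hU hV; exact/(preim_in_comp mf)/preim_in_pair. Qed.

Context {R : realType}.
Implicit Types U V : Omega -> R.

Lemma preim_inD U V : preim_in G U -> preim_in G V -> preim_in G (fun w => U w + V w).
Proof.
by apply: (@preim_in_comp2 _ _ _ R R R U V (fun z : R * R => z.1 + z.2)); exact: measurable_funD.
Qed.

Lemma preim_inB U V : preim_in G U -> preim_in G V -> preim_in G (fun w => U w - V w).
Proof.
by apply: (@preim_in_comp2 _ _ _ R R R U V (fun z : R * R => z.1 - z.2)); exact: measurable_funB.
Qed.

Lemma preim_inM U V : preim_in G U -> preim_in G V -> preim_in G (fun w => U w * V w).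
Proof.
by apply: (@preim_in_comp2 _ _ _ R R R U V (fun z : R * R => z.1 * z.2)); exact: measurable_funM.
Qed.

Lemma preim_in_cst (c : R) : preim_in G (fun=> c).
Proof.
move=> B mB; have : measurable_fun (T := g_sigma_algebraType G) setT (fun=> c).
  exact: measurable_cst.
by rewrite -preim_in_g_sigma; exact.
Qed.

Lemma preim_in_sum (I : Type) (s : seq I) (f : I -> Omega -> R) :
  (forall i, preim_in G (f i)) -> preim_in G (fun w => \sum_(i <- s) f i w).
Proof.
move=> hf; elim: s => [|i s ih].
  by under eq_fun do rewrite big_nil; exact: preim_in_cst.
by under eq_fun do rewrite big_cons; exact: preim_inD.
Qed.

End preim_in_sigma_algebra.

Section sqint_bounded.
Context d (T : measurableType d) (R : realType) (m : {measure set T -> \bar R}).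

Lemma sqintM_bounded (f g : T -> R) (M : R) : measurable_fun setT g ->
  (forall x, `|g x| <= M) -> sqint m f -> sqint m (fun x => f x * g x).
Proof.
move=> mg gM sf.
have := sqintZ M sf => -[_ i_f].
apply: (@sqint_le _ _ _ _ _ (fun x => (M * f x) ^+ 2)) => //.
- by apply: measurable_funM => //; case: sf.
- move=> x; rewrite !exprMn mulrC ler_wpM2r ?sqr_ge0//.
  by rewrite -[leLHS]real_normK ?num_real// ler_pXn2r ?nnegrE// (le_trans _ (gM x)).
Qed.

End sqint_bounded.

Lemma sqint_bounded d (T : measurableType d) (R : realType) (P : probability T R)
  (f : T -> R) (M : R) : measurable_fun setT f -> (forall x, `|f x| <= M) ->
  sqint P f.
Proof.
move=> mf fM; have := sqintM_bounded mf fM (sqint_cst P 1).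
by under eq_fun do rewrite mul1r.
Qed.

Section brownian_increments.
Context d (Omega : measurableType d) (R : realType) (P : probability Omega R).
Variables (F : R -> set (set Omega)) (W : R -> Omega -> R).
Hypotheses (hF : usual_filtration P F) (hW : brownian_motion P F W).

Lemma filtration_sigma t : 0 <= t -> sigma_algebra setT (F t).
Proof. by move=> t0; have [/(_ t t0)[]] := hF. Qed.

Lemma filtration_measurable t : 0 <= t -> F t `<=` measurable.
Proof. by move=> t0; have [/(_ t t0)[]] := hF. Qed.

Lemma preim_in_le d' (T' : measurableType d') (U : Omega -> T') s t :
  0 <= s -> s <= t -> preim_in (F s) U -> preim_in (F t) U.
Proof. by move=> s0 st hU B mB; have [_ /(_ s t s0 st) + _ _] := hF; apply; exact: hU. Qed.

Lemma preim_in_meas d' (T' : measurableType d') (U : Omega -> T') s :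
  0 <= s -> preim_in (F s) U -> measurable_fun setT U.
Proof. by move=> s0; exact/preim_in_measurable/filtration_measurable. Qed.

Lemma preim_inW t : 0 <= t -> preim_in (F t) (W t).
Proof. by move=> t0; case: hW => /(_ t t0) + _ _ _ _; rewrite measurable_wrtP. Qed.

Lemma preim_in_incr s t : 0 <= s -> s <= t ->
  preim_in (F t) (fun w => W t w - W s w).
Proof.
move=> s0 st; have t0 := le_trans s0 st.
apply: preim_inB; [exact: filtration_sigma|exact: preim_inW|].
by apply: preim_in_le st _ => //; exact: preim_inW.
Qed.

Lemma incr_moments s t : 0 <= s -> s <= t ->
  [/\ sqint P (fun w => W t w - W s w),
   ip P (fun w => W t w - W s w) (fun w => W t w - W s w) = t - s &
   \int[P]_w (W t w - W s w) = 0].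
Proof.
move=> s0; rewrite le_eqVlt => /predU1P[<-|st].
  under eq_fun do rewrite subrr.
  by rewrite /ip !Rintegral_cst// !mul0r subrr; split => //; exact: sqint0.
have ts : 0 < t - s by rewrite subr_gt0.
have t0 := le_trans s0 (ltW st).
have mV : measurable_fun setT (fun w => W t w - W s w).
  exact: preim_in_meas (preim_in_incr s0 (ltW st)).
have lV (B : set R) : measurable B ->
    P ((fun w => W t w - W s w) @^-1` B) = normal_prob 0 (Num.sqrt (t - s)) B.
  by case: hW => _ _ _ _ /(_ s t s0 st) h mB; exact: h.
have sq0 : 0 < Num.sqrt (t - s) by rewrite sqrtr_gt0.
by have [h1 h2 h3] := normal_moments sq0 mV lV; rewrite h2 sqr_sqrtr ?ltW.
Qed.

Lemma incr_ip0 (U : Omega -> R) s t : 0 <= s -> s <= t ->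
  preim_in (F s) U -> sqint P U -> ip P U (fun w => W t w - W s w) = 0.
Proof.
move=> s0 st GU sU; have [s2 _ m0] := incr_moments s0 st.
move: st; rewrite le_eqVlt => /predU1P[ts|st].
  by rewrite ts /ip; under eq_Rintegral do rewrite subrr mulr0; rewrite Rintegral_cst// mul0r.
apply: (@indep_ip0 _ _ _ P (F s)) => //.
- exact: filtration_measurable.
- by case: s2.
- by case: hW => _ _ _ /(_ s t s0 st).
Qed.

Lemma incr_ipM (U U' : Omega -> R) s t : 0 <= s -> s <= t ->
  preim_in (F s) U -> preim_in (F s) U' -> sqint P U -> sqint P U' ->
  sqint P (fun w => U w * (W t w - W s w)) /\
  ip P (fun w => U w * (W t w - W s w)) (fun w => U' w * (W t w - W s w))
    = ip P U U' * (t - s).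
Proof.
move=> s0 st GU GU' sU sU'; have [s2 e2 m0] := incr_moments s0 st.
move: st; rewrite le_eqVlt => /predU1P[ts|st].
  rewrite ts subrr mulr0; under eq_fun do rewrite subrr mulr0.
  split; first exact: sqint0.
  by rewrite /ip; under eq_Rintegral do rewrite mul0r; rewrite Rintegral_cst// mul0r.
have ind : independent_systems P (sigma_of (W t \- W s)) (F s).
  by case: hW => _ _ _ /(_ s t s0 st).
have mV := s2.1.
split; first by have [] := indep_sqintM (filtration_measurable s0) GU mV ind sU s2.
rewrite -e2; apply: (indep_ipM (filtration_measurable s0) GU GU' _ mV ind sU sU' s2).
by apply: preim_inD => //; exact: filtration_sigma.
Qed.

Definition step (xi : Omega -> R) a b w := xi w * (W b w - W a w).

(** Measurability at time a is required only when a < b. Cutting a simple process at a time t before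
    its interval leaves the degenerate interval from t to t, whose coefficient may be measurable
    only later. *)
Definition bounded_coef (xi : Omega -> R) (a b : R) : Prop :=
  [/\ 0 <= a, a <= b, exists M, forall w, `|xi w| <= M &
      measurable_fun setT xi /\ (a < b -> preim_in (F a) xi)].

Lemma bounded_coef_sqint xi a b : bounded_coef xi a b -> sqint P xi.
Proof. by move=> [_ _ [M xiM] [mxi _]]; exact: sqint_bounded xiM. Qed.

Lemma step0 xi a : step xi a a = fun=> 0.
Proof. by apply/funext => w; rewrite /step subrr mulr0. Qed.

Lemma ip0l d' (T : measurableType d') (m : {measure set T -> \bar R}) (f : T -> R) :
  ip m (fun=> 0) f = 0.
Proof. by rewrite /ip; under eq_Rintegral do rewrite mul0r; rewrite Rintegral_cst// mul0r. Qed.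

Lemma step_sqint xi a b : bounded_coef xi a b -> sqint P (step xi a b).
Proof.
move=> hx; have sx := bounded_coef_sqint hx; case: hx => a0 ab _ [_].
move: ab; rewrite le_eqVlt => /predU1P[<- _|ab /(_ ab) px].
  by rewrite step0; exact: sqint0.
by have [] := incr_ipM a0 (ltW ab) px px sx sx.
Qed.

Lemma step_preim xi a b c : bounded_coef xi a b -> b <= c -> preim_in (F c) (step xi a b).
Proof.
case=> a0 + _ [_]; rewrite le_eqVlt => /predU1P[<-|ab] px bc.
  by rewrite step0; apply: preim_in_cst; apply: filtration_sigma; exact: le_trans bc.
have ac : a <= c by rewrite (le_trans (ltW ab)).
apply: preim_inM.
- by apply: filtration_sigma; exact: (le_trans a0).
- exact: preim_in_le (px ab).
- apply: preim_in_le (preim_in_incr a0 (ltW ab)) => //.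
  by rewrite (le_trans a0 (ltW ab)).
Qed.

Lemma step_ip0 (U : Omega -> R) eta c d' : 0 <= c -> preim_in (F c) U -> sqint P U ->
  bounded_coef eta c d' -> ip P U (step eta c d') = 0.
Proof.
move=> c0 pU sU he; have se := step_sqint he; case: he => _ cd [M eM] [me].
move: cd; rewrite le_eqVlt => /predU1P[<- _|cd /(_ cd) pe].
  by rewrite step0 ipC ip0l.
transitivity (ip P (fun w => U w * eta w) (fun w => W d' w - W c w)).
  by apply: eq_Rintegral => w _; rewrite /step mulrA.
apply: incr_ip0 => //; first exact: ltW.
  by apply: preim_inM => //; exact: filtration_sigma.
exact: sqintM_bounded eM sU.
Qed.

Lemma stepD xi a b c w : step xi a c w = step xi a b w + step xi b c w.
Proof. by rewrite /step; ring. Qed.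

Lemma bounded_coef_sub xi a b a' b' : bounded_coef xi a b -> a <= a' -> a' <= b' ->
  b' <= b -> bounded_coef xi a' b'.
Proof.
case=> a0 ab bx [mx px] aa ab' bb; split => //; first exact: le_trans aa.
split=> // lt; apply: (preim_in_le a0 aa); apply: px.
by rewrite (le_lt_trans aa)// (lt_le_trans lt).
Qed.

(** The length of the intersection of ]a, b] and ]c, d'], as [overlapE] confirms. *)
Definition overlap (a b c d' : R) := Num.max 0 (Num.min b d' - Num.max a c).

(** Cut both increments at c and at the smaller of b and d'. Pieces over disjoint intervals are
    orthogonal, since the later increment is centred and independent of the past; the common piece
    contributes its length. *)
Lemma step_ip_le xi a b eta c d' : bounded_coef xi a b -> bounded_coef eta c d' ->
  a <= c -> ip P (step xi a b) (step eta c d') = ip P xi eta * overlap a b c d'.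
Proof.
move=> hx he ac; have [a0 ab _ [_ px]] := hx; have [c0 cd _ [_ pe]] := he.
have sx := bounded_coef_sqint hx; have se := bounded_coef_sqint he.
rewrite /overlap (max_r ac).
have [bc|cb] := leP b c.
  rewrite max_l ?mulr0; last by rewrite subr_le0 ge_min bc.
  apply: step_ip0 => //; [exact: step_preim|exact: step_sqint].
have hxac : bounded_coef xi a c by apply: (bounded_coef_sub hx) => //; exact: ltW.
have hxcb : bounded_coef xi c b by apply: (bounded_coef_sub hx) => //; exact: ltW.
have [dc|lt_cd] := leP d' c.
  have -> : d' = c by apply/eqP; rewrite eq_le dc cd.
  by rewrite step0 ipC ip0l min_r ?subrr ?maxxx ?mulr0// ltW.
have pxc : preim_in (F c) xi.
  by apply: (preim_in_le a0 ac) => //; apply: px; exact: le_lt_trans cb.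
have pec := pe lt_cd.
rewrite (_ : step xi a b = fun w => step xi a c w + step xi c b w); last first.
  by apply/funext => w; exact: stepD.
rewrite ipDl; [|exact: step_sqint..].
rewrite (@step_ip0 (step xi a c))//; [|exact: step_preim|exact: step_sqint].
rewrite add0r.
have [bd|db] := leP b d'.
  have hecb : bounded_coef eta c b by apply: (bounded_coef_sub he) => //; exact: ltW.
  have hebd : bounded_coef eta b d' by apply: (bounded_coef_sub he) => //; exact: ltW.
  rewrite (_ : step eta c d' = fun w => step eta c b w + step eta b d' w); last first.
    by apply/funext => w; exact: stepD.
  rewrite ipDr; [|exact: step_sqint..].
  rewrite [X in _ + X]step_ip0//; [|by rewrite (le_trans a0)|exact: step_preim|exact: step_sqint].
  rewrite addr0 max_r ?subr_ge0 ?(ltW cb)//.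
  by have [] := incr_ipM c0 (ltW cb) pxc pec sx se.
have hxcd : bounded_coef xi c d' by apply: (bounded_coef_sub hxcb) => //; exact: ltW.
have hxdb : bounded_coef xi d' b by apply: (bounded_coef_sub hxcb) => //; exact: ltW.
rewrite (_ : step xi c b = fun w => step xi c d' w + step xi d' b w); last first.
  by apply/funext => w; exact: stepD.
rewrite ipDl; [|exact: step_sqint..].
rewrite [X in _ + X]ipC [X in _ + X]step_ip0//; [|by rewrite (le_trans c0)|exact: step_preim|exact: step_sqint].
rewrite addr0 max_r ?subr_ge0//.
by have [] := incr_ipM c0 cd pxc pec sx se.
Qed.

Lemma step_ip xi a b eta c d' : bounded_coef xi a b -> bounded_coef eta c d' ->
  ip P (step xi a b) (step eta c d') = ip P xi eta * overlap a b c d'.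
Proof.
move=> hx he; have [ac|/ltW ca] := leP a c; first exact: step_ip_le.
by rewrite ipC step_ip_le// (ipC _ eta) /overlap (minC d') (maxC c).
Qed.

End brownian_increments.

(** * The product of Lebesgue measure and P *)

Section time_product.
Context d (Omega : measurableType d) (R : realType) (P : probability Omega R).
Local Notation mu := (@lebesgue_measure R).
Local Notation T := (measurableTypeR R * Omega)%type.
Local Notation Q := (mu \x P)%E.

Lemma time_product_integral (A : set R) (h : Omega -> R) :
  measurable A -> (mu A < +oo)%E -> P.-integrable setT (EFin \o h) ->
  Q.-integrable setT (fun z : T => (h z.2 * \1_A z.1)%:E) /\
  \int[Q]_z (h z.2 * \1_A z.1) = (\int[P]_w h w) * fine (mu A).
Proof.
move=> mA Aoo ih.
have mh : measurable_fun setT h by apply/measurable_EFinP; exact: measurable_int ih.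
have m1A : measurable_fun setT (fun s : measurableTypeR R => \1_A s : R).
  exact: measurable_indic.
have mf : measurable_fun setT (fun z : T => (h z.2 * \1_A z.1)%:E).
  apply/measurable_EFinP; apply: measurable_funM.
    exact: measurableT_comp.
  exact: (measurableT_comp m1A).
have i_f : Q.-integrable setT (fun z : T => (h z.2 * \1_A z.1)%:E).
  apply/integrable21ltyP => //=.
  under eq_integral => y _.
    under eq_integral => x _ do rewrite normrM (ger0_norm (_ : 0 <= \1_A x))//.
    rewrite ge0_integral_mulEFin; [|by []|exact: normr_ge0|exact: m1A|by move=> x _; rewrite indicE].
    rewrite integral_indic// setIT.
    over.
  rewrite ge0_integralZr; last 4 first.
  - by [].
  - by apply/measurable_EFinP; exact: measurableT_comp.
  - by move=> *; rewrite lee_fin.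
  - exact: measure_ge0.
  rewrite lte_mul_pinfty//.
  - by apply: integral_ge0 => *; rewrite lee_fin.
  - rewrite ge0_fin_numE; last by apply: integral_ge0 => *; rewrite lee_fin.
    by case/integrableP : ih.
split=> //; rewrite /Rintegral -integral21_prod_meas1//.
rewrite -[RHS]RintegralZr//; congr fine; apply: eq_integral => w _.
rewrite /fubini_G/=; under eq_integral do rewrite EFinM.
rewrite integralZl//; last first.
  apply/integrableP; split; first exact/measurable_EFinP.
  under eq_integral do rewrite /= ger0_norm//.
  by rewrite integral_indic// setIT.
by rewrite integral_indic// setIT EFinM fineK// ge0_fin_numE.
Qed.

Lemma time_product_ip (A B : set R) (xi eta : Omega -> R) :
  measurable A -> measurable B -> (mu A < +oo)%E -> (mu B < +oo)%E ->
  sqint P xi -> sqint P eta ->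
  sqint Q (fun z : T => xi z.2 * \1_A z.1) /\
  ip Q (fun z : T => xi z.2 * \1_A z.1) (fun z : T => eta z.2 * \1_B z.1)
    = ip P xi eta * fine (mu (A `&` B)).
Proof.
move=> mA mB Aoo Boo sx se; split.
  split.
    apply: measurable_funM; first by apply: measurableT_comp => //; case: sx.
    apply: (measurableT_comp (_ : measurable_fun setT (fun s : measurableTypeR R => \1_A s : R))) => //.
    exact: measurable_indic.
  have [+ _] := @time_product_integral A (fun w => xi w ^+ 2) mA Aoo sx.2.
  congr (_.-integrable _ _); apply/funext => z; congr EFin.
  by rewrite exprMn indicE; case: (_ \in _); rewrite ?expr1n ?expr0n.
have mAB : measurable (A `&` B) by exact: measurableI.
have ABoo : (mu (A `&` B) < +oo)%E.
  by rewrite (le_lt_trans _ Aoo)// le_measure ?inE//; exact: measurableI.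
have [_ <-] := time_product_integral mAB ABoo (sqintM_integrable sx se).
by apply: eq_Rintegral => z _; rewrite indicI/=; ring.
Qed.

(** Extension by zero puts the spaces L^2([0, t] x Omega) for all t inside the single space
    L^2([Q]), so that integrands with different horizons can be paired. *)
Definition lift (t : R) (Y : R -> Omega -> R) : T -> R :=
  fun z => if (0 <= z.1) && (z.1 <= t) then Y z.1 z.2 else 0.

Lemma liftE t Y : lift t Y = (fun z : T => Y z.1 z.2) \_ (`[0, t] `*` setT).
Proof.
apply/funext => z; rewrite /lift patchE.
have -> : (z \in `[0%R, t] `*` [set: Omega]) = (0 <= z.1 <= t).
  by apply/idP/idP; rewrite inE/= in_itv/=; [case|].
by case: ifP.
Qed.

Lemma measurable_lift t Y :
  measurable_fun ((`[0, t] : set R) `*` setT) (fun z : R * Omega => Y z.1 z.2) ->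
  measurable_fun setT (lift t Y).
Proof.
move=> mY; rewrite liftE; apply/(measurable_restrictT _ _).1 => //.
exact: measurableX.
Qed.

Lemma lift_dist2 t Y Y' :
  measurable_fun setT (lift t Y) -> measurable_fun setT (lift t Y') ->
  (\int[P]_w \int[mu]_(s in `[0%R, t]) ((Y s w - Y' s w) ^+ 2)%:E =
  \int[Q]_z ((lift t Y z - lift t Y' z) ^+ 2)%:E)%E.
Proof.
move=> mY mY'; rewrite fubini_tonelli2; last 2 first.
- by apply/measurable_EFinP; apply: measurable_funX; exact: measurable_funB.
- by move=> z; rewrite lee_fin sqr_ge0.
apply: eq_integral => w _; rewrite integral_mkcond.
apply: eq_integral => s _; rewrite patchE mem_setE in_itv/= /lift/=.
by case: ifPn => //; rewrite subrr expr0n.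
Qed.

(** Approximation on [0, t] is also approximation on every shorter interval; this is what lets one
    approximating sequence serve two horizons. *)
Lemma lift_sub_le s t Y Y' : s <= t ->
  sqint Q (fun z => lift t Y z - lift t Y' z) ->
  measurable_fun setT (lift s Y) -> measurable_fun setT (lift s Y') ->
  sqint Q (fun z => lift s Y z - lift s Y' z) /\
  ip Q (fun z => lift s Y z - lift s Y' z) (fun z => lift s Y z - lift s Y' z) <=
  ip Q (fun z => lift t Y z - lift t Y' z) (fun z => lift t Y z - lift t Y' z).
Proof.
move=> st sq mY mY'.
have le z : (lift s Y z - lift s Y' z) ^+ 2 <= (lift t Y z - lift t Y' z) ^+ 2.
  rewrite /lift; case: ifPn => [/andP[-> zs]|_]; first by rewrite (le_trans zs st).
  by rewrite subrr expr0n sqr_ge0.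
have ss : sqint Q (fun z => lift s Y z - lift s Y' z).
  by apply: (sqint_le _ sq.2 le); exact: measurable_funB.
split=> //; rewrite !ip_sqr; apply: le_Rintegral => //.
- exact: ss.2.
- exact: sq.2.
Qed.

End time_product.

Lemma ip_sumr d (T : measurableType d) (R : realType)
    (m : {measure set T -> \bar R}) (I : Type) (s : seq I) (f : I -> T -> R) h :
  (forall i, sqint m (f i)) -> sqint m h ->
  ip m h (fun x => \sum_(i <- s) f i x) = \sum_(i <- s) ip m h (f i).
Proof.
by move=> hf hh; rewrite ipC ip_suml//; apply: eq_bigr => i _; rewrite ipC.
Qed.

Section ito.
Context d (Omega : measurableType d) (R : realType) (P : probability Omega R).
Variables (F : R -> set (set Omega)) (W : R -> Omega -> R).
Hypotheses (hF : usual_filtration P F) (hW : brownian_motion P F W).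
Local Notation mu := (@lebesgue_measure R).
Local Notation T := (measurableTypeR R * Omega)%type.
Local Notation Q := (mu \x P)%E.
Implicit Types (S : @simple_process R d Omega) (Y : R -> Omega -> R) (s t : R).

Lemma lebesgue_oc_lty (a b : R) : (mu (`]a, b]%classic : set R) < +oo)%E.
Proof. by rewrite lebesgue_measure_itv/=; case: ifP => _; rewrite ?ltry// -EFinD ltry. Qed.

Lemma overlapE (a b c e : R) :
  fine (mu ((`]a, b]%classic : set R) `&` `]c, e])) = overlap a b c e.
Proof.
rewrite (_ : _ `&` _ = `]Num.max a c, Num.min b e]%classic); last first.
  apply/seteqP; split => x/=; rewrite !in_itv/= gt_max le_min.
    by move=> [/andP[-> ->] /andP[-> ->]].
  by move=> /andP[/andP[-> ->] /andP[-> ->]].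
rewrite lebesgue_measure_itv/= lte_fin /overlap.
have [lt|le] := ltP (Num.max a c) (Num.min b e).
  by rewrite [RHS]max_r ?subr_ge0 ?ltW// -EFinD.
by rewrite [RHS]max_l ?subr_le0.
Qed.

Lemma oc_product_ip (a b c e : R) (xi eta : Omega -> R) : sqint P xi -> sqint P eta ->
  sqint Q (fun z : T => xi z.2 * \1_(`]a, b]) z.1) /\
  ip Q (fun z : T => xi z.2 * \1_(`]a, b]) z.1) (fun z : T => eta z.2 * \1_(`]c, e]) z.1)
  = ip P xi eta * overlap a b c e.
Proof.
move=> sx se; rewrite -overlapE.
exact: (time_product_ip (measurable_itv _) (measurable_itv _)
  (lebesgue_oc_lty _ _) (lebesgue_oc_lty _ _) sx se).
Qed.

Section simple.
Variables (S : @simple_process R d Omega).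
Hypothesis hS : simple_adapted F S.

Lemma sp_time_ge0 i : 0 <= sp_time S i.
Proof.
by have [t0 ts _ _] := hS; elim: i => // i /le_trans; apply.
Qed.

Lemma sp_bounded_coef t i : 0 <= t ->
  bounded_coef F (sp_coef S i) (Num.min (sp_time S i) t) (Num.min (sp_time S i.+1) t).
Proof.
move=> t0; have ti := sp_time_ge0 i; have [_ ts ms [M bM]] := hS.
have px : preim_in (F (sp_time S i)) (sp_coef S i).
  by rewrite -measurable_wrtP.
split.
- by rewrite le_min ti t0.
- by rewrite le_min2// ts.
- by exists M.
split; first exact: (preim_in_meas hF ti).
rewrite lt_min => /andP[_ lt].
by rewrite min_l//; move: lt; rewrite gt_min ltxx orbF => /ltW.
Qed.

Lemma simple_integralE t : simple_integral S W t =
  fun w => \sum_(i < sp_size S)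
    step W (sp_coef S i) (Num.min (sp_time S i) t) (Num.min (sp_time S i.+1) t) w.
Proof. by []. Qed.

Lemma simple_integral_sqint t : 0 <= t -> sqint P (simple_integral S W t).
Proof.
move=> t0; rewrite simple_integralE; apply: sqint_sum => i.
exact: (step_sqint hF hW (sp_bounded_coef _ t0)).
Qed.

Lemma lift_simpleE t : 0 <= t -> lift t (simple_value S) =
  fun z => \sum_(i < sp_size S)
    sp_coef S i z.2 * \1_(`]Num.min (sp_time S i) t, Num.min (sp_time S i.+1) t]) z.1.
Proof.
move=> t0; apply/funext => z; rewrite /lift /simple_value.
have E i : (\1_(`]Num.min (sp_time S i) t, Num.min (sp_time S i.+1) t]) z.1 : R) =
  if (0 <= z.1) && (z.1 <= t) then \1_(`]sp_time S i, sp_time S i.+1]) z.1 else 0.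
  have ti := sp_time_ge0 i.
  rewrite !indicE !mem_setE !in_itv/= gt_min le_min.
  have [zt|tz] := leP z.1 t; last first.
    by rewrite /= !andbF.
  rewrite !andbT orbF; case: ifPn => //; rewrite -ltNge => z0.
  by rewrite ltNge (ltW (lt_le_trans z0 ti)).
under [RHS]eq_bigr do rewrite E.
case: ifP => _ //; rewrite big1// => i _; by rewrite mulr0.
Qed.

Lemma lift_simple_term t (i : nat) : 0 <= t -> sqint Q (fun z : T => sp_coef S i z.2 *
   \1_(`]Num.min (sp_time S i) t, Num.min (sp_time S i.+1) t]) z.1).
Proof.
move=> t0; have sx := bounded_coef_sqint P (sp_bounded_coef i t0).
exact: (oc_product_ip _ _ 0 0 sx sx).1.
Qed.

Lemma lift_simple_sqint t : 0 <= t -> sqint Q (lift t (simple_value S)).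
Proof.
by move=> t0; rewrite lift_simpleE//; apply: sqint_sum => i; exact: lift_simple_term.
Qed.

End simple.

(** The Ito isometry in polarised form and with two horizons: both sides expand into the same double
    sum of terms E[xi eta] * [overlap]. *)
Lemma simple_ip S S' s t : simple_adapted F S -> simple_adapted F S' ->
  0 <= s -> 0 <= t ->
  ip P (simple_integral S W s) (simple_integral S' W t) =
  ip Q (lift s (simple_value S)) (lift t (simple_value S')).
Proof.
move=> hS hS' s0 t0; rewrite !lift_simpleE// !simple_integralE.
have st1 i := step_sqint hF hW (sp_bounded_coef hS i s0).
have st2 i := step_sqint hF hW (sp_bounded_coef hS' i t0).
rewrite ip_suml//; last by apply: sqint_sum => i; exact: st2.
rewrite ip_suml; last 2 first.
- by move=> i; exact: lift_simple_term.
- by apply: sqint_sum => i; exact: lift_simple_term.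
apply: eq_bigr => i _.
rewrite ip_sumr// ip_sumr; last 2 first.
- by move=> j; exact: lift_simple_term.
- exact: lift_simple_term.
apply: eq_bigr => j _.
rewrite (step_ip hF hW)//; [|exact: sp_bounded_coef..].
by rewrite (oc_product_ip _ _ _ _ _ _).2//; apply: bounded_coef_sqint;
  exact: sp_bounded_coef.
Qed.

(** The content of [ito_integral] in the language of [ip]: real-valued distances, with the
    square-integrability of the limits made explicit. *)
Record ito_approx Y t I (S : nat -> @simple_process R d Omega) : Prop := {
  ito_approx_adapted : forall n, simple_adapted F (S n) ;
  ito_approx_Y : sqint Q (lift t Y) ;
  ito_approx_I : sqint P I ;
  ito_approx_cvgY : ip Q (fun z => lift t (simple_value (S n)) z - lift t Y z)
      (fun z => lift t (simple_value (S n)) z - lift t Y z) @[n --> \oo] --> 0 ;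
  ito_approx_cvgI : ip P (fun w => simple_integral (S n) W t w - I w)
      (fun w => simple_integral (S n) W t w - I w) @[n --> \oo] --> 0 }.

Lemma sqint_cvg0 d' (T' : measurableType d') (m : {measure set T' -> \bar R})
    (g : nat -> T' -> R) : (forall n, measurable_fun setT (g n)) ->
  (\int[m]_x (g n x ^+ 2)%:E @[n --> \oo] --> 0)%E ->
  (\forall n \near \oo, sqint m (g n)) /\ ip m (g n) (g n) @[n --> \oo] --> 0.
Proof.
move=> mg; move=> /fine_cvgP[fin cv]; split; last exact: cv.
apply: filterS fin => n; rewrite ge0_fin_numE ?integral_ge0//.
  exact: sqintP.
by move=> x _; rewrite lee_fin sqr_ge0.
Qed.

Lemma ito_integral_approx Y t I : 0 <= t -> ito_integral P F W Y t I ->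
  exists S : nat -> @simple_process R d Omega, ito_approx Y t I S.
Proof.
move=> t0 [mY _ mI [S [hS cY cI]]].
have mL := measurable_lift mY.
have mSL n : measurable_fun setT (lift t (simple_value (S n))).
  by case: (lift_simple_sqint (hS n) t0).
have mSI n : measurable_fun setT (simple_integral (S n) W t).
  by case: (simple_integral_sqint (hS n) t0).
have [] := @sqint_cvg0 _ _ Q (fun n z => lift t (simple_value (S n)) z - lift t Y z).
- by move=> n; exact: measurable_funB.
- by move: cY; under eq_fun do rewrite lift_dist2//.
move=> nY cvY.
have [] := @sqint_cvg0 _ _ P (fun n w => simple_integral (S n) W t w - I w).
- by move=> n; exact: measurable_funB.
- by move: cI; under eq_fun do rewrite unlock.
move=> nI cvI.
exists S; split => //.
(* The limit is in L^2 because, for one large n, both the approximation and its difference with the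
   limit are. *)
- have [n _ /(_ n (leqnn n)) h] := nY.
  have := sqintB (lift_simple_sqint (hS n) t0) h.
  congr sqint; apply/funext => z; ring.
- have [n _ /(_ n (leqnn n)) h] := nI.
  have := sqintB (simple_integral_sqint (hS n) t0) h.
  congr sqint; apply/funext => z; ring.
Qed.

(** [simple_ip] holds along the approximating sequences, and both of its sides converge by
    [ip_cvg]. *)
Lemma ito_ip Y Y' s t I J : 0 <= s -> 0 <= t ->
  ito_integral P F W Y s I -> ito_integral P F W Y' t J ->
  [/\ sqint P I, sqint P J, sqint Q (lift s Y), sqint Q (lift t Y') &
   ip P I J = ip Q (lift s Y) (lift t Y')].
Proof.
move=> s0 t0 /(ito_integral_approx s0)[S [hS sY sI cY cI]].
move=> /(ito_integral_approx t0)[S' [hS' sY' sI' cY' cI']].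
split => //.
have h1 := ip_cvg (fun n => simple_integral_sqint (hS n) s0)
  (fun n => simple_integral_sqint (hS' n) t0) sI sI' cI cI'.
have h2 := ip_cvg (fun n => lift_simple_sqint (hS n) s0)
  (fun n => lift_simple_sqint (hS' n) t0) sY sY' cY cY'.
rewrite (_ : (fun n => ip P _ _) =
    (fun n => ip Q (lift s (simple_value (S n))) (lift t (simple_value (S' n))))) in h1.
  exact: cvg_unique h1 h2.
by apply/funext => n; exact: simple_ip.
Qed.

Lemma simple_adapted_wrt S s : simple_adapted F S -> 0 <= s ->
  measurable_wrt (F s) (simple_value S s).
Proof.
move=> hS s0; rewrite measurable_wrtP.
have sF := filtration_sigma hF s0.
apply: preim_in_sum => // i.
(* A coefficient that is not yet known at time s is multiplied by the indicator of an interval that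
   starts at s or later, which vanishes at s. *)
have [lt|le] := ltP (sp_time S i) s; last first.
  rewrite (_ : (fun _ => _) = fun=> 0); first exact: preim_in_cst.
  by apply/funext => w; rewrite indicE mem_setE in_itv/= ltNge le/= mulr0.
have [_ _ /(_ i) ms _] := hS.
apply: preim_inM => //; last exact: preim_in_cst.
apply: (preim_in_le hF (sp_time_ge0 hS i) (ltW lt)).
by rewrite -measurable_wrtP.
Qed.

Lemma ito_integral_intro Y t I (S : nat -> @simple_process R d Omega) : 0 <= t ->
  measurable_fun ((`[0, t] : set R) `*` setT) (fun z : R * Omega => Y z.1 z.2) ->
  (forall s : R, 0 <= s <= t -> measurable_wrt (F s) (Y s)) ->
  ito_approx Y t I S -> ito_integral P F W Y t I.
Proof.
move=> t0 mY aY [hS sY sI cY cI]; split => //; first by case: sI.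
exists S; split => //.
  under eq_fun => n.
    rewrite lift_dist2; last 2 first.
    - by case: (lift_simple_sqint (hS n) t0).
    - by case: sY.
    rewrite ip_EFin; last exact: sqintB (lift_simple_sqint (hS n) t0) sY.
    over.
  by apply: cvg_EFin; [exact: nearW|exact: cY].
under eq_fun => n.
  rewrite unlock ip_EFin; last exact: sqintB (simple_integral_sqint (hS n) t0) sI.
  over.
by apply: cvg_EFin; [exact: nearW|exact: cI].
Qed.

Lemma measurable_simple_value S (D : set (R * Omega)) : simple_adapted F S ->
  measurable_fun D (fun z : R * Omega => simple_value S z.1 z.2).
Proof.
move=> hS; apply: measurable_funTS; apply: measurable_sum => i.
apply: measurable_funM.
  apply: measurableT_comp => //.
  have [_ _ /(_ i) + _] := hS; rewrite measurable_wrtP.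
  exact/(preim_in_meas hF)/(sp_time_ge0 hS).
apply: (measurableT_comp (_ : measurable_fun setT (fun s : R => \1_(`]sp_time S i, sp_time S i.+1]) s : R))) => //.
exact: measurable_indic.
Qed.

Lemma ito_simple S t : simple_adapted F S -> 0 <= t ->
  ito_integral P F W (simple_value S) t (simple_integral S W t).
Proof.
move=> hS t0; apply: (@ito_integral_intro _ _ _ (fun=> S)) => //.
- exact: measurable_simple_value.
- by move=> s /andP[s0 _]; exact: simple_adapted_wrt.
split => //.
- exact: lift_simple_sqint.
- exact: simple_integral_sqint.
- under eq_fun do (under [X in ip _ X]eq_fun do rewrite subrr).
  by rewrite ip0l; exact: cvg_cst.
- under eq_fun do (under [X in ip _ X]eq_fun do rewrite subrr).
  by rewrite ip0l; exact: cvg_cst.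
Qed.

(** The martingale property in weak form. Each interval lies before a, after a, or is split at a;
    the part after a is orthogonal to every F_a-measurable variable. *)
Lemma simple_mart S (xi : Omega -> R) a b : simple_adapted F S -> 0 <= a -> a <= b ->
  preim_in (F a) xi -> sqint P xi ->
  ip P xi (simple_integral S W b) = ip P xi (simple_integral S W a).
Proof.
move=> hS a0 ab px sx; have b0 := le_trans a0 ab.
have hb i := sp_bounded_coef hS i b0; have ha i := sp_bounded_coef hS i a0.
have sb i := step_sqint hF hW (hb i); have sa i := step_sqint hF hW (ha i).
rewrite !simple_integralE ip_sumr// ip_sumr//; apply: eq_bigr => i _.
have [_ /(_ i) tt _ _] := hS.
have [ta|at'] := leP (sp_time S i.+1) a.
  by rewrite !(min_l _)// ?(le_trans tt ta)// ?(le_trans ta ab)// (le_trans tt (le_trans ta ab)).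
have [at_|ta] := leP a (sp_time S i).
  rewrite (step0 W) [RHS]ipC ip0l.
  apply: (step_ip0 hF hW _ _ sx (hb i)); first by case: (hb i).
  by apply: (preim_in_le hF a0 _ px); rewrite le_min at_ ab.
rewrite (min_l (le_trans (ltW ta) ab)).
have h1 : bounded_coef F (sp_coef S i) a (Num.min (sp_time S i.+1) b).
  apply: (bounded_coef_sub hF (hb i)) => //.
  - by rewrite ge_min (ltW ta).
  - by rewrite le_min ab ltW.
rewrite (_ : step W _ (sp_time S i) (Num.min (sp_time S i.+1) b) =
   fun w => step W (sp_coef S i) (sp_time S i) a w +
            step W (sp_coef S i) a (Num.min (sp_time S i.+1) b) w); last first.
  by apply/funext => w; exact: stepD.
rewrite ipDr//; last 2 first.
- have := sa i; rewrite (min_l (ltW ta)) (min_r (ltW at'))//.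
- exact: (step_sqint hF hW h1).
by rewrite [X in _ + X](step_ip0 hF hW _ _ sx h1)// addr0.
Qed.

(** I and J come with unrelated approximations. The sequence chosen for J on [0, b], stopped at a,
    also converges to I: by the isometry its distance to I is the distance of the integrands on
    [0, a], which is at most the one on [0, b]. *)
Lemma ito_mart Y (xi : Omega -> R) a b I J : 0 <= a -> a <= b ->
  preim_in (F a) xi -> sqint P xi ->
  ito_integral P F W Y a I -> ito_integral P F W Y b J ->
  ip P xi J = ip P xi I.
Proof.
move=> a0 ab px sx hI hJ; have b0 := le_trans a0 ab.
have [S [hS sY sJ cY cJ]] := ito_integral_approx b0 hJ.
have [sI _ sYa _ eII] := ito_ip a0 a0 hI hI.
have sA n := simple_integral_sqint (hS n) a0.
have cA : ip P (fun w => simple_integral (S n) W a w - I w)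
      (fun w => simple_integral (S n) W a w - I w) @[n --> \oo] --> 0.
  apply: (squeeze_cvgr _ _ cY); last exact: cvg_cst.
  apply: nearW => n; rewrite ip_ge0/=.
  have hs := ito_simple (hS n) a0.
  have [_ _ sSa _ e1] := ito_ip a0 a0 hs hs.
  have [_ _ _ _ e2] := ito_ip a0 a0 hs hI.
  rewrite ipB_sqr// e1 e2 eII -ipB_sqr//.
  have sq := sqintB (lift_simple_sqint (hS n) b0) sY.
  have [_] := lift_sub_le ab sq sSa.1 sYa.1; exact.
have h0 : ip P (fun w => xi w - xi w) (fun w => xi w - xi w) @[n --> \oo] --> 0.
  under [X in ip _ X]eq_fun do rewrite subrr.
  by rewrite ip0l; exact: cvg_cst.
have c1 := ip_cvg (fun=> sx) (fun n => simple_integral_sqint (hS n) b0) sx sJ h0 cJ.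
have c2 := ip_cvg (fun=> sx) sA sx sI h0 cA.
have {}c1 : (fun n => ip P xi (simple_integral (S n) W b)) @ \oo --> ip P xi J by exact: c1.
rewrite (_ : (fun n => _) = (fun n => ip P xi (simple_integral (S n) W a))) in c1.
  exact: cvg_unique c1 c2.
by apply/funext => n; exact: simple_mart.
Qed.

Definition clamp (n : nat) (x : R) : R := Num.max (- n%:R) (Num.min x n%:R).

Lemma clamp_bound n x : `|clamp n x| <= n%:R.
Proof.
rewrite /clamp ler_norml le_max lexx/= ge_max ge_min lexx orbT andbT.
by rewrite (le_trans _ (ler0n R n))// oppr_le0.
Qed.

Lemma clamp_dist n x : (clamp n x - x) ^+ 2 <= x ^+ 2.
Proof.
rewrite /clamp; have n0 : 0 <= n%:R :> R by [].
have [h1|h1] := leP x n%:R.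
  by have [h2|h2] := leP (- n%:R) x; nra.
by have [h2|h2] := leP (- n%:R) (n%:R : R); nra.
Qed.

Lemma clamp_cvg x : (clamp n x - x) ^+ 2 @[n --> \oo] --> 0.
Proof.
apply: cvg_near_cst; near=> n.
have xn : `|x| <= n%:R by near: n; exact: nbhs_infty_ger.
move: xn; rewrite ler_norml => /andP[h1 h2].
by rewrite /clamp min_l// max_r// subrr expr0n.
Unshelve. all: by end_near. Qed.

Lemma measurable_clamp n : measurable_fun setT (clamp n).
Proof. by apply: measurable_maxr => //; exact: measurable_minr. Qed.

Lemma clamp_cvg_sqint (xi : Omega -> R) : sqint P xi ->
  (forall n : nat, sqint P (fun w => clamp n (xi w) - xi w)) /\
  (ip P (fun w => clamp n (xi w) - xi w) (fun w => clamp n (xi w) - xi w) @[n --> \oo] --> 0).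
Proof.
move=> sx; have mx := sx.1.
have sd n : sqint P (fun w => clamp n (xi w) - xi w).
  apply: (sqint_le _ sx.2).
    by apply: measurable_funB => //; exact: (measurableT_comp (measurable_clamp n)).
  by move=> w; exact: clamp_dist.
split=> //.
have [] := @dominated_convergence _ _ _ P setT measurableT
  (fun n w => ((clamp n (xi w) - xi w) ^+ 2)%:E) (cst 0%E) (fun w => (xi w ^+ 2)%:E).
- by move=> n; exact: measurable_int (sd n).2.
- exact: measurable_cst.
- apply: aeW => w _; apply: cvg_EFin; first exact: nearW.
  exact: clamp_cvg.
- exact: sx.2.
- apply: aeW => w n _; rewrite gee0_abs ?lee_fin ?sqr_ge0//; exact: clamp_dist.
move=> _ _; rewrite integral0 => /fine_cvgP[_]; exact.
Qed.

Lemma lift_oc (xi : Omega -> R) a b t : 0 <= a -> b <= t ->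
  lift t (fun s w => xi w * \1_(`]a, b]) s) = (fun z : T => xi z.2 * \1_(`]a, b]) z.1).
Proof.
move=> a0 bt; apply/funext => z; rewrite /lift.
case: ifPn => //; rewrite indicE mem_setE in_itv/=.
case: (boolP (a < z.1 <= b)) => [/andP[az zb]|_ _]; last by rewrite mulr0.
move=> /negP[]; rewrite (le_trans zb bt) andbT.
exact: (le_trans a0 (ltW az)).
Qed.

(** Simple processes have bounded coefficients, whereas the Euler scheme multiplies increments by
    variables that are only in L^2; truncation by [clamp] and dominated convergence fill the gap. *)
Lemma ito_incr (xi : Omega -> R) a b t : 0 <= a -> a <= b -> b <= t ->
  preim_in (F a) xi -> sqint P xi ->
  ito_integral P F W (fun s w => xi w * \1_(`]a, b]) s) t
    (fun w => xi w * (W b w - W a w)).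
Proof.
move=> a0 ab bt px sx; have b0 := le_trans a0 ab; have t0 := le_trans b0 bt.
have mx := sx.1.
have [sd cd] := clamp_cvg_sqint sx.
have pc n : preim_in (F a) (fun w => clamp n (xi w)).
  exact: (preim_in_comp (measurable_clamp n) px).
pose S n : @simple_process R d Omega := {| sp_size := 1 ;
  sp_time := fun i => if i is 0%N then a else b ;
  sp_coef := fun _ w => clamp n (xi w) |}.
have hS n : simple_adapted F (S n).
  split => //=.
  - by case.
  - move=> [|i]; rewrite measurable_wrtP//; exact: (preim_in_le hF a0 ab).
  - by exists n%:R => _ w; exact: clamp_bound.
have SvE n : simple_value (S n) = (fun s w => clamp n (xi w) * \1_(`]a, b]) s).
  by apply/funext => s; apply/funext => w; rewrite /simple_value big_ord1.
have SiE n : simple_integral (S n) W t = (fun w => clamp n (xi w) * (W b w - W a w)).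
  by apply/funext => w; rewrite /simple_integral big_ord1/= !min_l// (le_trans ab).
have m1 : measurable_fun setT (fun s : R => \1_(`]a, b]) s : R) by exact: measurable_indic.
have sF s : 0 <= s -> sigma_algebra setT (F s) by exact: (filtration_sigma hF).
apply: (@ito_integral_intro _ _ _ S) => //.
- apply: measurable_funTS; apply: measurable_funM; first exact: (measurableT_comp mx).
  exact: (measurableT_comp m1).
- move=> s /andP[s0 st]; rewrite measurable_wrtP.
  have [as_|sa] := leP a s.
    apply: preim_inM; [exact: sF|exact: (preim_in_le hF a0 as_)|].
    by apply: preim_in_cst; exact: sF.
  rewrite (_ : (fun _ => _) = fun=> 0); first by apply: preim_in_cst; exact: sF.
  by apply/funext => w; rewrite indicE mem_setE in_itv/= ltNge (ltW sa)/= mulr0.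
split => //.
- by rewrite lift_oc//; exact: (oc_product_ip a b a b sx sx).1.
- by have [] := incr_ipM hF hW a0 ab px px sx sx.
- have E n : (fun z => lift t (simple_value (S n)) z -
      lift t (fun s w => xi w * \1_(`]a, b]) s) z) =
    (fun z : T => (clamp n (xi z.2) - xi z.2) * \1_(`]a, b]) z.1).
    by apply/funext => z; rewrite SvE !lift_oc//= mulrBl.
  under eq_fun do rewrite E (oc_product_ip a b a b (sd _) (sd _)).2.
  by rewrite -(mul0r (overlap a b a b)); apply: cvgM => //; exact: cvg_cst.
- have E n : (fun w => simple_integral (S n) W t w - xi w * (W b w - W a w)) =
    (fun w => (clamp n (xi w) - xi w) * (W b w - W a w)).
    by apply/funext => w; rewrite SiE mulrBl.
  have pd n : preim_in (F a) (fun w => clamp n (xi w) - xi w).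
    by apply: preim_inB => //; exact: sF.
  under eq_fun do rewrite E (incr_ipM hF hW a0 ab (pd _) (pd _) (sd _) (sd _)).2.
  by rewrite -(mul0r (b - a)); apply: cvgM => //; exact: cvg_cst.
Qed.

End ito.

Lemma within_continuous_seq (R : realType) (A : set R) (f : R -> R) (u : nat -> R) (s : R) :
  {within A, continuous f} -> A s -> (forall n, A (u n)) -> u @ \oo --> s ->
  f (u n) @[n --> \oo] --> f s.
Proof.
move=> /subspace_continuousP cf As Au us V /(cf s As) fV.
have := us _ fV.
rewrite /nbhs /= /filter_from /=; apply: filterS => n; exact.
Qed.

(** * Joint measurability of continuous processes *)

Section joint_measurability.
Context d (Omega : measurableType d) (R : realType).
Variable X : R -> Omega -> R.
Hypothesis mX : forall t, 0 <= t -> measurable_fun setT (X t).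
Hypothesis cX : continuous_paths X.

Definition grid (n : nat) (s : R) : R := (Num.truncn (s * n.+1%:R))%:R / n.+1%:R.

Lemma grid_ge0 n s : 0 <= grid n s.
Proof. by rewrite divr_ge0. Qed.

Lemma grid_itv n s : 0 <= s -> grid n s <= s < grid n s + n.+1%:R^-1.
Proof.
move=> s0; have sn : 0 <= s * n.+1%:R by rewrite mulr_ge0.
have /andP[h1 h2] := truncn_itv sn.
rewrite /grid ler_pdivrMr ?ltr0n// h1/= -{2}[n.+1%:R^-1]mul1r -mulrDl.
by rewrite ltr_pdivlMr ?ltr0n// natr1.
Qed.

Lemma grid_cvg s : 0 <= s -> grid n s @[n --> \oo] --> s.
Proof.
move=> s0; apply/cvgrPdist_le => e e0; near=> n.
have /andP[h1 h2] := grid_itv n s0.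
rewrite ger0_norm ?subr_ge0// lerBlDr addrC (le_trans (ltW h2))// lerD2l.
by apply: ltW; near: n; exact: (near_infty_natSinv_lt (PosNum e0)).
Unshelve. all: by end_near. Qed.

(** By continuity of paths, X is the pointwise limit of its values at the largest multiple of
    1/(n+1) below s. For such a discretised process, preimages are countable unions of
    rectangles. *)
Lemma measurable_joint :
  measurable_fun ((`[0, +oo[ : set R) `*` setT) (fun z : R * Omega => X z.1 z.2).
Proof.
apply: (@measurable_fun_cvg _ _ _ _ (fun n z => X (grid n z.1) z.2)); last first.
  move=> [s w] [/=]; rewrite in_itv/= andbT => s0 _.
  apply: (@within_continuous_seq _ _ (fun t => X t w) (fun n => grid n s) s (@cX w)).
  - by rewrite /= in_itv/= s0.
  - by move=> n; rewrite /= in_itv/= grid_ge0.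
  - exact: grid_cvg.
move=> n mD B mB.
rewrite (_ : _ `&` _ = \bigcup_k
  ((`[0, +oo[ `&` `[k%:R / n.+1%:R, k.+1%:R / n.+1%:R[) `*` (X (k%:R / n.+1%:R) @^-1` B))).
  apply: bigcup_measurable => k _; apply: measurableX.
    exact: measurableI.
  by rewrite -[X in measurable X]setTI; apply: mX.
have n0 : 0 < n.+1%:R :> R by rewrite ltr0n.
apply/seteqP; split => [[s w] [[/= s0 _] XB]|[s w] [k _ [[/= s0 sk] XB]]].
  exists (Num.truncn (s * n.+1%:R)) => //; split => //=; split => //.
  move: s0; rewrite !in_itv/= andbT => s0.
  have sn : 0 <= s * n.+1%:R by rewrite mulr_ge0.
  by have := truncn_itv sn; rewrite ler_pdivrMr// ltr_pdivlMr.
split => //=; rewrite /grid.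
rewrite (@truncn_def _ _ k)//.
by move: sk; rewrite in_itv/= ler_pdivrMr// ltr_pdivlMr.
Qed.

Lemma measurable_joint_itv t :
  measurable_fun ((`[0, t] : set R) `*` setT) (fun z : R * Omega => X z.1 z.2).
Proof.
apply: measurable_funS measurable_joint => //.
  exact: measurableX.
by move=> z /= []; rewrite !in_itv/= => /andP[-> _].
Qed.

End joint_measurability.

(** * Derivatives of monotone functions *)

Section monotone_derivative.
Context {R : realType}.
Local Notation mu := (@lebesgue_measure R).
Implicit Types f g : R -> R.

Definition dquot g (n : nat) (t : R) : R := n.+1%:R * (g (t + n.+1%:R^-1) - g t).

Lemma cvg_dquot g t l : derivable g t 1 -> derive1 g t = l ->
  dquot g n t @[n --> \oo] --> l.
Proof.
move=> dg <-.
have /cvg_ex[l' cl] := dg.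
have el : derive1 g t = l'.
  rewrite derive1E; apply/cvg_lim => //; exact: cl.
rewrite el.
have hn : (@harmonic R) @ \oo --> 0^'.
  move=> V V0.
  have : \forall n \near \oo, harmonic n != 0 :> R -> V (harmonic n).
    exact: (@cvg_harmonic R _ V0).
  by apply: filterS => n; apply; rewrite gt_eqF// harmonic_gt0.
have := cvg_comp _ _ hn cl.
rewrite (_ : _ \o _ = dquot g ^~ t)//.
apply/funext => n /=; rewrite /dquot /harmonic/= invrK /GRing.scale/= mulr1.
by rewrite (addrC t).
Qed.

(** With h = 1/(n+1), the integral of g(t + h) - g(t) telescopes to the integral of g over
    [T, T + h] minus that over [0, h]; monotonicity bounds the first by h g(T + h) and the second
    below by h g(0). *)
Lemma dquot_integral_le g n T : {homo g : x y / x <= y} -> 0 < T ->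
  (\int[mu]_(t in `]0%R, T]) (dquot g n t)%:E <= (g (T + n.+1%:R^-1) - g 0)%:E)%E.
Proof.
(* Difference quotients ignore constants, and [g1] is nonnegative on positive times, so the calculus
   of nonnegative integrals applies. *)
move=> ng T0; pose h : R := n.+1%:R^-1; pose g1 x := g x - g 0.
have h0 : 0 < h by rewrite invr_gt0 ltr0n.
have mg : measurable_fun setT g by exact: nondecreasing_measurable.
have mg1 : measurable_fun setT g1 by exact: measurable_funB.
have g10 x : 0 <= x -> 0 <= g1 x by move=> x0; rewrite subr_ge0 ng.
have ng1 x y : x <= y -> g1 x <= g1 y by move=> xy; rewrite lerD2r ng.
have msh : measurable_fun setT (fun x : R => g1 (x + h)).
  by apply: measurableT_comp => //; exact: measurable_funD.
have mq : measurable_fun setT (dquot g n).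
  apply: measurable_funM => //; apply: measurable_funB => //.
  by apply: measurableT_comp => //; exact: measurable_funD.
have q0 t : 0 <= dquot g n t.
  by rewrite mulr_ge0// subr_ge0 ng// lerDl ltW.
pose A := (\int[mu]_(t in `]0%R, T]) (g1 t)%:E)%E.
have A0 : (0 <= A)%E.
  by apply: integral_ge0 => x /=; rewrite in_itv/= => /andP[x0 _]; rewrite lee_fin g10// ltW.
have Afin : A \is a fin_num.
  rewrite ge0_fin_numE//.
  apply: (@le_lt_trans _ _ (\int[mu]_(t in `]0%R, T]) (g1 T)%:E)%E).
    apply: ge0_le_integral => //.
    - by move=> x /=; rewrite in_itv/= => /andP[x0 _]; rewrite lee_fin g10// ltW.
    - exact/measurable_EFinP/measurable_funTS.
    - by move=> x /=; rewrite in_itv/= => /andP[_ xT]; rewrite lee_fin ng1.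
  by rewrite integral_cst//= lebesgue_measure_itv/= lte_fin T0 -EFinD -EFinM ltry.
have B : (\int[mu]_(t in `]0%R, T]) (g1 (t + h))%:E <= A + (h * g1 (T + h))%:E)%E.
  apply: (@le_trans _ _ (\int[mu]_(t in `]0%R, (T + h)%R]) (g1 t)%:E)%E).
    rewrite integral_mkcond [leRHS]integral_mkcond.
    rewrite -[leRHS](@ge0_integral_shift _ (- h)); last 2 first.
    - apply/(measurable_restrictT _ _).1 => //.
      exact/measurable_EFinP/measurable_funTS.
    - move=> x; rewrite patchE; case: ifPn => //; rewrite mem_setE in_itv/= => /andP[x0 _].
      by rewrite lee_fin g10// ltW.
    apply: ge0_le_integral => //.
    - move=> x _; rewrite patchE; case: ifPn => //; rewrite mem_setE in_itv/= => /andP[x0 _].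
      by rewrite lee_fin g10// addr_ge0// ltW.
    - apply/(measurable_restrictT _ _).1 => //.
      exact/measurable_EFinP/measurable_funTS.
    - apply: (@measurableT_comp _ _ _ _ _ _
        ((fun t => (g1 t)%:E) \_ `]0%R, (T + h)%R]) _ (fun x : R => x - - h)).
        apply/(measurable_restrictT _ _).1 => //.
        exact/measurable_EFinP/measurable_funTS.
      exact: measurable_funB.
    - move=> x _; rewrite !patchE !mem_setE !in_itv/= opprK lerD2r.
      case: ifPn => [/andP[x0 ->]|_].
        by rewrite addr_gt0.
      case: ifPn => // /andP[x0 _]; rewrite lee_fin g10// ltW//.
  rewrite (@itv_bndbnd_setU _ _ _ (BRight T)); last 2 first.
  - by rewrite bnd_simp ltW.
  - by rewrite bnd_simp lerDl ltW.
  rewrite ge0_integral_setU//=; last 3 first.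
  - exact/measurable_EFinP/measurable_funTS.
  - move=> x [] /=; rewrite in_itv/= => /andP[x0 _]; rewrite lee_fin g10// ltW//.
    exact: lt_trans x0.
  - apply/disj_setPS => y [/=]; rewrite 2!in_itv/= => /andP[_ yx] /andP[].
    by rewrite ltNge yx.
  apply: leeD2l.
  apply: (@le_trans _ _ (\int[mu]_(t in `]T, (T + h)%R]) (g1 (T + h))%:E)%E).
    apply: ge0_le_integral => //.
    - move=> x /=; rewrite in_itv/= => /andP[x0 _]; rewrite lee_fin g10// ltW//.
      exact: lt_trans x0.
    - exact/measurable_EFinP/measurable_funTS.
    - by move=> x /=; rewrite in_itv/= => /andP[_ xT]; rewrite lee_fin ng1.
  rewrite integral_cst//= lebesgue_measure_itv/= lte_fin ltrDl h0 -EFinD -EFinM lee_fin.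
  by rewrite mulrC addrAC subrr add0r.
have E : (\int[mu]_(t in `]0%R, T]) (dquot g n t)%:E + n.+1%:R%:E * A =
   n.+1%:R%:E * \int[mu]_(t in `]0%R, T]) (g1 (t + h))%:E)%E.
  rewrite -ge0_integral_mulEFin//; last 2 first.
  - exact: measurable_funTS.
  - by move=> x /=; rewrite in_itv/= => /andP[x0 _]; rewrite g10// ltW.
  rewrite -ge0_integralD//; last 4 first.
  - by move=> x _; rewrite lee_fin.
  - exact/measurable_EFinP/measurable_funTS.
  - by move=> x /=; rewrite in_itv/= => /andP[x0 _]; rewrite lee_fin mulr_ge0// g10// ltW.
  - by apply/measurable_EFinP/measurable_funTS; exact: measurable_funM.
  rewrite -ge0_integral_mulEFin//; last 2 first.
  - exact: measurable_funTS.
  - by move=> x /=; rewrite in_itv/= => /andP[x0 _]; rewrite g10// addr_ge0// ltW.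
  apply: eq_integral => x _; rewrite -EFinD; congr EFin.
  by rewrite /dquot /g1 -/h; ring.
have : (\int[mu]_(t in `]0%R, T]) (dquot g n t)%:E + n.+1%:R%:E * A <=
  (g1 (T + h))%:E + n.+1%:R%:E * A)%E.
  rewrite E (le_trans (lee_wpmul2l _ B))// muleDr//; last by rewrite fin_num_adde_defr.
  rewrite addeC; apply: leeD2r; rewrite -EFinM lee_fin mulrA mulfV ?mul1r// pnatr_eq0.
by rewrite leeD2rE// fin_numM.
Qed.

(* Fatou's lemma along the difference quotients of g. *)
Lemma monotone_integral_derivative (g phi : R -> R) (T : R) : {homo g : x y / x <= y} -> 0 < T ->
  measurable_fun `]0, T] phi ->
  {ae mu, forall t, 0 < t <= T -> dquot g n t @[n --> \oo] --> phi t} ->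
  g (T + n.+1%:R^-1) @[n --> \oo] --> g T ->
  (\int[mu]_(t in `]0%R, T]) (phi t)%:E <= (g T - g 0)%:E)%E.
Proof.
move=> ng T0 mphi dphi gT.
have mg : measurable_fun setT g by exact: nondecreasing_measurable.
have mq n : measurable_fun `]0, T] (fun t => (dquot g n t)%:E).
  apply/measurable_EFinP/measurable_funTS.
  apply: measurable_funM => //; apply: measurable_funB => //.
  by apply: measurableT_comp => //; exact: measurable_funD.
have q0 n t : 0 <= dquot g n t.
  by rewrite mulr_ge0// subr_ge0 ng// lerDl.
have E : (\int[mu]_(t in `]0%R, T]) (phi t)%:E =
    \int[mu]_(t in `]0%R, T]) limn_einf (fun n => (dquot g n t)%:E))%E.
  apply: ae_eq_integral => //.
  - exact/measurable_EFinP.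
  - apply: (@emeasurable_fun_cvg _ _ _ _ (fun k t => einfs (fun n => (dquot g n t)%:E) k)).
      by move=> k; exact: measurable_fun_einfs.
    by move=> t _; rewrite limn_einf_lim; exact: is_cvg_einfs.
  - apply: (@filterS _ _ (ae_filter_ringOfSetsType mu) _ _ _ dphi) => t /= + tT.
    move=> /(_ tT) c; apply/esym.
    apply: (cvg_limn_einf_sup _).1.
    by apply: cvg_EFin; [exact: nearW|exact: c].
have cg : ((g (T + n.+1%:R^-1) - g 0)%:E @[n --> \oo] --> (g T - g 0)%:E)%E.
  apply: cvg_EFin; first exact: nearW.
  by apply: cvgB => //; exact: cvg_cst.
have [eg _] := cvg_limn_einf_sup cg.
rewrite E -eg; apply: (le_trans (fatou _ _ _ _)) => //.
  by move=> n x _; rewrite lee_fin.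
rewrite !limn_einf_lim; apply: lee_lim; [exact: is_cvg_einfs..|].
apply: nearW => n; apply: le_ereal_inf_tmp => _ [k /= nk <-].
apply: (@le_trans _ _ (\int[mu]_(t in `]0%R, T]) (dquot g k t)%:E)%E).
  apply: ge_ereal_inf; exists (\int[mu]_(t in `]0%R, T]) (dquot g k t)%:E)%E => //.
  by exists k.
exact: dquot_integral_le.
Qed.

(** The differentiation theorem asks for local integrability on the whole line; [f] is integrable
    only on each [0, T], so it is first extended by zero to negative times. *)
Lemma lebesgue_FTC f :
  (forall T, 0 < T -> mu.-integrable `[0, T] (EFin \o f)) ->
  let F x := \int[mu]_(t in `[0, x]) f t in
  {ae mu, forall x, 0 < x -> derivable F x 1 /\ derive1 F x = f x}.
Proof.
move=> intf F.
pose f' := f \_ `[0, +oo[.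
have E M : {in `]-oo, M]%classic, f' =1 f \_ `[0, M]}.
  move=> x; rewrite inE/= in_itv/= => xM.
  by rewrite /f' !patchE !mem_setE !in_itv/= xM andbT.
have lfM M : 0 < M -> locally_integrable setT (f \_ `[0, M]).
  by move=> M0; apply: integrable_locally_restrict => //; exact: intf.
have mf' : measurable_fun setT f'.
  have -> : [set: R] = \bigcup_n `]-oo, n.+1%:R]%classic.
    apply/seteqP; split => // x _; exists (Num.truncn `|x|) => //=.
    rewrite in_itv/= (le_trans (ler_norm x))// ltW//.
    by have /andP[] := truncn_itv (normr_ge0 x).
  apply/measurable_fun_bigcup => // n.
  apply: (eq_measurable_fun (f \_ `[0, n.+1%:R])).
    by move=> x xn; rewrite (E n.+1%:R).
  by apply: measurable_funTS; case: (lfM n.+1%:R).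
have lf' : locally_integrable setT f'.
  split => //; first exact: openT.
  move=> C CT cC.
  have [M [_ CM]] := compact_bounded cC.
  pose M' := `|M| + 1.
  have M'0 : 0 < M' by rewrite ltr_wpDl.
  have [_ _ /(_ C CT cC)] := lfM M' M'0.
  congr (_ < _)%E; apply: eq_integral => x /set_mem Cx; rewrite (E M')// inE/= in_itv/=.
  rewrite (le_trans (ler_norm x))//; apply: CM => //.
  by rewrite (le_lt_trans (ler_norm M))// ltrDl.
have intf0 y : 0 < y -> mu.-integrable `[0, y] (EFin \o f').
  move=> y0; apply: eq_integrable (intf y y0) => //.
  by move=> x; rewrite inE/= in_itv/= /f' patchE mem_setE in_itv/= => /andP[-> _].
have intf' y : mu.-integrable `[0, y] (EFin \o f').
  have [y0|y0] := ltP 0 y; first exact: intf0.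
  apply: integrableS (intf0 1 ltr01) => //.
  by apply: subset_itvl; rewrite bnd_simp (le_trans y0).
have := FTC1 intf' lf'.
apply: (@filterS _ _ (ae_filter_ringOfSetsType mu)) => x /= h x0.
have := h; rewrite lte_fin => /(_ x0).
have -> : (fun x => \int[mu]_(t in `[0, x]) f' t) = F.
  apply/funext => y; apply: eq_Rintegral => t; rewrite inE/= in_itv/= => /andP[t0 _].
  by rewrite /f' patchE mem_setE in_itv/= t0.
by rewrite /f' patchE mem_setE in_itv/= (ltW x0).
Qed.

End monotone_derivative.

(** * Kernel and resolvent *)

Section extension_by_zero.
Context {R : realType}.
Local Notation mu := (@lebesgue_measure R).
Implicit Types f g : R -> R.

(** Vanishing on negative times confines the convolution integral over the line to [0, t]; see
    [econv_ext]. In particular [ext (cst 1)] is the Heaviside function, the kernel of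
    integration. *)
Definition ext f (x : R) : \bar R := if 0 <= x then (f x)%:E else 0%E.

Lemma measurable_ext f : measurable_fun (`[0, +oo[ : set R) f ->
  measurable_fun setT (ext f).
Proof.
move=> mf; rewrite (_ : ext f = (EFin \o f) \_ `[0, +oo[).
  by apply/(measurable_restrictT _ _).1 => //; exact/measurable_EFinP.
by apply/funext => x; rewrite patchE mem_setE in_itv/= andbT.
Qed.

Lemma ext_ge0 f : (forall x, 0 <= x -> 0 <= f x) -> forall x, (0 <= ext f x)%E.
Proof. by move=> f0 x; rewrite /ext; case: ifPn => // x0; rewrite lee_fin f0. Qed.

Lemma econv_ext f g t :
  econv (ext f) (ext g) t = (\int[mu]_(s in `[0%R, t]) (f (t - s) * g s)%:E)%E.
Proof.
rewrite /econv [RHS]integral_mkcond; apply: eq_integral => s _.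
rewrite patchE mem_setE in_itv/= /ext subr_ge0.
by case: (0 <= s); case: (s <= t); rewrite ?mule0 ?mul0e.
Qed.

Lemma econv_ext_lt0 f g t : t < 0 -> econv (ext f) (ext g) t = 0%E.
Proof.
by move=> t0; rewrite econv_ext set_itv_ge ?integral_set0// bnd_simp -ltNge.
Qed.

Lemma econv_one f t : measurable_fun (`[0, +oo[ : set R) f ->
  (forall x, 0 <= x -> 0 <= f x) ->
  econv (ext f) (ext (cst 1)) t = (\int[mu]_(s in `[0%R, t]) (f s)%:E)%E.
Proof.
move=> mf f0; rewrite econvC.
- by rewrite econv_ext; under eq_integral do rewrite mul1r.
- exact: measurable_ext.
- by apply: measurable_ext.
- exact: ext_ge0.
- by apply: ext_ge0 => x _; exact: ler01.
Qed.

Lemma econvDr (f g h : R -> \bar R) : measurable_fun setT f -> measurable_fun setT g ->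
  measurable_fun setT h ->
  (forall x, 0 <= f x)%E -> (forall x, 0 <= g x)%E -> (forall x, 0 <= h x)%E ->
  econv h (f \+ g)%E = (econv h f \+ econv h g)%E.
Proof.
move=> mf mg mh f0 g0 h0; rewrite econvC//.
- by rewrite econvDl// !(econvC mh).
- exact: emeasurable_funD.
- by move=> x; exact: adde_ge0.
Qed.

End extension_by_zero.

Section kernel.
Context {R : realType}.
Local Notation mu := (@lebesgue_measure R).
Variable (K : R -> R).
Hypothesis hK : admissible_kernel K.

Lemma measurable_kernel t : measurable_fun (`[0, t] : set R) K.
Proof.
apply: measurable_funS (kernel_measurable hK) => //.
exact: subset_itvl.
Qed.

(** Pointwise K^2 <= 1 + |K|^(2q): either |K| <= 1, or the larger exponent dominates. *)
Lemma kernel_sqr_integrable T : 0 < T ->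
  mu.-integrable `[0, T] (fun u => (K u ^+ 2)%:E).
Proof.
move=> T0; have [q [q1 /(_ T T0) fin]] := kernel_L2q hK.
have mK := @measurable_kernel T.
have mKq : measurable_fun (`[0, T] : set R) (fun u => `|K u| `^ (2 * q)).
  apply: (@measurableT_comp _ _ _ _ _ _ (fun x : R => x `^ (2 * q)) _ (fun u => `|K u|)) => //.
  exact: (measurableT_comp (@normr_measurable R setT) mK).
apply/integrableP; split.
  by apply/measurable_EFinP; exact: measurable_funX.
apply: (@le_lt_trans _ _ (\int[mu]_(u in `[0%R, T]) (1 + `|K u| `^ (2 * q))%:E)%E).
  apply: ge0_le_integral => //.
  - apply: measurableT_comp => //; apply/measurable_EFinP; exact: measurable_funX.
  - by apply/measurable_EFinP; exact: measurable_funD.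
  - move=> x _; rewrite gee0_abs ?lee_fin ?sqr_ge0//.
    rewrite -real_normK ?num_real//.
    have [K1|K1] := leP `|K x| 1.
      by rewrite ler_wpDr ?powR_ge0// expr_le1.
    rewrite ler_wpDl// -powR_mulrn// ler_powR ?(ltW K1)//.
    by rewrite ler_pMr// ltW.
under eq_integral do rewrite EFinD.
rewrite ge0_integralD//; last exact/measurable_EFinP.
rewrite lte_add_pinfty// integral_cst//= lebesgue_measure_itv/= lte_fin T0.
by rewrite -EFinD -EFinM ltry.
Qed.

Lemma kernel_integrable T : 0 < T -> mu.-integrable `[0, T] (EFin \o K).
Proof.
move=> T0.
have ic : mu.-integrable `[0, T] (cst (1%:E : \bar R)).
  apply/integrableP; split; first exact: measurable_cst.
  rewrite integral_cst//= lebesgue_measure_itv/= lte_fin T0.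
  by rewrite normr1 -EFinD -EFinM ltry.
apply: (le_integrable _ _ _ (integrableD _ ic (kernel_sqr_integrable T0))) => //.
  by apply/measurable_EFinP; exact: (@measurable_kernel T).
move=> x /=; rewrite in_itv/= => /andP[x0 _].
rewrite lee_fin [leRHS]ger0_norm ?addr_ge0 ?sqr_ge0// ger0_norm ?(kernel_ge0 hK)//.
by nra.
Qed.

Definition kprim (t : R) : R := \int[mu]_(u in `[0, t]) K u.

Lemma kprim_EFin t : 0 <= t -> (\int[mu]_(u in `[0%R, t]) (K u)%:E = (kprim t)%:E)%E.
Proof.
move=> t0; rewrite /kprim /Rintegral fineK//; apply: integrable_fin_num => //.
have t1 : 0 < t + 1 by rewrite ltr_wpDl.
apply: integrableS (kernel_integrable t1) => //.
by apply: subset_itvl; rewrite bnd_simp lerDl.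
Qed.

Lemma kprim_max t : kprim (Num.max 0 t) = kprim t.
Proof.
have [//|t0] := leP 0 t.
rewrite /kprim set_itv1 Rintegral_set1 set_itv_ge ?Rintegral_set0//.
by rewrite bnd_simp -ltNge.
Qed.

Lemma kprim_cvg T : 0 <= T -> kprim (T + n.+1%:R^-1) @[n --> \oo] --> kprim T.
Proof.
move=> T0; have T1 : 0 < T + 1 by rewrite ltr_wpDl.
have h := parameterized_integral_continuous (ltW T1) (kernel_integrable T1).
have n1 n : n.+1%:R^-1 <= 1 :> R by rewrite invf_le1// ler1n.
apply: (@within_continuous_seq R `[0, T + 1] kprim) => //.
- by rewrite /= in_itv/= T0 lerDl ler01.
- by move=> n; rewrite /= in_itv/= lerD2l n1 addr_ge0//.
- rewrite -[X in _ --> X]addr0; apply: cvgD; first exact: cvg_cst.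
  exact: cvg_harmonic.
Qed.

Section resolvent.
Variables (lam : R) (Rl : R -> R).
Hypothesis lam0 : 0 < lam.
Hypothesis hR : resolvent K lam Rl.
Hypothesis Rdec : {in `[0, +oo[ &, {homo Rl : s t / s <= t >-> t <= s}}.
Hypothesis Rlim : Rl t @[t --> +oo] --> 0.
Hypothesis Rder : forall t : R, 0 < t -> derivable Rl t 1 /\ derive1 Rl t < 0.

Lemma Rl_le s t : 0 <= s -> s <= t -> Rl t <= Rl s.
Proof.
move=> s0 st; apply: Rdec => //; rewrite in_itv/= andbT//.
exact: le_trans st.
Qed.

Lemma Rl_ge0 t : 0 <= t -> 0 <= Rl t.
Proof.
move=> t0; rewrite leNgt; apply/negP => Rt0.
have : \forall s \near +oo, Rl t < Rl s by exact: (cvgr_gt _ Rlim).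
move=> h; near +oo_R => s.
have : Rl t < Rl s by near: s.
rewrite ltNge => /negP; apply; apply: Rl_le => //.
Unshelve. all: by end_near. Qed.

Lemma Rl_0 : Rl 0 = 1.
Proof.
have [_] := hR (lexx 0).
by rewrite /convolution set_itv1 Rintegral_set1 mulr0 addr0.
Qed.

Lemma Rl_le1 t : 0 <= t -> Rl t <= 1.
Proof. by move=> t0; rewrite -Rl_0; exact: Rl_le. Qed.

Lemma measurable_Rmax : measurable_fun setT (fun x : R => Rl (Num.max 0 x)).
Proof.
apply: nonincreasing_measurable => // x y xy.
apply: Rl_le; first by rewrite le_max lexx.
by rewrite ge_max le_max lexx/= le_max xy orbT.
Qed.

Lemma measurable_Rl : measurable_fun (`[0, +oo[ : set R) Rl.
Proof.
apply: (eq_measurable_fun (fun x : R => Rl (Num.max 0 x))).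
  by move=> x; rewrite inE/= in_itv/= andbT => x0; rewrite max_r.
exact: measurable_funTS measurable_Rmax.
Qed.

Lemma resolvent_econv t : (ext Rl t + lam%:E * econv (ext K) (ext Rl) t = ext (cst 1%R) t)%E.
Proof.
rewrite /ext; case: ifPn => t0; last first.
  by rewrite econv_ext_lt0 ?mule0 ?adde0// ltNge.
have [i_ <-] := hR t0.
rewrite econv_ext EFinD EFinM /convolution /Rintegral fineK//.
exact: integrable_fin_num.
Qed.

Let eK0 : forall x, (0 <= ext K x)%E := ext_ge0 (kernel_ge0 hK).
Let eR0 : forall x, (0 <= ext Rl x)%E := ext_ge0 Rl_ge0.
Let mK := measurable_ext (kernel_measurable hK).
Let mR := measurable_ext measurable_Rl.

Lemma econv_RK_fin t : econv (ext Rl) (ext K) t \is a fin_num.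
Proof.
rewrite econvC//.
have [t0|t0] := leP 0 t; last by rewrite econv_ext_lt0.
have [i_ _] := hR t0.
by rewrite econv_ext; exact: integrable_fin_num.
Qed.

(** After the resolvent equation, it suffices to compare R(t - x) + 1_(x <= s) with R(s - x) + 1_(x
    <= t) under the weight K: for x <= s this is monotonicity of R, for s < x <= t it is R <= 1. *)
Lemma Rl_kprim s t : 0 <= s -> s <= t -> Rl s - Rl t <= lam * (kprim t - kprim s).
Proof.
move=> s0 st; have t0 := le_trans s0 st.
have H : (econv (ext Rl) (ext K) t + (kprim s)%:E <= econv (ext Rl) (ext K) s + (kprim t)%:E)%E.
  rewrite -!kprim_EFin//.
  have E u : 0 <= u -> (\int[mu]_(x in `[0%R, u]) (K x)%:E =
      \int[mu]_x ((if x <= u then 1 else 0)%:E * ext K x))%E.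
    move=> u0; rewrite integral_mkcond; apply: eq_integral => x _.
    rewrite patchE mem_setE in_itv/= /ext.
    by case: (0 <= x); case: (x <= u); rewrite ?mul1e ?mul0e ?mule0.
  have mi u : measurable_fun setT (fun x : R => (if x <= u then 1 else 0 : R)%:E).
    apply/measurable_EFinP; apply: measurable_fun_ifT => //.
    exact: measurable_fun_ler.
  have i0 u x : (0 <= (if x <= u :> R then 1 else 0 : R)%:E)%E.
    by rewrite lee_fin; case: ifP.
  have mRs (u : R) : measurable_fun setT (fun x : R => ext Rl (u - x)).
    by apply: measurableT_comp => //; exact: measurable_reflect.
  have mM1 u : measurable_fun setT (fun x : R => ext Rl (u - x) * ext K x)%E.
    by apply: emeasurable_funM.
  have mM2 u : measurable_fun setT (fun x : R => (if x <= u then 1 else 0 : R)%:E * ext K x)%E.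
    by apply: emeasurable_funM.
  have p1 u (x : R) : (0 <= ext Rl (u - x) * ext K x)%E by exact: mule_ge0.
  have p2 u (x : R) : (0 <= (if x <= u then 1 else 0 : R)%:E * ext K x)%E by exact: mule_ge0.
  have D u v : (econv (ext Rl) (ext K) u +
      \int[mu]_x ((if (x : R) <= v then 1 else 0 : R)%:E * ext K x) =
      \int[mu]_x (ext Rl (u - x)%R * ext K x + (if (x : R) <= v then 1 else 0 : R)%:E * ext K x))%E.
    by rewrite /econv ge0_integralD; [by []|by []|by move=> x _; exact: p1|exact: mM1|by move=> x _; exact: p2|exact: mM2].
  rewrite !E// !D; apply: ge0_le_integral => //.
  - by move=> x _; apply: adde_ge0.
  - by apply: emeasurable_funD; [exact: mM1|exact: mM2].
  - by apply: emeasurable_funD; [exact: mM1|exact: mM2].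
  move=> x _; rewrite -!ge0_muleDl//; apply: lee_wpmul2r => //.
  rewrite /ext !subr_ge0.
  have [xs|sx] := leP x s.
    rewrite (le_trans xs st) -!EFinD lee_fin lerD2r; apply: Rl_le.
      by rewrite subr_ge0.
    by rewrite lerD2r.
  have [xt|tx] := leP x t; last by [].
  by rewrite add0e adde0 lee_fin Rl_le1// subr_ge0.
have Es := resolvent_econv s; have Et := resolvent_econv t.
rewrite econvC// in Es; rewrite econvC// in Et.
move: Es Et H; rewrite /ext s0 t0.
rewrite -(fineK (econv_RK_fin s)) -(fineK (econv_RK_fin t)).
rewrite -!EFinM -!EFinD => -[Es] [Et]; rewrite lee_fin => H.
have : lam * (fine (econv (ext Rl) (ext K) t) + kprim s) <=
       lam * (fine (econv (ext Rl) (ext K) s) + kprim t).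
  by rewrite ler_wpM2l// ltW.
rewrite !mulrDr mulrN; lra.
Qed.

Definition dens : R -> R := (fun x => - derive1 Rl x) \_ `]0, +oo[.

Lemma dens_gt0 x : 0 < x -> 0 < dens x.
Proof.
by move=> x0; rewrite /dens patchE mem_setE in_itv/= x0/= oppr_gt0; exact: (Rder x0).2.
Qed.

Lemma dens_le0 x : x <= 0 -> dens x = 0.
Proof. by move=> x0; rewrite /dens patchE mem_setE in_itv/= andbT ltNge x0. Qed.

Lemma dens_ge0 x : 0 <= dens x.
Proof. by have [/dens_le0->//|/dens_gt0/ltW] := leP x 0. Qed.

(** Freezing the argument at 0 makes this nondecreasing on the whole line, as
    [monotone_integral_derivative] demands. *)
Let Rm (x : R) := - Rl (Num.max 0 x).

Let dquot_Rm t : 0 < t -> dquot Rm n t @[n --> \oo] --> dens t.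
Proof.
move=> t0.
have E n : dquot Rm n t = - dquot Rl n t.
  rewrite /dquot /Rm !max_r ?ltW//; first by rewrite -mulrN; congr (_ * _); ring.
  by rewrite addr_gt0// invr_gt0.
under eq_fun do rewrite E.
rewrite -(opprK (dens t)); apply: cvgN; apply: cvg_dquot; first exact: (Rder t0).1.
by rewrite /dens patchE mem_setE in_itv/= t0 opprK.
Qed.

Lemma measurable_dens : measurable_fun setT dens.
Proof.
rewrite /dens; apply/(measurable_restrictT _ _).1 => //.
apply: (@measurable_fun_cvg _ _ _ _ (fun n => dquot Rm n)).
  move=> n; apply: measurable_funTS; apply: measurable_funM => //.
  have mRm : measurable_fun setT Rm by exact: (measurableT_comp (@oppr_measurable R setT) measurable_Rmax).
  apply: measurable_funB => //.
  by apply: (measurableT_comp mRm); exact: measurable_funD.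
move=> x /=; rewrite in_itv/= andbT => x0; have := dquot_Rm x0.
by rewrite /dens patchE mem_setE in_itv/= x0.
Qed.

Lemma Rl_cvg T : 0 < T -> Rl (T + n.+1%:R^-1) @[n --> \oo] --> Rl T.
Proof.
move=> T0.
have h : harmonic n * dquot Rl n T @[n --> \oo] --> 0.
  rewrite -(mul0r (derive1 Rl T)); apply: cvgM; first exact: cvg_harmonic.
  by apply: cvg_dquot => //; exact: (Rder T0).1.
have h2 : harmonic n * dquot Rl n T + Rl T @[n --> \oo] --> 0 + Rl T.
  by apply: cvgD => //; exact: cvg_cst.
rewrite add0r in h2.
rewrite (_ : (fun n => Rl (T + _)) = (fun n => harmonic n * dquot Rl n T + Rl T))//.
apply/funext => n /=.
by rewrite /harmonic /dquot /= mulrA mulVf ?pnatr_eq0// mul1r subrK.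
Qed.

(* Both - Rl and lam * kprim + Rl are nondecreasing; monotone_integral_derivative
   applied to each gives the two inequalities. *)
Lemma integral_dens_oc T : 0 < T ->
  (\int[mu]_(t in `]0%R, T]) (dens t)%:E = (1 - Rl T)%:E)%E.
Proof.
move=> T0.
have T1 : 0 < T + 1 by rewrite ltr_wpDl// ltW.
have cRm : Rm (T + n.+1%:R^-1) @[n --> \oo] --> Rm T.
  rewrite /Rm (max_r (ltW T0)); apply: cvgN.
  under eq_fun do rewrite max_r ?addr_ge0 ?(ltW T0)//.
  exact: Rl_cvg.
have up : (\int[mu]_(t in `]0%R, T]) (dens t)%:E <= (1 - Rl T)%:E)%E.
  rewrite (_ : 1 - Rl T = Rm T - Rm 0); last first.
    by rewrite /Rm maxxx Rl_0 (max_r (ltW T0)); ring.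
  apply: monotone_integral_derivative => //.
  - move=> x y xy; rewrite lerN2; apply: Rl_le; first by rewrite le_max lexx.
    by rewrite ge_max le_max lexx/= le_max xy orbT.
  - exact: measurable_funTS measurable_dens.
  - by apply: aeW => t /andP[t0 _]; exact: dquot_Rm.
pose g x := lam * kprim x - Rm x.
have ng : {homo g : x y / x <= y}.
  move=> x y xy; rewrite /g -(kprim_max x) -(kprim_max y) /Rm.
  have h : Num.max 0 x <= Num.max 0 y by rewrite ge_max le_max lexx/= le_max xy orbT.
  have h0 : 0 <= Num.max 0 x by rewrite le_max lexx.
  by have := Rl_kprim h0 h; rewrite mulrBr; lra.
have intK : mu.-integrable `]0, T] (EFin \o K).
  apply: integrableS (kernel_integrable T0) => //.
  by apply: subset_itvr; rewrite bnd_simp.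
have intd : mu.-integrable `]0, T] (EFin \o dens).
  apply/integrableP; split.
    by apply/measurable_EFinP; exact: measurable_funTS measurable_dens.
  under eq_integral do rewrite /= ger0_norm ?dens_ge0//.
  by rewrite (le_lt_trans up)// ltry.
have lo : (\int[mu]_(t in `]0%R, T]) (lam * K t - dens t)%:E <= (g T - g 0)%:E)%E.
  apply: monotone_integral_derivative => //.
  - apply: measurable_funB; last exact: measurable_funTS measurable_dens.
    by apply: measurable_funM => //; apply/measurable_EFinP; exact: measurable_int intK.
  - have := lebesgue_FTC (fun T T0 => kernel_integrable T0).
    apply: (@filterS _ _ (ae_filter_ringOfSetsType mu)) => t /= + /andP[t0 _].
    move=> /(_ t0)[d1 d2].
    have E n : dquot g n t = lam * dquot kprim n t - dquot Rm n t.
      by rewrite /dquot /g; ring.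
    under eq_fun do rewrite E.
    apply: cvgB; last exact: dquot_Rm.
    by apply: cvgM; [exact: cvg_cst|exact: cvg_dquot d1 d2].
  - apply: cvgB => //; apply: cvgM; first exact: cvg_cst.
    exact: kprim_cvg (ltW T0).
have intlK : mu.-integrable `]0, T] (fun t => (lam * K t)%:E).
  rewrite (_ : (fun t => (lam * K t)%:E) = (fun t => lam%:E * (EFin \o K) t)%E) //; exact: integrableZl.
(* [lo] reads: [lam * kprim T] minus the integral of [dens] is at most [lam * kprim T] + R(T) - 1.
   Cancelling the finite term gives the reverse of [up]. *)
apply/eqP; rewrite eq_le up/=.
move: lo; under eq_integral do rewrite EFinB.
rewrite integralB//.
under eq_integral do rewrite EFinM.
rewrite integralZl// integral_itv_obnd_cbnd; last exact: measurable_int intK.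
rewrite kprim_EFin ?(ltW T0)// -(fineK (integrable_fin_num _ intd))//.
rewrite -EFinM -EFinB !lee_fin /g /Rm maxxx Rl_0 (max_r (ltW T0)).
have -> : kprim 0 = 0 by rewrite /kprim set_itv1 Rintegral_set1.
lra.
Qed.

Lemma integral_dens T : 0 <= T ->
  (\int[mu]_(t in `[0%R, T]) (dens t)%:E = (1 - Rl T)%:E)%E.
Proof.
rewrite le_eqVlt => /predU1P[<-|T0].
  by rewrite set_itv1 integral_set1 Rl_0 subrr.
rewrite -integral_dens_oc// integral_itv_obnd_cbnd//.
by apply/measurable_EFinP; exact: measurable_funTS measurable_dens.
Qed.

End resolvent.
End kernel.

(** Equal primitives have equal derivatives almost everywhere. The function [a] may be infinite on a
    null set, so the differentiation theorem is applied to [fine (a x)]. *)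
Lemma ae_eq_primitives (R : realType) (a : R -> \bar R) (b : R -> R) :
  measurable_fun setT a -> (forall x, 0 <= a x)%E ->
  (forall T, 0 < T -> (@lebesgue_measure R).-integrable `[0, T] (EFin \o b)) ->
  (forall T, 0 <= T -> (\int[lebesgue_measure]_(x in `[0%R, T]) a x =
     \int[lebesgue_measure]_(x in `[0%R, T]) (b x)%:E)%E) ->
  {ae lebesgue_measure, forall x, 0 < x -> a x = (b x)%:E}.
Proof.
set mu := (@lebesgue_measure R) => ma a0 ib ab.
have ia T : 0 < T -> mu.-integrable `[0, T] a.
  move=> T0; apply/integrableP; split; first exact: measurable_funTS.
  under eq_integral do rewrite gee0_abs//.
  rewrite ab ?ltW// ltey_eq (integrable_fin_num _ (ib T T0))//.
have afin : {ae mu, forall x, 0 < x -> a x \is a fin_num}.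
  have h n : {ae mu, forall x, `[0, n.+1%:R]%classic x -> a x \is a fin_num}.
    by apply: integrable_ae => //; exact: ia.
  have := ae_foralln h.
  apply: (@filterS _ _ (ae_filter_ringOfSetsType mu)) => x /= hx x0.
  apply: (hx (Num.truncn x)); rewrite in_itv/= (ltW x0)/= ltW//.
  by have /andP[] := truncn_itv (ltW x0).
have ifa T : 0 < T -> mu.-integrable `[0, T] (EFin \o (fun x => fine (a x))).
  move=> T0; apply: le_integrable (ia T T0) => //.
    by apply/measurable_EFinP/measurable_funTS; exact: measurableT_comp.
  move=> x _ /=; have := a0 x; case: (a x) => [r||] //=.
  by move=> _; rewrite leey.
have Eint T : 0 <= T -> (\int[mu]_(x in `[0%R, T]) (fine (a x))%:E =
    \int[mu]_(x in `[0%R, T]) (b x)%:E)%E.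
  rewrite le_eqVlt => /predU1P[<-|T0]; first by rewrite set_itv1 !integral_set1.
  rewrite -ab ?ltW//; apply: ae_eq_integral => //.
  - by apply/measurable_EFinP/measurable_funTS; exact: measurableT_comp.
  - exact: measurable_funTS.
  - have h : {ae mu, forall x, `[0, T]%classic x -> a x \is a fin_num}.
      by apply: integrable_ae => //; exact: ia.
    apply: (@filterS _ _ (ae_filter_ringOfSetsType mu) _ _ _ h) => x /= hx xT.
    by rewrite fineK// hx.
have FE : (fun x => \int[mu]_(t in `[0, x]) fine (a t)) = (fun x => \int[mu]_(t in `[0, x]) b t).
  apply/funext => x; have [x0|x0] := leP 0 x.
    by rewrite /Rintegral Eint.
  by rewrite !set_itv_ge ?Rintegral_set0// bnd_simp -ltNge.
have ha := lebesgue_FTC ifa.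
have hb := lebesgue_FTC ib.
have := @filterI _ _ (ae_filter_ringOfSetsType mu) _ _ ha
  (@filterI _ _ (ae_filter_ringOfSetsType mu) _ _ hb afin).
apply: (@filterS _ _ (ae_filter_ringOfSetsType mu)) => x /= [h1 [h2 h3]] x0.
have [_ e1] := h1 x0; have [_ e2] := h2 x0.
by rewrite -(fineK (h3 x0)) -e1 FE e2.
Qed.

(** * Uniqueness for the linear Volterra equation *)

Section kernel.
Context {R : realType}.
Local Notation mu := (@lebesgue_measure R).
Variable (K : R -> R).
Hypothesis hK : admissible_kernel K.
Let K0 : forall x, (0 <= ext K x)%E := ext_ge0 (kernel_ge0 hK).
Let mK : measurable_fun setT (ext K) := measurable_ext (kernel_measurable hK).

Lemma kernel_reflect_integral (w : R -> R) s : measurable_fun setT w ->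
  (forall x, 0 <= w x) ->
  (\int[mu]_(u in `[0%R, s]) (K (s - u) * w (s - u))%:E =
   \int[mu]_(u in `[0%R, s]) (K u * w u)%:E)%E.
Proof.
move=> mw w0.
have mKw : measurable_fun (`[0, +oo[ : set R) (fun x => K x * w x).
  by apply: measurable_funM; [exact: kernel_measurable hK|exact: measurable_funTS].
have Kw0 x : 0 <= x -> 0 <= K x * w x by move=> x0; rewrite mulr_ge0 ?(kernel_ge0 hK).
rewrite -(econv_one s mKw Kw0) econv_ext.
by apply: eq_integral => u _; rewrite mulr1.
Qed.

Lemma kernel_reflect_integrable s : 0 <= s ->
  mu.-integrable `[0, s] (fun u => (K (s - u))%:E).
Proof.
move=> s0; have s1 : 0 < s + 1 by rewrite ltr_wpDl.
have mKs : measurable_fun (`[0, s] : set R) (fun u => K (s - u)).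
  apply: (@measurable_comp _ _ _ _ _ _ (`[0, +oo[%classic : set R) K _ (fun u : R => s - u)) => //.
  - move=> _ [u /= us <-]; move: us; rewrite !in_itv/= andbT => /andP[_ us]; rewrite subr_ge0//.
  - exact: kernel_measurable hK.
  - exact: measurable_funTS (measurable_reflect s).
apply/integrableP; split; first exact/measurable_EFinP.
have := @kernel_reflect_integral (cst 1) s (measurable_cst _) (fun=> ler01).
rewrite /=; under eq_integral do rewrite mulr1.
under [X in _ = X -> _]eq_integral do rewrite mulr1.
under [X in _ -> (X < _)%E]eq_integral => u.
  rewrite inE/= in_itv/= => /andP[u0 us].
  rewrite ger0_norm ?(kernel_ge0 hK) ?subr_ge0//.
  over.
move=> ->; rewrite ltey_eq (integrable_fin_num _ _)//.
apply: integrableS (kernel_integrable hK s1) => //.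
by apply: subset_itvl; rewrite bnd_simp lerDl.
Qed.

Lemma convolution_integrable (psi : R -> R) M s : 0 <= s ->
  measurable_fun (`[0, s] : set R) psi -> (forall u, 0 <= u <= s -> `|psi u| <= M) ->
  mu.-integrable `[0, s] (fun u => (K (s - u) * psi u)%:E).
Proof.
move=> s0 mpsi bpsi; have iK := kernel_reflect_integrable s0.
have mKs : measurable_fun (`[0, s] : set R) (fun u => K (s - u)).
  by apply/measurable_EFinP; exact: measurable_int iK.
apply: (le_integrable _ _ _ (integrableZl _ M iK)) => //.
  by apply/measurable_EFinP; exact: measurable_funM.
move=> u /=; rewrite in_itv/= => us; rewrite lee_fin !normrM mulrC ler_wpM2r//.
by rewrite (le_trans (bpsi u us))// ler_norm.
Qed.

(** Dominated convergence: for u > 0 the weights e^(-n u) tend to 0, and K dominates. *)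
Lemma kernel_weight_small T e : 0 < T -> 0 < e -> exists2 beta : R, 0 <= beta &
  (\int[mu]_(u in `[0%R, T]) (K u * expR (- (beta * u)))%:E <= e%:E)%E.
Proof.
move=> T0 e0.
have iK := kernel_integrable hK T0.
have mKT : measurable_fun (`[0, T] : set R) K by exact: (@measurable_kernel _ _ hK _).
have mE (n : nat) : measurable_fun setT (fun u : R => expR (- (n%:R * u))).
  apply: (measurableT_comp (@measurable_expR R)).
  by apply: (measurableT_comp (@oppr_measurable R setT)); exact: measurable_funM.
have [] := @dominated_convergence _ _ _ mu `[0, T] (measurable_itv _)
  (fun n u => (K u * expR (- (n%:R * u)))%:E) (cst 0%E) (EFin \o K).
- move=> n; apply/measurable_EFinP; apply: measurable_funM => //.
  by apply: measurable_funTS; exact: mE.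
- exact: measurable_cst.
- have n0 : {ae mu, forall x : R, x != 0}.
    exists [set 0]; split => //; first exact: lebesgue_measure_set1.
    by move=> x /= /negP; rewrite negbK => /eqP.
  apply: (@filterS _ _ (ae_filter_ringOfSetsType mu) _ _ _ n0) => u /= un0.
  rewrite in_itv/= => /andP[u0 _].
  have up : 0 < u by rewrite lt_def un0.
  apply: cvg_EFin; first exact: nearW.
  rewrite -[X in _ --> X](mulr0 (K u)); apply: cvgM; first exact: cvg_cst.
  rewrite (_ : (fun n : nat => expR (- (n%:R * u))) = (fun n => expR (- u) ^+ n)); last first.
    by apply/funext => n; rewrite -mulrN expRM_natl.
  by apply: cvg_expr; rewrite ger0_norm ?expR_ge0// expR_lt1 oppr_lt0.
- exact: iK.
- apply: aeW => u n; rewrite /= in_itv/= => /andP[u0 _].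
  rewrite lee_fin normrM (ger0_norm (kernel_ge0 hK u0)) ger0_norm ?expR_ge0//.
  rewrite ler_piMr ?(kernel_ge0 hK)// -expR0 ler_expR oppr_le0 mulr_ge0//.
move=> _ _; rewrite integral0 => /fine_cvgP[fin /cvgrPdist_le /(_ e e0) h].
near \oo => n; exists n%:R => //.
have f1 : (\int[mu]_(x in `[0%R, T]) (K x * expR (- (n%:R * x)))%:E)%E \is a fin_num.
  by near: n; exact: fin.
have h1 : `|0 - fine (\int[mu]_(x in `[0%R, T]) (K x * expR (- (n%:R * x)))%:E)%E| <= e.
  by near: n; exact: h.
rewrite -(fineK f1) lee_fin (le_trans _ h1)// sub0r normrN ler_norm//.
Unshelve. all: by end_near. Qed.

(* For beta large, f |-> lam K * f is a contraction for sup |f u| e^(- beta u). *)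
Lemma volterra_unique lam T (D : R -> R) M : 0 < lam -> 0 < T ->
  measurable_fun (`[0, T] : set R) D -> (forall u, 0 <= u <= T -> `|D u| <= M) ->
  (forall s, 0 <= s <= T -> D s + lam * convolution K D s = 0) ->
  forall s, 0 <= s <= T -> D s = 0.
Proof.
move=> lam0 T0 mD bD eqD.
(* With this bound, lam times the weighted mass of K is at most 1/2, the contraction factor. *)
have [|beta b0 small] := @kernel_weight_small T (2 * lam)^-1 T0.
  by rewrite invr_gt0 mulr_gt0.
have mw : measurable_fun setT (fun u : R => expR (- (beta * u))).
  apply: (measurableT_comp (@measurable_expR R)).
  by apply: (measurableT_comp (@oppr_measurable R setT)); exact: measurable_funM.
have step C : 0 <= C -> (forall s, 0 <= s <= T -> `|D s| <= C * expR (beta * s)) ->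
    forall s, 0 <= s <= T -> `|D s| <= C / 2 * expR (beta * s).
  move=> C0 hC s /andP[s0 sT].
  have mDs : measurable_fun (`[0, s] : set R) D.
    by apply: measurable_funS mD => //; apply: subset_itvl; rewrite bnd_simp.
  have bDs u : 0 <= u <= s -> `|D u| <= M.
    by move=> /andP[u0 us]; rewrite bD// u0 (le_trans us).
  have ic := convolution_integrable s0 mDs bDs.
  have -> : D s = - (lam * convolution K D s).
    by apply/eqP; rewrite -subr_eq0 opprK eqD// s0.
  rewrite normrN normrM (gtr0_norm lam0).
  have mKs : measurable_fun (`[0, s] : set R) (fun u => K (s - u)).
    by apply/measurable_EFinP; exact: measurable_int (kernel_reflect_integrable s0).
  have H : (`|convolution K D s|%:E <= (C * expR (beta * s) * (2 * lam)^-1)%:E)%E.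
    rewrite EFin_normr_Rintegral//.
    apply: (le_trans (le_abse_integral _ _ (measurable_int _ ic))) => //.
    apply: (@le_trans _ _ (\int[mu]_(u in `[0%R, s])
       (C * expR (beta * s) * (K (s - u) * expR (- (beta * (s - u)))))%:E)%E).
      apply: ge0_le_integral => //.
      - by apply: measurableT_comp => //; exact: measurable_int ic.
      - apply/measurable_EFinP; apply: measurable_funM => //.
        apply: measurable_funM => //; apply: measurable_funTS.
        by apply: (measurableT_comp mw); exact: measurable_reflect.
      - move=> u /=; rewrite in_itv/= => /andP[u0 us].
        rewrite lee_fin normrM ger0_norm ?(kernel_ge0 hK) ?subr_ge0//.
        rewrite mulrCA ler_wpM2l ?(kernel_ge0 hK) ?subr_ge0//.
        rewrite -mulrA -expRD (_ : beta * s + _ = beta * u); last by ring.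
        by apply: hC; rewrite u0 (le_trans us).
    rewrite ge0_integral_mulEFin//; last 3 first.
    - by rewrite mulr_ge0 ?expR_ge0.
    - apply: measurable_funM => //; apply: measurable_funTS.
      by apply: (measurableT_comp mw); exact: measurable_reflect.
    - move=> u /=; rewrite in_itv/= => /andP[u0 us].
      by rewrite mulr_ge0 ?expR_ge0 ?(kernel_ge0 hK) ?subr_ge0.
    rewrite (@kernel_reflect_integral (fun x => expR (- (beta * x))) s)//.
    rewrite (EFinM (C * expR (beta * s))); apply: lee_wpmul2l; first by rewrite lee_fin mulr_ge0 ?expR_ge0.
    apply: le_trans small; apply: ge0_subset_integral => //.
    - apply/measurable_EFinP; apply: measurable_funM; last exact: measurable_funTS.
      exact: (@measurable_kernel _ _ hK _).
    - move=> u /=; rewrite in_itv/= => /andP[u0 us].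
      by rewrite lee_fin mulr_ge0 ?expR_ge0 ?(kernel_ge0 hK).
    - by apply: subset_itvl; rewrite bnd_simp.
  move: H; rewrite lee_fin -(ler_pM2l lam0) => /le_trans; apply.
  rewrite invfM [leLHS](_ : _ = C / 2 * expR (beta * s) * (lam / lam)); last by ring.
  by rewrite divff ?gt_eqF// mulr1.
have M0 : 0 <= M by rewrite (le_trans (normr_ge0 _) (bD 0 _))// lexx ltW.
(* The iteration starts from the plain bound M, since the weight is at least 1 for beta, s >= 0. *)
have all n s : 0 <= s <= T -> `|D s| <= M / 2 ^+ n * expR (beta * s).
  elim: n s => [|n ih] s sT.
    rewrite expr0 divr1 (le_trans (bD s sT))// ler_peMr// -expR0 ler_expR.
    by case/andP: sT => s0 _; rewrite mulr_ge0.
  have -> : M / 2 ^+ n.+1 = M / 2 ^+ n / 2 by rewrite exprSr invfM mulrA.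
  by apply: step => //; rewrite divr_ge0// exprn_ge0.
move=> s sT; apply/eqP; rewrite -normr_le0.
have c : (fun n => M / 2 ^+ n * expR (beta * s)) @ \oo --> 0.
  rewrite -[X in _ --> X](mul0r (expR (beta * s))); apply: cvgM; last exact: cvg_cst.
  rewrite -[X in _ --> X](mulr0 M); apply: cvgM; first exact: cvg_cst.
  under eq_fun do rewrite -exprVn.
  by apply: cvg_expr; rewrite ger0_norm ?invr_ge0// invf_lt1// ltr1n.
by apply: (cvgr_to_ge c); apply: nearW => n; exact: all.
Qed.

End kernel.

(** * Resolvent algebra and identification of the kernel *)

Section kernel.
Context {R : realType}.
Local Notation mu := (@lebesgue_measure R).
Variable (K : R -> R).
Hypothesis hK : admissible_kernel K.
Variables (lam : R) (Rl : R -> R).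
Hypothesis lam0 : 0 < lam.
Hypothesis hR : resolvent K lam Rl.
Hypothesis Rdec : {in `[0, +oo[ &, {homo Rl : s t / s <= t >-> t <= s}}.
Hypothesis Rlim : Rl t @[t --> +oo] --> 0.
Hypothesis Rder : forall t : R, 0 < t -> derivable Rl t 1 /\ derive1 Rl t < 0.

Let f := dens Rl.
Let K0 : forall x, (0 <= ext K x)%E := ext_ge0 (kernel_ge0 hK).
Let mK : measurable_fun setT (ext K) := measurable_ext (kernel_measurable hK).
Let R0 : forall x, (0 <= ext Rl x)%E := ext_ge0 (Rl_ge0 Rdec Rlim).
Let mR : measurable_fun setT (ext Rl) := measurable_ext (measurable_Rl Rdec).
Let mf : measurable_fun setT f := measurable_dens Rdec Rder.
Let f0 x : 0 <= f x := dens_ge0 Rder x.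
Let F0 : forall x, (0 <= ext f x)%E := ext_ge0 (fun x _ => f0 x).
Let mF : measurable_fun setT (ext f) := measurable_ext (measurable_funTS mf).
Let H0 : forall x : R, (0 <= ext (cst 1%R) x)%E := ext_ge0 (fun _ _ => ler01).
Let mH : measurable_fun setT (ext (cst 1%R : R -> R)) :=
  measurable_ext (@measurable_cst _ _ _ _ _ _).
Let lam0' : 0 <= lam := ltW lam0.

Lemma econv_dens_one t : 0 <= t -> econv (ext f) (ext (cst 1%R)) t = (1 - Rl t)%:E.
Proof.
move=> t0; rewrite econv_one//.
- exact: (integral_dens hK lam0 hR Rdec Rlim Rder t0).
- exact: measurable_funTS.
Qed.

(* Resolvent algebra: writing R for the resolvent, R + lam K * R = 1 and
   R + f * 1 = 1, hence (f + lam K * f) * 1 = lam K * R + lam K * (1 - R) = (lam K) * 1. *)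
Lemma dens_conv :
  {ae mu, forall x : R, (ext f x + lam%:E * econv (ext K) (ext f) x = lam%:E * ext K x)%E}.
Proof.
have mKF := measurable_econv mK mF K0 F0.
have KF0 := econv_ge0 K0 F0.
pose a x : \bar R := (ext f x + lam%:E * econv (ext K) (ext f) x)%E.
have ma : measurable_fun setT a.
  by apply: emeasurable_funD => //; exact: emeasurable_funM.
have lKF0 x : (0 <= lam%:E * econv (ext K) (ext f) x)%E.
  by rewrite mule_ge0// lee_fin.
have a0 x : (0 <= a x)%E by exact: adde_ge0.
have mlKF : measurable_fun setT (fun x => lam%:E * econv (ext K) (ext f) x)%E.
  exact: emeasurable_funM.
have aH T : 0 <= T -> econv a (ext (cst 1%R)) T = (lam%:E * econv (ext K) (ext (cst 1%R)) T)%E.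
  move=> T0.
  have -> : a = (ext f \+ (fun x => lam%:E * econv (ext K) (ext f) x))%E by [].
  rewrite econvDl// econvZl// -econvA//=.
  have HE : ext (cst 1%R) = (ext Rl \+ econv (ext f) (ext (cst 1%R)))%E.
    apply/funext => x /=; have [x0|x0] := leP 0 x.
      by rewrite econv_dens_one// /ext x0 -EFinD addrC subrK.
    by rewrite econv_ext_lt0// adde0 /ext leNgt x0.
  have mFH := measurable_econv mF mH F0 H0.
  have FH0 := econv_ge0 F0 H0.
  have -> : econv (ext K) (ext (cst 1%R)) T =
      (econv (ext K) (ext Rl) T + econv (ext K) (econv (ext f) (ext (cst 1%R))) T)%E.
    by rewrite {1}HE econvDr.
  rewrite [RHS]ge0_muleDr; [|exact: econv_ge0|exact: econv_ge0].
  congr (_ + _)%E.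
  (* The Heaviside function has two decompositions, R + lam K * R and R + f * 1; cancelling the
     finite value of R leaves f * 1 = lam K * R. *)
  have := resolvent_econv hR T; rewrite [in X in _ = X -> _]HE /= => e.
  have fR : ext Rl T \is a fin_num by rewrite /ext T0.
  have k (z : \bar R) : (ext Rl T + z - ext Rl T = z)%E by rewrite (addeC (ext Rl T)) addeK.
  by rewrite -[LHS]k -e k.
have lK0 : forall x, 0 <= x -> 0 <= K x := kernel_ge0 hK.
have := @ae_eq_primitives R a (fun x => lam * K x) ma a0.
have aeh : {ae mu, forall x : R, 0 < x -> a x = (lam * K x)%:E}.
  apply: ae_eq_primitives => //.
    move=> T T0.
    rewrite (_ : _ \o _ = (fun t => lam%:E * (EFin \o K) t)%E) //.
    by apply: integrableZl => //; exact: kernel_integrable.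
  move=> T T0.
  rewrite ge0_integral_mulEFin//; last 2 first.
  - exact: (@measurable_kernel _ _ hK T).
  - by move=> x /=; rewrite in_itv/= => /andP[x0 _]; exact: lK0.
  rewrite -econv_one//; last exact: kernel_measurable hK.
  rewrite -aH// econvC// {1}/econv [LHS]integral_mkcond; apply: eq_integral => s _.
  rewrite patchE mem_setE in_itv/= {1}/ext subr_ge0.
  case: (leP s T) => sT; rewrite ?andbT ?andbF ?mul1e ?mul0e//.
  case: (leP 0 s) => // s0.
  by rewrite /a econv_ext_lt0// /ext leNgt s0/= mule0 add0e.
move=> _.
have n0 : {ae mu, forall x : R, x != 0}.
  exists [set 0]; split => //; first exact: lebesgue_measure_set1.
  by move=> x /= /negP; rewrite negbK => /eqP.
apply: (@filterS2 _ _ (ae_filter_ringOfSetsType mu) _ _ _ _ aeh n0) => x /= hx xn0.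
have [x0|x0] := leP 0 x.
  by rewrite -/(a x) hx ?lt_def ?xn0// [in RHS]/ext x0 EFinM.
by rewrite econv_ext_lt0// /ext leNgt x0/= !mule0 adde0.
Qed.

(** [dens_conv] convolved with g: the almost-everywhere identity becomes one valid at every time,
    and says that f * g solves phi + lam K * phi = lam K * g. *)
Lemma econv_dens_solve g : measurable_fun setT g -> (forall x, 0 <= g x)%E ->
  (econv (ext f) g \+ (fun x => lam%:E * econv (ext K) (econv (ext f) g) x) =
   (fun x => lam%:E * econv (ext K) g x))%E.
Proof.
move=> mg g0.
have mKF := measurable_econv mK mF K0 F0.
have KF0 := econv_ge0 K0 F0.
have mlKF : measurable_fun setT (fun x => lam%:E * econv (ext K) (ext f) x)%E.
  exact: emeasurable_funM.
have lKF0 x : (0 <= lam%:E * econv (ext K) (ext f) x)%E.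
  by rewrite mule_ge0// lee_fin.
transitivity (econv (ext f \+ (fun x => lam%:E * econv (ext K) (ext f) x)) g)%E.
  by rewrite econvDl// econvZl// econvA.
rewrite -econvZl//; apply: econv_ae_eql => //.
- by apply: emeasurable_funD => //; exact: emeasurable_funM.
- exact: emeasurable_funM.
- by move=> x /=; rewrite adde_ge0// mule_ge0// lee_fin.
- by move=> x; rewrite mule_ge0// lee_fin.
- exact: dens_conv.
Qed.

(** Variation of constants: R solves the equation with right-hand side 1 and f * g the one with
    right-hand side lam K * g. The difference D of the two sides is a bounded solution of the
    homogeneous equation, hence zero by [volterra_unique]. *)
Lemma volterra_solve (g h : R -> R) (T M B c0 c1 : R) :
  measurable_fun (`[0, +oo[ : set R) g -> (forall x, 0 <= x -> 0 <= g x) ->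
  0 < T -> measurable_fun (`[0, T] : set R) h -> (forall u, 0 <= u <= T -> `|h u| <= M) ->
  (forall s, 0 <= s <= T -> (econv (ext K) (ext g) s <= B%:E)%E) ->
  (forall s, 0 <= s <= T ->
     h s + lam * convolution K h s = c0 + c1 * fine (econv (ext K) (ext g) s)) ->
  forall s, 0 <= s <= T ->
    h s = c0 * Rl s + c1 / lam * fine (econv (ext f) (ext g) s).
Proof.
move=> mg g0 T0 mh bh bB eqh.
have mG := measurable_ext mg.
have G0 := ext_ge0 g0.
have mKG := measurable_econv mK mG K0 G0.
have mFG := measurable_econv mF mG F0 G0.
have FG0 := econv_ge0 F0 G0.
have KG0 := econv_ge0 K0 G0.
have KFG0 := econv_ge0 K0 FG0.
have sol s := congr1 (@^~ s) (econv_dens_solve mG G0).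
rewrite /= in sol.
have B0 : 0 <= B.
  by rewrite -lee_fin (le_trans (KG0 0))// bB// lexx ltW.
pose phi s := fine (econv (ext f) (ext g) s).
(* Dropping a nonnegative term in [econv_dens_solve] gives f * g <= lam K * g, so the bound on K * g
   controls f * g. *)
have Fle s : 0 <= s <= T -> (econv (ext f) (ext g) s <= (lam * B)%:E)%E.
  move=> sT; apply: (@le_trans _ _ (lam%:E * econv (ext K) (ext g) s)%E).
    by rewrite -sol leeDl// mule_ge0// lee_fin.
  by rewrite EFinM; apply: lee_wpmul2l; [rewrite lee_fin|exact: bB].
have Ffin s : 0 <= s <= T -> econv (ext f) (ext g) s = (phi s)%:E.
  move=> sT; rewrite /phi fineK// ge0_fin_numE//.
  by rewrite (le_lt_trans (Fle s sT))// ltry.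
have phi0 s : 0 <= phi s by rewrite fine_ge0.
have phiB s : 0 <= s <= T -> `|phi s| <= lam * B.
  by move=> sT; rewrite ger0_norm// -lee_fin -Ffin// Fle.
have mphi : measurable_fun (`[0, T] : set R) phi.
  by apply: measurable_funTS; exact: measurableT_comp.
have Kphi s : 0 <= s <= T -> econv (ext K) (econv (ext f) (ext g)) s =
    (\int[mu]_(u in `[0%R, s]) (K (s - u) * phi u)%:E)%E.
  move=> /andP[s0 sT].
  rewrite {1}/econv [RHS]integral_mkcond; apply: eq_integral => u _.
  rewrite patchE mem_setE in_itv/= {1}/ext subr_ge0.
  have [us|su] := leP u s; last by rewrite andbF mul0e.
  rewrite andbT; case: (leP 0 u) => u0.
    by rewrite Ffin ?u0 ?(le_trans us)// EFinM.
  by rewrite econv_ext_lt0// mule0.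
have subint s (psi : R -> R) : 0 <= s <= T -> measurable_fun (`[0, T] : set R) psi ->
    measurable_fun (`[0, s] : set R) psi.
  move=> /andP[_ sT]; apply: measurable_funS => //.
  by apply: subset_itvl; rewrite bnd_simp.
have subb s (psi : R -> R) C : 0 <= s <= T -> (forall u, 0 <= u <= T -> `|psi u| <= C) ->
    forall u, 0 <= u <= s -> `|psi u| <= C.
  by move=> /andP[_ sT] h1 u /andP[u0 us]; rewrite h1// u0 (le_trans us).
have eqphi s : 0 <= s <= T ->
    phi s + lam * convolution K phi s = lam * fine (econv (ext K) (ext g) s).
  move=> sT; have := sol s; rewrite Ffin// Kphi// => e.
  have s0 : 0 <= s by case/andP: sT.
  have ic := convolution_integrable hK s0 (subint s phi sT mphi) (subb _ _ _ sT phiB).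
  move: e; rewrite -(fineK (integrable_fin_num _ ic))// -[X in (_ = lam%:E * X)%E -> _]fineK; last first.
    by rewrite ge0_fin_numE// (le_lt_trans (bB s sT))// ltry.
  by rewrite -!EFinM -EFinD => -[].
have mRl : measurable_fun (`[0, T] : set R) Rl.
  by apply: measurable_funS (measurable_Rl Rdec) => //; exact: subset_itvl.
have bRl u : 0 <= u <= T -> `|Rl u| <= 1.
  move=> /andP[u0 _]; rewrite ger0_norm ?(Rl_ge0 Rdec Rlim)//.
  exact: (Rl_le1 hR Rdec).
have eqRl s : 0 <= s -> Rl s + lam * convolution K Rl s = 1.
  by move=> s0; case: (hR s0).
pose D s := h s - c0 * Rl s - c1 / lam * phi s.
have mD : measurable_fun (`[0, T] : set R) D.
  by apply: measurable_funB; [apply: measurable_funB|] => //; exact: measurable_funM.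
have bD u : 0 <= u <= T -> `|D u| <= M + `|c0| * 1 + `|c1 / lam| * (lam * B).
  move=> uT; rewrite /D (le_trans (ler_normB _ _))// lerD//; last first.
    by rewrite normrM ler_wpM2l ?phiB.
  rewrite (le_trans (ler_normB _ _))// lerD ?bh// normrM ler_wpM2l// bRl//.
have eqD s : 0 <= s <= T -> D s + lam * convolution K D s = 0.
  move=> sT; have s0 : 0 <= s by case/andP: sT.
  have i1 := convolution_integrable hK s0 (subint s h sT mh) (subb _ _ _ sT bh).
  have i2 := convolution_integrable hK s0 (subint s _ sT mRl) (subb _ _ _ sT bRl).
  have i3 := convolution_integrable hK s0 (subint s _ sT mphi) (subb _ _ _ sT phiB).
  have -> : convolution K D s = convolution K h s - c0 * convolution K Rl s
      - c1 / lam * convolution K phi s.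
    rewrite /convolution -RintegralZl// -RintegralZl//.
    rewrite -RintegralB//; last exact: integrableZl i2.
    rewrite -RintegralB//.
    - by apply: eq_Rintegral => u _; rewrite /D; ring.
    - have i2c : mu.-integrable `[0, s] (fun u => c0%:E * (K (s - u) * Rl u)%:E)%E.
        by apply: integrableZl.
      have i12 : mu.-integrable `[0, s] ((fun u => (K (s - u) * h u)%:E) \- (fun u => c0%:E * (K (s - u) * Rl u)%:E))%E.
        by apply: integrableB.
      exact: i12.
    - exact: integrableZl i3.
  have e1 := eqh s sT; have e2 := eqRl s s0; have e3 := eqphi s sT.
  have ll : lam != 0 by rewrite gt_eqF.
  rewrite /D.
  have -> : h s = c0 + c1 * fine (econv (ext K) (ext g) s) - lam * convolution K h s.
    by rewrite -e1; ring.
  have -> : Rl s = 1 - lam * convolution K Rl s by rewrite -e2; ring.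
  have -> : phi s = lam * fine (econv (ext K) (ext g) s) - lam * convolution K phi s.
    by rewrite -e3; ring.
  by field.
move=> s sT; have := volterra_unique hK lam0 T0 mD bD eqD sT.
rewrite /D -/(phi s) => /eqP; lra.
Qed.

Lemma kernel_const (v0 s0 : R) : 0 <= v0 -> 0 < s0 ->
  (forall t : R, 0 <= t -> (\int[mu]_(u in `[0%R, t]) (f u ^+ 2)%:E =
     (lam ^+ 2 / s0 * v0 * (1 - Rl t ^+ 2))%:E)%E) ->
  {ae mu, forall t : R, 0 <= t -> K t = 2 * lam * v0 / s0}.
Proof.
move=> v00 s00 hf.
pose al := 2 * lam ^+ 2 * v0 / s0.
have mf2 : measurable_fun setT (fun u => f u ^+ 2) by exact: measurable_funX.
have if2 T : 0 < T -> mu.-integrable `[0, T] (EFin \o (fun u => f u ^+ 2)).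
  move=> T0; apply/integrableP; split.
    by apply/measurable_EFinP; exact: measurable_funTS.
  under eq_integral do rewrite /= ger0_norm ?sqr_ge0//.
  by rewrite hf ?ltW// ltry.
have fE : {ae mu, forall x : R, 0 < x -> f x = al * Rl x}.
  have := lebesgue_FTC if2.
  apply: (@filterS _ _ (ae_filter_ringOfSetsType mu)) => x /= hx x0.
  have [d1 d2] := hx x0.
  pose Phi x := \int[mu]_(u in `[0, x]) (f u ^+ 2).
  have PhiE t : 0 <= t -> Phi t = lam ^+ 2 / s0 * v0 * (1 - Rl t ^+ 2).
    by move=> t0; rewrite /Phi /Rintegral hf.
  have c1 : dquot Phi n x @[n --> \oo] --> f x ^+ 2 by exact: cvg_dquot.
  have fx : derive1 Rl x = - f x.
    by rewrite /f /dens patchE mem_setE in_itv/= x0 opprK.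
  have cR : dquot Rl n x @[n --> \oo] --> - f x.
    by rewrite -fx; apply: cvg_dquot => //; exact: (Rder x0).1.
  (* A difference of squares factors, so the quotients of 1 - R^2 are expressed through those of
     R. *)
  have E n : dquot Phi n x =
      - (lam ^+ 2 / s0 * v0) * (dquot Rl n x * (Rl (x + n.+1%:R^-1) + Rl x)).
    rewrite /dquot !PhiE ?ltW//; last by rewrite addr_gt0// invr_gt0.
    by ring.
  have c2 : dquot Phi n x @[n --> \oo] -->
      - (lam ^+ 2 / s0 * v0) * (- f x * (Rl x + Rl x)).
    under eq_fun do rewrite E.
    apply: cvgM; first exact: cvg_cst.
    apply: cvgM => //; apply: cvgD; last exact: cvg_cst.
    exact: (Rl_cvg Rder x0).
  have fxp : 0 < f x := dens_gt0 Rder x0.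
  (* The two limits give f^2 = al f R at x; one factor f can be cancelled because R is strictly
     decreasing in the sense R' < 0. *)
  have := cvg_unique _ c1 c2 => e.
  apply: (mulfI (lt0r_neq0 fxp)); rewrite -expr2 e // /al; ring.
have alp : 0 <= al by rewrite /al divr_ge0 ?(ltW s00)// !mulr_ge0 ?sqr_ge0.
(* [fE] says nothing at time 0, where [ext] does not vanish by definition; a single point is
   negligible. *)
have n0 : {ae mu, forall x : R, x != 0}.
  exists [set 0]; split => //; first exact: lebesgue_measure_set1.
  by move=> x /= /negP; rewrite negbK => /eqP.
have FE : {ae mu, forall x : R, ext f x = al%:E * ext Rl x}%E.
  apply: (@filterS2 _ _ (ae_filter_ringOfSetsType mu) _ _ _ _ fE n0) => x /= hx xn0.
  rewrite /ext; case: ifPn => x0; last by rewrite mule0.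
  by rewrite hx ?lt_def ?xn0// EFinM.
have KF : econv (ext K) (ext f) = (fun x => al%:E * econv (ext K) (ext Rl) x)%E.
  rewrite econvC// (@econv_ae_eql _ _ (fun x => al%:E * ext Rl x)%E)//.
  - by rewrite econvZl//; apply/funext => x; rewrite econvC.
  - exact: emeasurable_funM.
  - by move=> x; rewrite mule_ge0// lee_fin.
have := @filterI _ _ (ae_filter_ringOfSetsType mu) _ _ FE dens_conv.
apply: (@filterS _ _ (ae_filter_ringOfSetsType mu)) => x /= [e1 e2] x0.
(* Substituting f = al R turns f + lam K * f into al (R + lam K * R), which the resolvent equation
   evaluates to al. *)
have := e2; rewrite e1 KF muleCA -ge0_muleDr//; last first.
  by rewrite mule_ge0 ?lee_fin//; exact: econv_ge0.
rewrite (resolvent_econv hR) /ext x0 mule1 -EFinM => -[] e.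
have ll : lam != 0 by rewrite gt_eqF.
apply: (mulfI ll); rewrite -e /al; field; exact: lt0r_neq0.
Qed.

End kernel.

(** * Covariances of a stationary solution *)

Section fubini_ip.
Context d (Omega : measurableType d) (R : realType) (P : probability Omega R).
Local Notation mu := (@lebesgue_measure R).
Local Notation TO := (measurableTypeR R * Omega)%type.
Local Notation Q := (mu \x P)%E.
Variables (T C : R) (k : R -> R) (xi : Omega -> R) (Y : R -> Omega -> R).
Hypothesis k0 : forall u, 0 <= u <= T -> 0 <= k u.
Hypothesis ik : mu.-integrable `[0, T] (EFin \o k).
Hypothesis sxi : sqint P xi.
Hypothesis mY : measurable_fun ((`[0, T] : set R) `*` setT) (fun z : R * Omega => Y z.1 z.2).
Hypothesis sY : forall u, 0 <= u <= T -> sqint P (Y u).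
Hypothesis bY : forall u, 0 <= u <= T -> ip P (Y u) (Y u) <= C.

Let F := lift T (fun u w => k u * (xi w * Y u w)).

Let mF : measurable_fun setT F.
Proof.
apply: measurable_lift; apply: measurable_funM.
  apply: (@measurable_comp _ _ _ _ _ _ (`[0, T]%classic : set R) k _ (fst : R * Omega -> R)) => //.
  - by move=> _ [z [/= z1 _] <-].
  - by apply/measurable_EFinP; exact: measurable_int ik.
  - exact: measurable_funTS.
apply: measurable_funM => //; apply: measurable_funTS.
by apply: measurableT_comp => //; exact: sxi.1.
Qed.

Let intw u : 0 <= u <= T ->
  P.-integrable setT (fun w => (k u * (xi w * Y u w))%:E).
Proof.
move=> uT; rewrite (_ : (fun _ => _) = (fun w => (k u)%:E * (xi w * Y u w)%:E)%E)//.
by apply: integrableZl => //; exact: sqintM_integrable (sY uT).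
Qed.

(** Dominated by k(u) (xi^2 + Y_u^2), whose expectation is at most a constant times k(u), thanks to
    the second-moment bound C that is uniform in u. *)
Lemma fubini_ip_integrable : Q.-integrable setT (EFin \o F).
Proof.
have mF' : measurable_fun setT (EFin \o F) by exact/measurable_EFinP.
apply/integrable12ltyP => //.
apply: (@le_lt_trans _ _ (\int[mu]_(u in `[0%R, T]) ((ip P xi xi + C) * k u)%:E)%E).
  rewrite [leRHS]integral_mkcond; apply: ge0_le_integral => //.
  - by move=> u _; apply: integral_ge0.
  - apply: (measurable_fun_fubini_tonelli_F (abse \o (EFin \o F))) => //.
      exact: measurableT_comp.
    by move=> z /=; rewrite lee_fin.
  - apply/(measurable_restrictT _ _).1 => //; apply/measurable_EFinP.
    by apply: measurable_funM => //; apply/measurable_EFinP; exact: measurable_int ik.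
  - move=> u _; rewrite patchE mem_setE in_itv/=; case: ifPn => uT; last first.
      rewrite integral0_eq// => w _; rewrite /F /lift/= (negbTE uT).
      by rewrite normr0.
    apply: (@le_trans _ _ (\int[P]_w (k u * (xi w ^+ 2 + Y u w ^+ 2))%:E)%E).
      apply: ge0_le_integral => //.
      + apply/measurable_EFinP; apply: (measurableT_comp (@normr_measurable R setT)).
        by apply: (measurableT_comp mF); exact: measurable_pair1.
      + apply/measurable_EFinP; apply: measurable_funM => //.
        by apply: measurable_funD; apply: measurable_funX; [exact: sxi.1|exact: (sY uT).1].
      + move=> w _; rewrite /F /lift/= uT lee_fin normrM ger0_norm ?k0//.
        rewrite ler_wpM2l ?k0//.
        by rewrite ler_norml; apply/andP; split; nra.
    rewrite ge0_integral_mulEFin ?k0//; last 2 first.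
    + by apply: measurable_funD; apply: measurable_funX; [exact: sxi.1|exact: (sY uT).1].
    + by move=> w _; rewrite addr_ge0 ?sqr_ge0.
    under eq_integral do rewrite EFinD.
    rewrite ge0_integralD//; first last.
    + by apply/measurable_EFinP; apply: measurable_funX; exact: (sY uT).1.
    + by move=> w _; rewrite lee_fin sqr_ge0.
    + by apply/measurable_EFinP; apply: measurable_funX; exact: sxi.1.
    + by move=> w _; rewrite lee_fin sqr_ge0.
    rewrite !ip_EFin//; last exact: sY.
    rewrite -EFinD -EFinM lee_fin mulrC ler_wpM2r ?k0// lerD2l bY//.
rewrite ltey_eq (integrable_fin_num _ _)//.
rewrite (_ : (fun _ => _) = (fun u => (ip P xi xi + C)%:E * (EFin \o k) u)%E)//.
exact: integrableZl.
Qed.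

Let inner u : 0 <= u <= T -> (\int[P]_w (F (u, w))%:E = (k u * ip P xi (Y u))%:E)%E.
Proof.
move=> uT; rewrite /F /lift/= uT -RintegralZl//; last exact: sqintM_integrable (sY uT).
by rewrite /Rintegral fineK//; exact: integrable_fin_num (intw uT).
Qed.

(** With k = 1 this gives the measurability of covariance functions in time, which the Volterra
    theory above requires. *)
Lemma fubini_ip_measurable_time : measurable_fun (`[0, T] : set R) (fun u => k u * ip P xi (Y u)).
Proof.
have := measurable_fubini_F fubini_ip_integrable => mI.
apply: (eq_measurable_fun (fun u => fine (fubini_F P (EFin \o F) u))).
  by move=> u; rewrite inE/= in_itv/= => uT; rewrite /fubini_F/= inner.
by apply: measurable_funTS; exact: measurableT_comp.
Qed.

Let outerE w : (\int[mu]_(u in `[0%R, T]) (k u * (xi w * Y u w))%:E =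
  \int[mu]_u (F (u, w))%:E)%E.
Proof.
rewrite integral_mkcond; apply: eq_integral => u _.
by rewrite patchE mem_setE in_itv/= /F /lift/=; case: ifP.
Qed.

Lemma fubini_ip_measurable_omega :
  measurable_fun setT (fun w => \int[mu]_(u in `[0, T]) (k u * (xi w * Y u w))).
Proof.
have := measurable_fubini_G fubini_ip_integrable => mI.
apply: (eq_measurable_fun (fun w => fine (fubini_G mu (EFin \o F) w))).
  by move=> w _; rewrite /fubini_G/= /Rintegral outerE.
exact: measurableT_comp.
Qed.

Lemma fubini_ip_integrable_omega : P.-integrable setT
  (EFin \o fun w => \int[mu]_(u in `[0, T]) (k u * (xi w * Y u w))).
Proof.
have iF := fubini_ip_integrable; have mF' := measurable_int _ iF.
apply/integrableP; split; first exact/measurable_EFinP/fubini_ip_measurable_omega.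
apply: le_lt_trans ((integrable21ltyP mu P mF').1 iF).
apply: ge0_le_integral => //.
- apply: measurableT_comp => //.
  exact/measurable_EFinP/fubini_ip_measurable_omega.
- apply: (measurable_fun_fubini_tonelli_G (abse \o (EFin \o F))) => //.
    exact: measurableT_comp.
  by move=> z /=; rewrite lee_fin.
- move=> w _; apply: (@le_trans _ _ `|\int[mu]_u (F (u, w))%:E|%E).
    rewrite /= /Rintegral outerE.
    by case: (\int[mu]_u _)%E => [r| |]//=; rewrite ?normr0 ?leey.
  apply: le_abse_integral => //; apply: (measurableT_comp mF').
  exact: measurable_pair2.
Qed.

(** Testing the drift convolution of the equation against a random variable xi yields the
    convolution of K with u |-> E[xi Y_u]. *)
Lemma fubini_ip :
  \int[P]_w (\int[mu]_(u in `[0, T]) (k u * (xi w * Y u w))) =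
  \int[mu]_(u in `[0, T]) (k u * ip P xi (Y u)).
Proof.
have iF := fubini_ip_integrable.
transitivity (fine (\int[P]_w \int[mu]_u (F (u, w))%:E)%E).
  congr fine; apply: ae_eq_integral => //.
  - exact/measurable_EFinP/fubini_ip_measurable_omega.
  - exact: measurable_fubini_G iF.
  - have h := ae_integrable2 iF.
    apply: filterS h => w /= iw _.
    by rewrite /Rintegral outerE fineK//; exact: integrable_fin_num iw.
congr fine; rewrite -(Fubini iF)/= [RHS]integral_mkcond; apply: eq_integral => u _.
rewrite patchE mem_setE in_itv/=; case: ifPn => uT; first exact: inner.
by rewrite integral0_eq// => w _; rewrite /F /lift/= (negbTE uT).
Qed.

End fubini_ip.

Lemma path_bounded (R : realType) (g : R -> R) T :
  {within `[0, +oo[, continuous g} -> exists M, forall u, 0 <= u <= T -> `|g u| <= M.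
Proof.
move=> cg.
have cT : {within `[0, T], continuous g}.
  by apply: continuous_subspaceW cg; apply: subset_itvl.
have [M [_ hM]] := compact_bounded (continuous_compact cT (@segment_compact R 0 T)).
exists (`|M| + 1) => u uT; apply: hM.
  by rewrite (le_lt_trans (ler_norm M))// ltrDl.
by exists u => //=; rewrite in_itv.
Qed.

Section reflected_kernel.
Context {R : realType}.
Local Notation mu := (@lebesgue_measure R).
Implicit Types p q : R -> R.

(** The function u |-> p(s - u), cut off after s, so that it can itself be a factor in a convolution
    evaluated at another time. *)
Definition reflected p (s u : R) : R := fine (ext p (s - u)).

Lemma measurable_reflected p s : measurable_fun (`[0, +oo[ : set R) p ->
  measurable_fun setT (reflected p s).
Proof.
move=> mp; apply: measurableT_comp => //.
by apply: (measurableT_comp (measurable_ext mp)); exact: measurable_reflect.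
Qed.

Lemma reflectedE p s u : reflected p s u = if u <= s then p (s - u) else 0.
Proof. by rewrite /reflected /ext subr_ge0; case: ifP. Qed.

Lemma reflected_ge0 p s u : (forall x, 0 <= x -> 0 <= p x) -> 0 <= reflected p s u.
Proof.
by move=> p0; rewrite reflectedE; case: ifP => // us; rewrite p0 ?subr_ge0.
Qed.

(** Both sides are the integral of p(s - u) q(t - u) over u between 0 and the smaller of s and t. It
    lets a covariance computed in the variable s be reread as a source term in the variable t. *)
Lemma econv_reflectedC p q s t :
  econv (ext p) (ext (reflected q t)) s = econv (ext q) (ext (reflected p s)) t.
Proof.
rewrite !econv_ext integral_mkcond [RHS]integral_mkcond.
apply: eq_integral => u _; rewrite !patchE !mem_setE !in_itv/= !reflectedE.
case: (0 <= u) => //=; case: (u <= s); case: (u <= t) => //=; rewrite ?mulr0//.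
by rewrite mulrC.
Qed.

Lemma integral_reflect_itv p s : measurable_fun (`[0, +oo[ : set R) p ->
  (forall x, 0 <= x -> 0 <= p x) ->
  (\int[mu]_(u in `[0%R, s]) (p (s - u))%:E = \int[mu]_(u in `[0%R, s]) (p u)%:E)%E.
Proof.
move=> mp p0; rewrite -(econv_one s mp p0) econv_ext.
by apply: eq_integral => u _; rewrite mulr1.
Qed.

Lemma econv_reflected_diag p s : measurable_fun (`[0, +oo[ : set R) p ->
  econv (ext p) (ext (reflected p s)) s = (\int[mu]_(u in `[0%R, s]) (p u ^+ 2)%:E)%E.
Proof.
move=> mp; rewrite econv_ext -(@integral_reflect_itv (fun x => p x ^+ 2)); last 2 first.
- exact: measurable_funX.
- by move=> x _; exact: sqr_ge0.
apply: eq_integral => u; rewrite inE/= in_itv/= => /andP[_ us].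
by rewrite reflectedE us expr2.
Qed.

Lemma econv_reflected_le p q s t : measurable_fun (`[0, +oo[ : set R) p ->
  measurable_fun (`[0, +oo[ : set R) q ->
  (forall x, 0 <= x -> 0 <= p x) -> (forall x, 0 <= x -> 0 <= q x) ->
  (econv (ext p) (ext (reflected q t)) s <=
   \int[mu]_(u in `[0%R, s]) (p u ^+ 2)%:E + \int[mu]_(u in `[0%R, t]) (q u ^+ 2)%:E)%E.
Proof.
move=> mp mq p0 q0.
rewrite -(@integral_reflect_itv (fun x => p x ^+ 2)); [|exact: measurable_funX|by move=> x _; exact: sqr_ge0].
rewrite -(@integral_reflect_itv (fun x => q x ^+ 2)); [|exact: measurable_funX|by move=> x _; exact: sqr_ge0].
have E p' s' : (\int[mu]_(u in `[0%R, s']) (p' (s' - u) ^+ 2)%:E =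
    \int[mu]_(u in `[0%R, +oo[) (reflected p' s' u ^+ 2)%:E)%E.
  rewrite integral_mkcond [RHS]integral_mkcond; apply: eq_integral => u _.
  rewrite !patchE !mem_setE !in_itv/= andbT reflectedE.
  by case: (0 <= u) => //=; case: (u <= s') => //=; rewrite expr0n.
have mr p' s' : measurable_fun (`[0, +oo[ : set R) p' ->
    measurable_fun (`[0, +oo[ : set R) (reflected p' s').
  by move=> m; apply: measurable_funTS; exact: measurable_reflected.
rewrite !E -ge0_integralD//; last 4 first.
- by move=> u _; rewrite lee_fin sqr_ge0.
- by apply/measurable_EFinP; apply: measurable_funX; exact: mr.
- by move=> u _; rewrite lee_fin sqr_ge0.
- by apply/measurable_EFinP; apply: measurable_funX; exact: mr.
rewrite econv_ext (_ : (\int[mu]_(_ in _) _ = \int[mu]_(u in `[0%R, +oo[) (reflected p s u * reflected q t u)%:E)%E); last first.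
  rewrite integral_mkcond [RHS]integral_mkcond; apply: eq_integral => u _.
  rewrite !patchE !mem_setE !in_itv/= andbT (reflectedE p).
  by case: (0 <= u) => //=; case: (u <= s) => //=; rewrite mul0r.
apply: ge0_le_integral => //.
- by move=> u _; rewrite lee_fin mulr_ge0 ?reflected_ge0.
- by apply/measurable_EFinP; apply: measurable_funM; exact: mr.
- by apply: emeasurable_funD; apply/measurable_EFinP; apply: measurable_funX; exact: mr.
- move=> u _; rewrite lee_fin.
  have := reflected_ge0 s u p0; have := reflected_ge0 t u q0; nra.
Qed.

End reflected_kernel.

Section ito_vanish.
Context (R : realType) (d : measure_display) (Omega : measurableType d)
  (P : probability Omega R).
Variables (F : R -> set (set Omega)) (W : R -> Omega -> R).
Local Notation mu := (@lebesgue_measure R).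

(** The process with no steps approximates Y on [0, a]; it inherits times and coefficients from the
    given sequence, so adaptedness is immediate. Combined with [ito_mart], it makes integrals over
    ]a, t] orthogonal to F_a. *)
Lemma ito_integral_vanish Y a t I : 0 <= a -> a <= t ->
  (forall w, \int[mu]_(s in `[0%R, a]) (Y s w ^+ 2)%:E = 0)%E ->
  ito_integral P F W Y t I -> ito_integral P F W Y a (fun=> 0).
Proof.
move=> a0 at_ Y0 [mY aY mI [S [hS _ _]]]; split.
- apply: measurable_funS mY; first exact: measurableX.
  by apply: setSX => //; apply: subset_itvl.
- by move=> s /andP[s0 s1]; apply: aY; rewrite s0 (le_trans s1).
- exact: measurable_cst.
- exists (fun n => SimpleProcess 0 (sp_time (S n)) (sp_coef (S n))); split => //.
  + rewrite (_ : (fun n => _) = fun=> 0%E); first exact: cvg_cst.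
    apply/funext => n; apply: integral0_eq => w _; rewrite -(Y0 w).
    by apply: eq_integral => s _; rewrite /simple_value big_ord0 sub0r sqrrN.
  + rewrite (_ : (fun n => _) = fun=> 0%E); first exact: cvg_cst.
    apply/funext => n; rewrite unlock; apply: integral0_eq => w _.
    by rewrite /simple_integral big_ord0 subr0 expr0n.
Qed.

End ito_vanish.

Lemma lipschitzP (R : realType) (L : R) (g : R -> R) : L.-lipschitz g ->
  forall x y, `|g x - g y| <= L * `|x - y|.
Proof. by move=> h x y; exact: (h (x, y)). Qed.

Lemma lipschitz_measurable (R : realType) (L : R) (g : R -> R) : L.-lipschitz g ->
  measurable_fun setT g.
Proof.
move=> /lipschitzP h; apply: continuous_measurable_fun => x.
apply/cvgrPdist_le => e e0.
have L1 : 0 < `|L| + 1 by rewrite ltr_wpDl.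
near=> y.
rewrite (le_trans (h x y))//.
apply: (@le_trans _ _ ((`|L| + 1) * `|x - y|)).
  by rewrite ler_wpM2r// (le_trans (ler_norm L))// lerDl.
rewrite mulrC -ler_pdivlMr//.
near: y; have /cvgrPdist_le := @cvg_id _ (nbhs x); apply.
by rewrite divr_gt0.
Unshelve. all: by end_near. Qed.

Section covariance.
Context (R : realType) (d : measure_display) (Omega : measurableType d)
  (P : probability Omega R).
Variables (F : R -> set (set Omega)) (W : R -> Omega -> R) (K : R -> R)
  (lam mu0 : R) (sigma : R -> R) (X : R -> Omega -> R) (v0 sb2 : R).
Local Notation mu := (@lebesgue_measure R).
Local Notation TO := (measurableTypeR R * Omega)%type.
Local Notation Q := (mu \x P)%E.
Hypotheses (hF : usual_filtration P F) (hW : brownian_motion P F W).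
Hypotheses (hK : admissible_kernel K) (lam0 : 0 < lam).
Hypothesis msigma : measurable_fun setT sigma.
Hypothesis hX : volterra_solution P F W K (fun x => mu0 - lam * x) sigma X.
Hypotheses (hv0 : 0 <= v0) (hsb2 : 0 <= sb2).
Hypothesis hmean : forall t : R, 0 <= t -> 'E_P[X t]%E = (mu0 / lam)%:E.
Hypothesis hvar : forall t : R, 0 <= t -> 'V_P[X t]%E = v0%:E.
Hypothesis hsig2 : forall t : R, 0 <= t ->
  'E_P[(fun w => sigma (X t w) ^+ 2)%R]%E = sb2%:E.

Definition centered (t : R) (w : Omega) : R := X t w - mu0 / lam.

Let pX t : 0 <= t -> preim_in (F t) (X t).
Proof. by move=> t0; case: hX => /(_ t t0) + _ _; rewrite measurable_wrtP. Qed.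

Let mX t : 0 <= t -> measurable_fun setT (X t).
Proof. by move=> t0; exact: (preim_in_meas hF t0 (pX t0)). Qed.

Let cX : continuous_paths X. Proof. by case: hX. Qed.

Lemma preim_in_centered t : 0 <= t -> preim_in (F t) (centered t).
Proof.
move=> t0; have sF := filtration_sigma hF t0.
by apply: preim_inB => //; [exact: pX|exact: preim_in_cst].
Qed.

Lemma sqint_centered t : 0 <= t ->
  sqint P (centered t) /\ ip P (centered t) (centered t) = v0.
Proof.
move=> t0.
have mc : measurable_fun setT (centered t) by exact: (preim_in_meas hF t0 (preim_in_centered t0)).
have E : (\int[P]_w (centered t w ^+ 2)%:E = v0%:E)%E.
  have := hvar t0; rewrite /variance unlock hmean//= unlock => <-.
  by apply: eq_integral => w _.
have s : sqint P (centered t) by apply: sqintP => //; rewrite E ltry.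
by split => //; apply: EFin_inj; rewrite -ip_EFin.
Qed.

Lemma measurable_centered T :
  measurable_fun ((`[0, T] : set R) `*` setT) (fun z : R * Omega => centered z.1 z.2).
Proof.
by apply: measurable_funB => //; exact: measurable_joint_itv mX cX T.
Qed.

Lemma sqint_sigma t : 0 <= t -> sqint P (fun w => sigma (X t w)) /\
  ip P (fun w => sigma (X t w)) (fun w => sigma (X t w)) = sb2.
Proof.
move=> t0; have E := hsig2 t0; rewrite unlock in E.
have s : sqint P (fun w => sigma (X t w)).
  apply: sqintP; first by apply: measurableT_comp => //; exact: mX.
  by rewrite E ltry.
by split => //; apply: EFin_inj; rewrite -ip_EFin.
Qed.

Lemma ip_centered_measurable T xi : sqint P xi ->
  measurable_fun (`[0, T] : set R) (fun u => ip P xi (centered u)).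
Proof.
move=> sx.
have i1 : mu.-integrable `[0, T] (EFin \o (cst 1 : R -> R)).
  apply/integrableP; split; first exact/measurable_EFinP.
  under eq_integral do rewrite /= normr1.
  rewrite integral_cst//= mul1e lebesgue_measure_itv/=.
  by case: ifP => _; rewrite ?ltry// -EFinB ltry.
have := @fubini_ip_measurable_time _ _ _ P T v0 (cst 1) xi centered (fun _ _ => ler01) i1 sx
  (@measurable_centered T).
have h1 u : 0 <= u <= T -> sqint P (centered u).
  by move=> /andP[u0 _]; exact: (sqint_centered u0).1.
have h2 u : 0 <= u <= T -> ip P (centered u) (centered u) <= v0.
  by move=> /andP[u0 _]; rewrite (sqint_centered u0).2.
move=> /(_ h1 h2); apply: eq_measurable_fun => u _.
by rewrite /= mul1r.
Qed.

Lemma ip_centered_bound T xi : sqint P xi ->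
  forall u, 0 <= u <= T -> `|ip P xi (centered u)| <= Num.sqrt (ip P xi xi) * Num.sqrt v0.
Proof.
move=> sx u /andP[u0 _]; have [s e] := sqint_centered u0.
by rewrite -e; exact: ip_abs.
Qed.

(** Since mu0 - lam x = - lam (x - mu0 / lam), the centred process satisfies the equation without
    constant drift. Pairing it with xi leaves a scalar equation, the expectation passing inside the
    convolution by [fubini_ip]. *)
Lemma ip_centered_eq t xi I : 0 <= t -> sqint P xi -> sqint P I ->
  {ae P, forall w, X t w = X 0 w + convolution K (fun s => mu0 - lam * X s w) t + I w} ->
  ip P xi (centered t) = ip P xi (centered 0)
    - lam * convolution K (fun u => ip P xi (centered u)) t + ip P xi I.
Proof.
move=> t0 sx sI hI.
have ik := kernel_reflect_integrable hK t0.
have k0 u : 0 <= u <= t -> 0 <= K (t - u).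
  by move=> /andP[_ ut]; rewrite (kernel_ge0 hK)// subr_ge0.
have h1 u : 0 <= u <= t -> sqint P (centered u).
  by move=> /andP[u0 _]; exact: (sqint_centered u0).1.
have h2 u : 0 <= u <= t -> ip P (centered u) (centered u) <= v0.
  by move=> /andP[u0 _]; rewrite (sqint_centered u0).2.
have fb := fubini_ip k0 ik sx (@measurable_centered t) h1 h2.
have mo := fubini_ip_measurable_omega k0 ik sx (@measurable_centered t) h1 h2.
have [st _] := sqint_centered t0; have [s0 _] := sqint_centered (lexx 0).
have e1 : \int[P]_w (- lam * \int[mu]_(u in `[0, t]) (K (t - u) * (xi w * centered u w))) =
    ip P xi (fun w => centered t w - centered 0 w - I w).
  apply: ae_eq_Rintegral.
  - exact: measurable_funM.
  - apply: measurable_funM; first exact: sx.1.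
    apply: measurable_funB; last exact: sI.1.
    by apply: measurable_funB; [exact: st.1|exact: s0.1].
  apply: filterS hI => w; rewrite /centered => ->.
  have -> : X 0 w + convolution K (fun s => mu0 - lam * X s w) t + I w - mu0 / lam -
     (X 0 w - mu0 / lam) - I w = convolution K (fun s => mu0 - lam * X s w) t by ring.
  have [M hM] := path_bounded t (@cX w).
  have mp : measurable_fun (`[0, t] : set R) (fun u => X u w).
    apply: (measurable_funS _ (_ : `[0, t] `<=` `[0, +oo[)) => //.
      exact: subset_itvl.
    by apply: subspace_continuous_measurable_fun => //; exact: @cX.
  have mc : measurable_fun (`[0, t] : set R) (fun u => centered u w) by exact: measurable_funB.
  have bc u : 0 <= u <= t -> `|centered u w| <= M + `|mu0 / lam|.
    by move=> ut; rewrite (le_trans (ler_normB _ _))// lerD2r hM.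
  have ic := convolution_integrable hK t0 mc bc.
  rewrite /convolution.
  rewrite -[X in _ = xi w * X](_ : - lam * \int[mu]_(u in `[0, t]) (K (t - u) * centered u w) = _); last first.
    rewrite -RintegralZl//; apply: eq_Rintegral => u _; rewrite /centered.
    by field; exact: lt0r_neq0.
  rewrite mulrCA -[in RHS]RintegralZl//.
  by congr (_ * _); apply: eq_Rintegral => u _; rewrite /centered; ring.
move: e1; rewrite RintegralZl//; last first.
  exact: (fubini_ip_integrable_omega k0 ik sx (@measurable_centered t) h1 h2).
rewrite fb ipBr//; last exact: sqintB.
rewrite ipBr//.
rewrite /convolution; lra.
Qed.

(** The stochastic convolution M_t, one random variable for each t separately: its integrand depends
    on t, so no single stochastic integral contains all of them. *)
Definition is_noise t (I : Omega -> R) : Prop :=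
  ito_integral P F W (fun s w => K (t - s) * sigma (X s w)) t I /\
  {ae P, forall w, X t w = X 0 w + convolution K (fun s => mu0 - lam * X s w) t + I w}.

(** The polarised isometry gives the integral of K(s - u) K(t - u) E[sigma(X_u)^2], and the last
    factor is the constant [sb2]. *)
Lemma noise_ip s t I J : 0 <= s -> 0 <= t -> is_noise s I -> is_noise t J ->
  [/\ sqint P I, sqint P J &
  (ip P I J)%:E = (sb2%:E * econv (ext K) (ext (reflected K t)) s)%E].
Proof.
move=> s0 t0 [iI _] [iJ _]; have [sI sJ sY sY' ->] := ito_ip hF hW s0 t0 iI iJ.
split => //.
have iQ := sqintM_integrable sY sY'.
rewrite /ip /Rintegral fineK; last exact: integrable_fin_num.
rewrite -(integral12_prod_meas1 iQ)/= econv_ext -ge0_integralZl; [|by []|..]; last 3 first.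
- apply/measurable_EFinP; apply: measurable_funM.
    by apply/measurable_EFinP; exact: measurable_int (kernel_reflect_integrable hK s0).
  by apply: measurable_funTS; apply: measurable_reflected; exact: kernel_measurable hK.
- move=> u; rewrite /= in_itv/= => /andP[_ us].
  by rewrite lee_fin mulr_ge0 ?(kernel_ge0 hK) ?subr_ge0 ?reflected_ge0//; exact: kernel_ge0.
- by rewrite lee_fin.
rewrite [RHS]integral_mkcond; apply: eq_integral => u _.
rewrite patchE mem_setE in_itv/= /fubini_F /lift/=; case: ifPn => [/andP[u0 us]|_]; last first.
  by rewrite integral0_eq// => w _; rewrite mul0r.
rewrite u0/= reflectedE; case: ifPn => ut; last first.
  by rewrite mulr0 mule0 integral0_eq// => w _; rewrite mulr0.
have [ss es] := sqint_sigma u0.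
under eq_integral => w _.
  rewrite (_ : _ * _ = K (s - u) * K (t - u) * (sigma (X u w) * sigma (X u w))); last by ring.
  over.
rewrite ge0_integral_mulEFin//; last 3 first.
- by rewrite mulr_ge0// (kernel_ge0 hK)// subr_ge0.
- by apply: measurable_funM; exact: ss.1.
- by move=> w _; rewrite -expr2 sqr_ge0.
under eq_integral do rewrite -expr2.
by rewrite ip_EFin// es muleC.
Qed.

Lemma noise_exists t : 0 <= t -> exists I, is_noise t I.
Proof. by move=> t0; have [_ _ /(_ t t0)] := hX. Qed.

Lemma noise_ip_F0 t xi I : 0 <= t -> preim_in (F 0) xi -> sqint P xi -> is_noise t I ->
  ip P xi I = 0.
Proof.
move=> t0 pxi sxi [iI _].
(* The integrand belonging to t is kept fixed while the upper limit goes down to 0; for a fixed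
   integrand the martingale property is available. *)
have i0 : ito_integral P F W (fun s w => K (t - s) * sigma (X s w)) 0 (fun=> 0).
  by apply: ito_integral_vanish iI => // w; rewrite set_itv1 integral_set1.
rewrite (ito_mart hF hW (lexx 0) t0 pxi sxi i0 iI).
by rewrite ipC ip0l.
Qed.

Variable Rl : R -> R.
Hypothesis hR : resolvent K lam Rl.
Hypothesis Rdec : {in `[0, +oo[ &, {homo Rl : s t / s <= t >-> t <= s}}.
Hypothesis Rlim : Rl t @[t --> +oo] --> 0.
Hypothesis Rder : forall t : R, 0 < t -> derivable Rl t 1 /\ derive1 Rl t < 0.
Hypothesis Rsqr : forall T : R, 0 < T ->
  (\int[mu]_(u in `]0%R, T]) (derive1 Rl u ^+ 2)%:E < +oo)%E.

Let f := dens Rl.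
Let mf : measurable_fun (`[0, +oo[ : set R) f := measurable_funTS (measurable_dens Rdec Rder).
Let f0 x (_ : 0 <= x) : 0 <= f x := dens_ge0 Rder x.
Let mK := kernel_measurable hK.
Let K0 := kernel_ge0 hK.

Lemma dens_sqr_lty T : (\int[mu]_(u in `[0%R, T]) (f u ^+ 2)%:E < +oo)%E.
Proof.
have [T0|T0] := ltP 0 T; last first.
  move: T0; rewrite le_eqVlt => /predU1P[->|T0]; first by rewrite set_itv1 integral_set1.
  by rewrite set_itv_ge ?integral_set0// bnd_simp -ltNge.
rewrite (le_lt_trans _ (Rsqr T0))// integral_mkcond [leRHS]integral_mkcond.
rewrite le_eqVlt; apply/orP; left; apply/eqP; apply: eq_integral => u _.
rewrite !patchE !mem_setE !in_itv/=; have [u0|u0] := leP u 0.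
  by case: ifP => // _; rewrite /f dens_le0// expr0n.
by rewrite ltW//=; case: ifP => // _; rewrite /f /dens patchE mem_setE in_itv/= u0/= sqrrN.
Qed.

Lemma kernel_sqr_lty T : (\int[mu]_(u in `[0%R, T]) (K u ^+ 2)%:E < +oo)%E.
Proof.
apply: (@le_lt_trans _ _ (\int[mu]_(u in `[0%R, Num.max T 1%R]) (K u ^+ 2)%:E)%E).
  apply: ge0_subset_integral => //.
  - apply/measurable_EFinP; apply: measurable_funX; exact: measurable_kernel.
  - by move=> u _; rewrite lee_fin sqr_ge0.
  - by apply: subset_itvl; rewrite bnd_simp le_max lexx.
have T1 : 0 < Num.max T 1 by rewrite lt_max ltr01 orbT.
by rewrite ltey_eq (integrable_fin_num _ (kernel_sqr_integrable hK T1)).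
Qed.

Lemma econv_reflected_bound (p : R -> R) t T : measurable_fun (`[0, +oo[ : set R) p ->
  (forall x, 0 <= x -> 0 <= p x) ->
  (forall t, \int[mu]_(u in `[0%R, t]) (p u ^+ 2)%:E < +oo)%E ->
  exists B : R, forall s, 0 <= s <= T -> (econv (ext K) (ext (reflected p t)) s <= B%:E)%E.
Proof.
move=> mp p0 fp.
pose B := (\int[mu]_(u in `[0%R, T]) (K u ^+ 2)%:E + \int[mu]_(u in `[0%R, t]) (p u ^+ 2)%:E)%E.
exists (fine B) => s /andP[s0 sT]; rewrite fineK; last first.
  rewrite /B ge0_fin_numE; first exact: lte_add_pinfty (kernel_sqr_lty _) (fp _).
  by rewrite adde_ge0// integral_ge0// => u _; rewrite lee_fin sqr_ge0.
apply: (le_trans (econv_reflected_le _ _ mK mp K0 p0)); rewrite leeD2r//.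
apply: ge0_subset_integral => //.
- apply/measurable_EFinP; apply: measurable_funX; exact: measurable_kernel.
- by move=> u _; rewrite lee_fin sqr_ge0.
- exact: subset_itvl.
Qed.

(** The common frame of the three covariance computations, with xi equal to Y_0, then M_t, then Y_s:
    knowing the covariance of xi with the noise in the stated form determines its covariance with
    the process. *)
Lemma ip_centered_solve (p : R -> R) t T xi c0 c1 : 0 < T ->
  measurable_fun (`[0, +oo[ : set R) p -> (forall x, 0 <= x -> 0 <= p x) ->
  (forall t, \int[mu]_(u in `[0%R, t]) (p u ^+ 2)%:E < +oo)%E ->
  sqint P xi ->
  (forall s I, 0 <= s -> is_noise s I ->
     ip P xi (centered 0) + ip P xi I = c0 + c1 * fine (econv (ext K) (ext (reflected p t)) s)) ->
  forall s, 0 <= s <= T ->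
    ip P xi (centered s) = c0 * Rl s + c1 / lam * fine (econv (ext f) (ext (reflected p t)) s).
Proof.
move=> T0 mp p0 fp sxi hI.
have [B hB] := econv_reflected_bound t T mp p0 fp.
apply: (volterra_solve hK lam0 hR Rdec Rlim Rder _ _ T0 (ip_centered_measurable sxi)
  (ip_centered_bound sxi) hB).
- by apply: measurable_funTS; exact: measurable_reflected.
- by move=> x _; exact: reflected_ge0.
move=> s /andP[s0 sT]; have [I hI'] := noise_exists s0.
have [sI _ _] := noise_ip s0 s0 hI' hI'.
rewrite (ip_centered_eq s0 sxi sI hI'.2) -(hI _ _ s0 hI').
by rewrite addrAC -addrA; ring.
Qed.

Lemma ip_centered0 s : 0 <= s -> ip P (centered 0) (centered s) = v0 * Rl s.
Proof.
move=> s0; have s1 : 0 < s + 1 by rewrite ltr_wpDl.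
have [sc0 e0] := sqint_centered (lexx 0).
(* The noise is orthogonal to Y_0, so c1 = 0 and the factor K is a placeholder. *)
rewrite (@ip_centered_solve K 0 _ _ v0 0 s1 mK K0 kernel_sqr_lty sc0) ?s0 ?lerDl ?ler01//.
  by rewrite mul0r mul0r addr0.
move=> u I u0 hI; rewrite e0 (noise_ip_F0 u0 _ sc0 hI); last exact: preim_in_centered.
by rewrite mul0r.
Qed.

(** Here xi = M_t: c0 = 0 because M_t is orthogonal to F_0, and [noise_ip] supplies c1 = [sb2] with
    p = K. *)
Lemma ip_noise_centered s t I : 0 <= s -> 0 <= t -> is_noise t I ->
  ip P I (centered s) = sb2 / lam * fine (econv (ext f) (ext (reflected K t)) s).
Proof.
move=> s0 t0 hI; have s1 : 0 < s + 1 by rewrite ltr_wpDl.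
have [sI _ _] := noise_ip t0 t0 hI hI.
rewrite (@ip_centered_solve K t _ _ 0 sb2 s1 mK K0 kernel_sqr_lty sI) ?s0 ?lerDl ?ler01//.
  by rewrite mul0r add0r.
move=> u J u0 hJ; have [sc0 _] := sqint_centered (lexx 0).
rewrite ipC (noise_ip_F0 t0 (preim_in_centered (lexx 0)) sc0 hI).
have [_ _ e] := noise_ip u0 t0 hJ hI.
rewrite !add0r ipC; apply: EFin_inj; rewrite e EFinM fineK//.
rewrite ge0_fin_numE.
  apply: (le_lt_trans (econv_reflected_le _ _ mK mK K0 K0)).
  by rewrite lte_add_pinfty ?kernel_sqr_lty.
by apply: econv_ge0; apply: ext_ge0 => // x _; exact: reflected_ge0.
Qed.

(* Solving in t the Volterra equation tested against X_s gives the covariance of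
   X_s and X_t; this is its value at t = s. *)
Lemma variance_identity s : 0 <= s ->
  (sb2%:E * \int[mu]_(u in `[0%R, s]) (f u ^+ 2)%:E = (lam ^+ 2 * v0 * (1 - Rl s ^+ 2))%:E)%E.
Proof.
move=> s0; have s1 : 0 < s + 1 by rewrite ltr_wpDl.
have [sc es] := sqint_centered s0.
(* Here xi = Y_s: c0 is E[Y_s Y_0], and the noise part is a multiple of K convolved with u |-> f(s -
   u), whence p = f. *)
have := @ip_centered_solve f s _ _ (v0 * Rl s) (sb2 / lam) s1 mf f0 dens_sqr_lty sc _ s.
rewrite s0 lerDl ler01 es => /(_ _ isT).
have -> : econv (ext f) (ext (reflected f s)) s = (\int[mu]_(u in `[0%R, s]) (f u ^+ 2)%:E)%E.
  exact: econv_reflected_diag.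
move=> e.
have {}e : v0 = v0 * Rl s * Rl s + sb2 / lam / lam *
    fine (\int[mu]_(u in `[0%R, s]) (f u ^+ 2)%:E)%E.
  (* E[M_t Y_s] was obtained as a convolution with f at time s; [econv_reflectedC] rewrites it as a
     convolution with K at time t. *)
  apply: e => t I t0 hI; rewrite ipC ip_centered0// ipC (ip_noise_centered s0 t0 hI).
  by rewrite econv_reflectedC.
rewrite -[X in (_ * X)%E]fineK; last first.
  by rewrite ge0_fin_numE ?dens_sqr_lty// integral_ge0// => u _; rewrite lee_fin sqr_ge0.
rewrite -EFinM; congr EFin.
have -> : lam ^+ 2 * v0 * (1 - Rl s ^+ 2) = lam ^+ 2 * (v0 - v0 * Rl s * Rl s) by ring.
rewrite {1}e addrAC subrr add0r; field; exact: lt0r_neq0.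
Qed.

End covariance.

(** * The two cases for [sb2] *)

Section conclusions.
Context (R : realType) (d : measure_display) (Omega : measurableType d)
  (P : probability Omega R).
Variables (F : R -> set (set Omega)) (W : R -> Omega -> R) (K : R -> R)
  (lam mu0 : R) (sigma : R -> R) (X : R -> Omega -> R) (v0 sb2 : R).
Local Notation mu := (@lebesgue_measure R).
Hypotheses (hF : usual_filtration P F) (hW : brownian_motion P F W).
Hypotheses (hK : admissible_kernel K) (lam0 : 0 < lam).
Hypothesis msigma : measurable_fun setT sigma.
Hypothesis hX : volterra_solution P F W K (fun x => mu0 - lam * x) sigma X.
Hypotheses (hv0 : 0 <= v0) (hsb2 : 0 <= sb2).
Hypothesis hmean : forall t : R, 0 <= t -> 'E_P[X t]%E = (mu0 / lam)%:E.
Hypothesis hvar : forall t : R, 0 <= t -> 'V_P[X t]%E = v0%:E.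
Hypothesis hsig2 : forall t : R, 0 <= t ->
  'E_P[(fun w => sigma (X t w) ^+ 2)%R]%E = sb2%:E.

Lemma stationary_kernel_const : 0 < sb2 ->
  {ae mu, forall t : R, 0 <= t -> K t = 2 * lam * v0 / sb2}.
Proof.
move=> sb0; have [Rl [hR Rdec Rlim Rder Rsqr]] := kernel_resolvent hK lam0.
apply: (kernel_const hK lam0 hR Rdec Rlim Rder hv0 sb0) => t t0.
have e := variance_identity hF hW hK lam0 msigma hX hsb2 hmean hvar hsig2 hR Rdec Rlim Rder Rsqr t0.
have sb : sb2 != 0 by rewrite gt_eqF.
rewrite (_ : lam ^+ 2 / sb2 * v0 * (1 - Rl t ^+ 2) =
   sb2^-1 * (lam ^+ 2 * v0 * (1 - Rl t ^+ 2))); last by ring.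
by rewrite EFinM -e muleA -EFinM mulVf// mul1e.
Qed.

Lemma stationary_degenerate : sb2 = 0 ->
  sigma (mu0 / lam) = 0 /\
    forall t : R, 0 <= t -> {ae P, forall w, X t w = mu0 / lam}.
Proof.
move=> sb0; have [Rl [hR Rdec Rlim Rder Rsqr]] := kernel_resolvent hK lam0.
have v00 : v0 = 0.
  have e t : 0 <= t -> v0 = v0 * Rl t ^+ 2.
    move=> t0; have := variance_identity hF hW hK lam0 msigma hX hsb2 hmean hvar hsig2
      hR Rdec Rlim Rder Rsqr t0.
    rewrite sb0 mul0e => -[] /esym/eqP; rewrite -mulrA mulf_eq0 sqrf_eq0 gt_eqF//=.
    by rewrite mulrBr mulr1 subr_eq0 => /eqP.
  have c1 : v0 * Rl t ^+ 2 @[t --> +oo] --> v0 * (0 * 0).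
    by apply: cvgM; [exact: cvg_cst|apply: cvgM].
  have c2 : v0 * Rl t ^+ 2 @[t --> +oo] --> v0.
    apply: cvg_near_cst; near=> t; apply/esym/e; near: t; exact: nbhs_pinfty_ge.
  by rewrite (cvg_unique _ c2 c1)// !mulr0.
have Xc t : 0 <= t -> {ae P, forall w, X t w = mu0 / lam}.
  move=> t0; have [s es] := sqint_centered hF hX hmean hvar t0.
  rewrite v00 in es.
  have := ip_eq0 s es; apply: filterS => w /eqP; rewrite /centered subr_eq0.
  by move/eqP.
split => //.
have [sX es] := sqint_sigma hF msigma hX hsig2 (lexx 0).
have := ip_eq0 sX; rewrite es sb0 => /(_ erefl) h1.
have := Xc 0 (lexx 0) => h2.
have h : {ae P, forall w, sigma (mu0 / lam) = 0}.
  by move: h1 h2; apply: filterS2 => w h1 <-.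
(* The statement about sigma is deterministic: if it failed, the negligible exceptional set would be
   all of Omega, which has mass 1. *)
apply: contrapT => n0; case: h => A [mA A0 sA].
have AT : A = setT by apply/seteqP; split => // w _; apply: sA => /= z; exact: n0.
by move: A0; rewrite AT probability_setT => /eqP; rewrite onee_eq0.
Unshelve. all: by end_near. Qed.

End conclusions.

(** * Constant kernels *)

Section kernel_constant.
Context (R : realType) (d : measure_display) (Omega : measurableType d)
  (P : probability Omega R).
Variables (F : R -> set (set Omega)) (W : R -> Omega -> R).
Local Notation mu := (@lebesgue_measure R).
Hypothesis hF : usual_filtration P F.

Lemma measurable_section (t : R) (Y : R -> Omega -> R) w :
  measurable_fun ((`[0, t] : set R) `*` setT) (fun z : R * Omega => Y z.1 z.2) ->
  measurable_fun (`[0, t] : set R) (fun s => Y s w).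
Proof.
move=> mY; apply: (@measurable_comp _ _ _ _ _ _ ((`[0, t]%classic : set R) `*` setT)
  (fun z : R * Omega => Y z.1 z.2) _ (fun s : R => (s, w))) => //.
- exact: measurableX.
- by move=> _ [s /= ts <-].
- by apply: measurable_funTS; exact: measurable_pair2.
Qed.

(** The kernel is constant only almost everywhere in time, so integrands must be exchangeable up to
    null sets of times, path by path; the same simple processes approximate both. *)
Lemma ito_integral_ae_eq (Y Y' : R -> Omega -> R) t I :
  measurable_fun ((`[0, t] : set R) `*` setT) (fun z : R * Omega => Y' z.1 z.2) ->
  (forall s : R, 0 <= s <= t -> measurable_wrt (F s) (Y' s)) ->
  (forall w, {ae mu, forall s : R, 0 <= s <= t -> Y s w = Y' s w}) ->
  ito_integral P F W Y t I -> ito_integral P F W Y' t I.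
Proof.
move=> mY' aY' e [mY aY mI [S [hS cS cI]]].
split; [exact: mY'|exact: aY'|exact: mI|exists S; split; [exact: hS| |exact: cI]].
suff <- : (fun n => \int[P]_w \int[mu]_(s in `[0%R, t])
  ((simple_value (S n) s w - Y s w) ^+ 2)%:E)%E = (fun n => \int[P]_w \int[mu]_(s in `[0%R, t])
  ((simple_value (S n) s w - Y' s w) ^+ 2)%:E)%E by exact: cS.
apply/funext => n; apply: eq_integral => w _; apply: ae_eq_integral => //.
- apply/measurable_EFinP; apply: measurable_funX; apply: measurable_funB.
    apply: (@measurable_section _ (simple_value (S n))).
    exact: (measurable_simple_value hF).
  exact: measurable_section.
- apply/measurable_EFinP; apply: measurable_funX; apply: measurable_funB.
    apply: (@measurable_section _ (simple_value (S n))).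
    exact: (measurable_simple_value hF).
  exact: measurable_section.
- have := e w; apply: (@filterS _ _ (ae_filter_ringOfSetsType mu)) => s es.
  by rewrite /= in_itv/= => st; rewrite es.
Qed.

Variables (K : R -> R) (c : R).
Hypothesis mK : measurable_fun (`[0, +oo[ : set R) K.
Hypothesis Kc : {ae mu, forall t : R, 0 <= t -> K t = c}.

Let Kct t : {ae mu, forall s : R, 0 <= s <= t -> K (t - s) = c}.
Proof.
have := ae_reflect t Kc; apply: (@filterS _ _ (ae_filter_ringOfSetsType mu)) => s /= h.
by move=> /andP[_ st]; apply: h; rewrite subr_ge0.
Qed.

Variables (b sigma : R -> R).
Hypotheses (mb : measurable_fun setT b) (msigma : measurable_fun setT sigma).

Let mKt t : measurable_fun (`[0, t] : set R) (fun s => K (t - s)).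
Proof.
apply: (@measurable_comp _ _ _ _ _ _ (`[0, +oo[%classic : set R) K _ (fun s : R => t - s)) => //.
- by move=> _ [s /= + <-]; rewrite !in_itv/= andbT subr_ge0 => /andP[].
- by apply: measurable_funTS; exact: measurable_reflect.
Qed.

Lemma convolution_const (x : R -> R) t : {within `[0, +oo[, continuous x} ->
  convolution K (fun s => b (x s)) t = \int[mu]_(s in `[0, t]) (c * b (x s)).
Proof.
move=> cx.
have mx : measurable_fun (`[0, t] : set R) x.
  apply: (measurable_funS _ (_ : `[0, t] `<=` `[0, +oo[)) => //.
    exact: subset_itvl.
  exact: subspace_continuous_measurable_fun.
have mbx : measurable_fun (`[0, t] : set R) (fun s => b (x s)) by exact: measurableT_comp.
congr fine; apply: ae_eq_integral => //.
- by apply/measurable_EFinP; apply: measurable_funM => //; exact: mKt.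
- by apply/measurable_EFinP; exact: measurable_funM.
- have := Kct t; apply: (@filterS _ _ (ae_filter_ringOfSetsType mu)) => s h.
  by rewrite /= in_itv/= => st; rewrite h.
Qed.

Lemma noise_const (Y : R -> Omega -> R) t I : adapted F Y -> continuous_paths Y ->
  ito_integral P F W (fun s w => K (t - s) * sigma (Y s w)) t I <->
  ito_integral P F W (fun s w => c * sigma (Y s w)) t I.
Proof.
move=> aY cY.
have pY s : 0 <= s -> preim_in (F s) (Y s) by move=> s0; rewrite -measurable_wrtP; exact: aY.
have mY s : 0 <= s -> measurable_fun setT (Y s).
  by move=> s0; exact: (preim_in_meas hF s0 (pY s s0)).
have jY : measurable_fun ((`[0, t] : set R) `*` setT) (fun z : R * Omega => Y z.1 z.2).
  exact: measurable_joint_itv mY cY t.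
have jS : measurable_fun ((`[0, t] : set R) `*` setT) (fun z : R * Omega => sigma (Y z.1 z.2)).
  exact: (measurableT_comp msigma jY).
have jK : measurable_fun ((`[0, t] : set R) `*` setT)
    (fun z : R * Omega => K (t - z.1) * sigma (Y z.1 z.2)).
  apply: measurable_funM => //.
  apply: (@measurable_comp _ _ _ _ _ _ (`[0, t]%classic : set R) (fun s => K (t - s)) _
     (fst : R * Omega -> R)) => //.
  - by move=> _ [z [/= z1 _] <-].
  - exact: measurable_funTS.
have jc : measurable_fun ((`[0, t] : set R) `*` setT)
    (fun z : R * Omega => c * sigma (Y z.1 z.2)) by exact: measurable_funM.
have pa (k s : R) : 0 <= s <= t -> measurable_wrt (F s) (fun w => k * sigma (Y s w)).
  move=> /andP[s0 st]; rewrite measurable_wrtP; have sF := filtration_sigma hF s0.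
  apply: preim_inM => //; first exact: preim_in_cst.
  exact: (preim_in_comp msigma (pY s s0)).
split; apply: ito_integral_ae_eq => //.
- by move=> s; exact: pa.
- move=> w; have := Kct t; apply: (@filterS _ _ (ae_filter_ringOfSetsType mu)) => s h st.
  by rewrite h.
- by move=> s; exact: pa.
- move=> w; have := Kct t; apply: (@filterS _ _ (ae_filter_ringOfSetsType mu)) => s h st.
  by rewrite h.
Qed.

Lemma volterra_sde (Y : R -> Omega -> R) :
  volterra_solution P F W K b sigma Y <->
  sde_solution P F W (fun x => c * b x) (fun x => c * sigma x) Y.
Proof.
split=> -[aY cY hY]; split=> // t t0; have [I [iI eI]] := hY t t0; exists I.
- split; first exact/(noise_const _ _ aY cY).
  by apply: filterS eI => w ->; rewrite convolution_const//; exact: @cY.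
- split; first exact/(noise_const _ _ aY cY).
  by apply: filterS eI => w ->; rewrite convolution_const//; exact: @cY.
Qed.

End kernel_constant.

(** * Conditional expectations *)

Section density.
Context d (T : measurableType d) (R : realType) (m : {sigma_finite_measure set T -> \bar R}).
Local Open Scope ereal_scope.

(** The measure Z m. Its change-of-variables formula is the Radon-Nikodym one, once the derivative
    is identified with Z almost everywhere. *)
Lemma density_measure (Z : T -> \bar R) : m.-integrable setT Z -> (forall x, 0 <= Z x) ->
  exists nu : {finite_measure set T -> \bar R},
    (forall A, nu A = \int[m]_(x in A) Z x) /\
    forall g : T -> \bar R, measurable_fun setT g -> (forall x, 0 <= g x) ->
      \int[nu]_x g x = \int[m]_x (Z x * g x).
Proof.
move=> iZ Z0; have mZ := measurable_int _ iZ.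
pose f := fun A : set T => \int[m]_(x in A) Z x.
have f0 : f set0 = 0 by rewrite /f integral_set0.
have fge A : 0 <= f A by exact: integral_ge0.
have fsa : semi_sigma_additive f by exact: semi_sigma_additive_nng_induced.
pose nu0 : {measure set T -> \bar R} := HB.pack f (isMeasure.Build _ _ _ f f0 fge fsa).
have fin : fin_num_fun nu0.
  by move=> A mA; apply: integrable_fin_num => //; exact: integrableS iZ.
pose nu : {finite_measure set T -> \bar R} :=
  HB.pack f nu0 (Measure_isFinite.Build _ _ _ nu0 fin).
have num : nu `<< m.
  apply/null_content_dominatesP => A mA mA0.
  rewrite /nu /= /f (eq_integral (fun x => `|Z x|)).
    by apply: integral_abs_eq0 => //; exact: measurable_funTS.
  by move=> x _; rewrite gee0_abs.
exists nu; split => // g mg g0.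
rewrite -(Radon_Nikodym_SigmaFinite.change_of_variables num g0 measurableT mg).
have mf := measurable_int _ (Radon_Nikodym_SigmaFinite.f_integrable num).
apply: ae_eq_integral => //.
- exact: emeasurable_funM.
- exact: emeasurable_funM.
- have : ae_eq m setT (Radon_Nikodym_SigmaFinite.f nu m) Z.
    apply: integral_ae_eq => //; first exact: Radon_Nikodym_SigmaFinite.f_integrable.
    by move=> A _ mA; rewrite -Radon_Nikodym_SigmaFinite.f_integral.
  by apply: filterS => x e _; rewrite e// muleC.
Qed.

End density.

Section bounded_cond_exp.
Context d (Omega : measurableType d) (R : realType) (P : probability Omega R).
Local Open Scope ereal_scope.

Lemma bounded_integrable (Z : Omega -> R) (M : R) : measurable_fun setT Z ->
  (forall w, `|Z w| <= M)%R -> P.-integrable setT (EFin \o Z).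
Proof.
move=> mZ bZ; apply: (le_integrable _ _ _ (finite_measure_integrable_cst P M measurableT)) => //.
- exact/measurable_EFinP.
- by move=> w _; rewrite lee_fin (le_trans (bZ w))// ler_norm.
Qed.

(** h(U) is E[Z | U] in factored form: h is the density of the image of Z P under U with respect to
    the law of U. *)
Lemma cond_exp_bounded (Z U : Omega -> R) (M : R) :
  measurable_fun setT Z -> measurable_fun setT U -> (forall w, 0 <= Z w <= M)%R ->
  exists h : R -> R, [/\ measurable_fun setT h, forall x, (0 <= h x <= M)%R &
    forall psi : R -> \bar R, measurable_fun setT psi -> (forall x, 0 <= psi x) ->
      \int[P]_w ((Z w)%:E * psi (U w)) = \int[P]_w ((h (U w))%:E * psi (U w))].
Proof.
move=> mZ mU bZ.
have iZ : P.-integrable setT (EFin \o Z).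
  by apply: (@bounded_integrable _ M) => // w; have /andP[h1 h2] := bZ w; rewrite ger0_norm.
have Z0 w : 0 <= (EFin \o Z) w by rewrite lee_fin; case/andP: (bZ w).
have [nu [nuE nuI]] := density_measure iZ Z0.
pose Up : {mfun Omega >-> R} := HB.pack U (isMeasurableFun.Build _ _ _ _ U mU).
pose law : probability R R := distribution P Up.
pose nuU1 : {measure set R -> \bar R} := pushforward nu Up.
pose nuU0 := nuU1 mU.
have fin : fin_num_fun nuU0.
  by move=> A mA; apply: fin_num_measure; rewrite -[X in measurable X]setTI; exact: (mU measurableT).
pose nuU : {finite_measure set R -> \bar R} :=
  HB.pack (Measure.sort nuU0) nuU0 (Measure_isFinite.Build _ _ _ nuU0 fin).
have mUA A : measurable A -> measurable (U @^-1` A).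
  by move=> mA; rewrite -[X in measurable X]setTI; exact: (mU measurableT).
have nuUle A : measurable A -> nuU A <= M%:E * law A.
  move=> mA; rewrite /nuU /= /pushforward nuE -[law A](_ : P (U @^-1` A) = _)//.
  rewrite -integral_cst; last exact: mUA.
  apply: ge0_le_integral => //; first exact: mUA.
  - by apply/measurable_EFinP; exact: measurable_funTS.
  - by move=> w _; rewrite lee_fin; case/andP: (bZ w).
have dom : nuU `<< law.
  apply/null_content_dominatesP => A mA lA0.
  by apply/eqP; rewrite eq_le measure_ge0 andbT (le_trans (nuUle A mA))// lA0 mule0.
pose f := Radon_Nikodym_SigmaFinite.f nuU law.
have f0 : forall x, 0 <= f x := Radon_Nikodym_SigmaFinite.f_ge0 dom.
have ff : forall x, f x \is a fin_num := Radon_Nikodym_SigmaFinite.f_fin_num dom.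
have iff : law.-integrable setT f := Radon_Nikodym_SigmaFinite.f_integrable dom.
have mf := measurable_int _ iff.
have M0 : (0 <= M)%R.
  by have /andP[h1 h2] := bZ point; exact: le_trans h1 h2.
have mB : measurable [set x | M%:E < f x].
  by rewrite -[X in measurable X]setTI; exact: emeasurable_fun_o_infty.
have fM : {ae law, forall x, f x <= M%:E}.
  set B := [set x | M%:E < f x] in mB.
  have iB : law.-integrable B f by exact: integrableS iff.
  have iM : law.-integrable B (EFin \o cst M) by exact: finite_measure_integrable_cst.
  have iME : \int[law]_(x in B) (EFin \o cst M) x = M%:E * law B by rewrite -integral_cst.
  (* On B the integrand f - M is positive, while [nuUle] makes its integral nonpositive; this forces
     B to be null. *)
  have e0 : \int[law]_(x in B) `|f x - M%:E| = 0.
    rewrite (eq_integral (fun x => f x - (EFin \o cst M) x)); last first.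
      by move=> x; rewrite inE => Bx; rewrite gee0_abs// sube_ge0//; exact: ltW.
    rewrite integralB// -(Radon_Nikodym_SigmaFinite.f_integral dom mB) iME.
    apply/eqP; rewrite eq_le; apply/andP; split.
      by rewrite sube_le0; exact: nuUle.
    rewrite sube_ge0; last by rewrite fin_numM// fin_num_measure.
    rewrite (Radon_Nikodym_SigmaFinite.f_integral dom mB) -iME.
    apply: ge0_le_integral => //.
    - exact: measurable_int iM.
    - exact: measurable_int iB.
    - by move=> x Bx; apply/ltW/Bx.
  have mfM : measurable_fun B (fun x => f x - M%:E).
    by apply: emeasurable_funB => //; exact: measurable_funTS.
  have := (ae_eq_integral_abs law mB mfM).1 e0.
  apply: filterS => x hx; rewrite leNgt; apply/negP => Bx.
  have /eqP := hx Bx; rewrite sube_eq ?fin_num_adde_defl// add0e => /eqP fxM.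
  by move: Bx; rewrite fxM ltxx.
(* Truncation makes the bounds hold at every point and, by [fM], changes the density only on a null
   set. *)
exists (fun x => Num.min (fine (f x)) M); split.
- by apply: measurable_minr => //; exact: measurableT_comp.
- by move=> x; rewrite le_min M0 fine_ge0//= ge_min lexx orbT.
move=> psi mpsi psi0.
have mpsiU : measurable_fun setT (fun w => psi (U w)) by exact: measurableT_comp.
rewrite -(nuI _ mpsiU)//.
transitivity (\int[nuU]_x psi x).
  by rewrite [RHS]ge0_integral_pushforward.
rewrite -(Radon_Nikodym_SigmaFinite.change_of_variables dom psi0 measurableT mpsi).
transitivity (\int[law]_x ((Num.min (fine (f x)) M)%:E * psi x)).
  apply: ae_eq_integral => //.
  - exact: emeasurable_funM.
  - apply: emeasurable_funM => //; apply/measurable_EFinP.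
    by apply: measurable_minr => //; exact: measurableT_comp.
  - apply: filterS fM => x fxM _; rewrite muleC; congr (_ * _).
    rewrite -/f -{1}(fineK (ff x)) min_l//.
    by rewrite -lee_fin fineK.
rewrite ge0_integral_distribution//.
- apply: emeasurable_funM => //; apply/measurable_EFinP.
  by apply: measurable_minr => //; exact: measurableT_comp.
- by move=> x; rewrite mule_ge0// lee_fin le_min M0 fine_ge0.
Qed.


End bounded_cond_exp.

(** * Euler scheme and Markov property *)

Section window.
Context d (Omega : measurableType d) (R : realType) (P : probability Omega R).
Local Notation mu := (@lebesgue_measure R).
Local Notation TO := (measurableTypeR R * Omega)%type.
Local Notation Q := (mu \x P)%E.
Variables (a b : R) (Z : R -> Omega -> R) (V : R).
Hypotheses (a0 : 0 <= a) (ab : a <= b).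
Hypothesis mZ : measurable_fun ((`[0, b] : set R) `*` setT) (fun z : R * Omega => Z z.1 z.2).
Hypothesis sZ : forall u, a < u <= b -> sqint P (Z u) /\ ip P (Z u) (Z u) <= V.

Definition window : TO -> R := lift b (fun u w => \1_(`]a, b]) u * Z u w).

Lemma windowE z : window z = if a < z.1 <= b then Z z.1 z.2 else 0.
Proof.
rewrite /window /lift indicE mem_setE in_itv/=; case: (ltP a z.1) => az/=; last first.
  by rewrite mul0r if_same.
by rewrite (le_trans a0 (ltW az))/=; case: (z.1 <= b); rewrite ?mul1r ?mul0r.
Qed.

Lemma measurable_window : measurable_fun setT window.
Proof.
apply: measurable_lift; apply: measurable_funM => //; apply: measurable_funTS.
apply: (measurableT_comp (_ : measurable_fun setT (fun s : R => \1_(`]a, b]) s : R))) => //.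
exact: measurable_indic.
Qed.

Lemma lebesgue_oc : mu (`]a, b]%classic : set R) = (b - a)%:E.
Proof.
rewrite lebesgue_measure_itv/= lte_fin; move: ab; rewrite le_eqVlt => /predU1P[<-|->//].
by rewrite ltxx subrr.
Qed.

Lemma window_sqint : sqint Q window /\ ip Q window window <= (b - a) * V.
Proof.
have le : (\int[Q]_z (window z ^+ 2)%:E <= ((b - a) * V)%:E)%E.
  rewrite fubini_tonelli1//; last 2 first.
  - by apply/measurable_EFinP; apply: measurable_funX; exact: measurable_window.
  - by move=> z; rewrite lee_fin sqr_ge0.
  rewrite mulrC EFinM -lebesgue_oc -integral_cst// [leRHS]integral_mkcond.
  apply: ge0_le_integral => //.
  - by move=> u _; apply: integral_ge0 => w _; rewrite lee_fin sqr_ge0.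
  - apply: (measurable_fun_fubini_tonelli_F (fun z => (window z ^+ 2)%:E)) => //.
      by apply/measurable_EFinP; apply: measurable_funX; exact: measurable_window.
    by move=> z; rewrite lee_fin sqr_ge0.
  - by apply/(measurable_restrictT _ _).1.
  - move=> u _; rewrite patchE mem_setE in_itv/= /fubini_F.
    under eq_integral do rewrite windowE/=.
    case: ifPn => abu; last by rewrite integral0_eq// => w _; rewrite expr0n.
    have [su hu] := sZ abu.
    by rewrite ip_EFin// lee_fin.
have s : sqint Q window.
  by apply: sqintP; [exact: measurable_window|rewrite (le_lt_trans le)// ltry].
by split => //; move: le; rewrite ip_EFin// lee_fin.
Qed.

Hypothesis pZ : forall w, sqint mu (fun u => window (u, w)).

Let one_sqint : sqint mu (\1_(`]a, b]) : R -> R) /\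
  ip mu (\1_(`]a, b]) : R -> R) (\1_(`]a, b]) : R -> R) = b - a.
Proof.
have E : (\int[mu]_u ((\1_(`]a, b]%classic) u : R) ^+ 2)%:E = (b - a)%:E)%E.
  rewrite -lebesgue_oc -[X in mu X]setIT -integral_indic//.
  by apply: eq_integral => u _; rewrite indicE; case: (_ \in _); rewrite ?expr1n ?expr0n.
have s : sqint mu (\1_(`]a, b]) : R -> R).
  by apply: sqintP; [exact: measurable_indic|rewrite E ltry].
by split => //; apply: EFin_inj; rewrite -ip_EFin.
Qed.

(** Cauchy-Schwarz in time, path by path, gives a second factor b - a; a drift contributes at order
    (b - a)^2 where a stochastic integral contributes at order b - a. *)
Lemma window_drift : let B w := \int[mu]_u window (u, w) in
  sqint P B /\ ip P B B <= (b - a) ^+ 2 * V.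
Proof.
move=> B; have [sQ leQ] := window_sqint; have [s1 e1] := one_sqint.
have BE w : B w = ip mu (\1_(`]a, b]) : R -> R) (fun u => window (u, w)).
  apply: eq_Rintegral => u _; rewrite windowE/= indicE mem_setE in_itv/=.
  by case: ifP; rewrite ?mul1r ?mulr0.
have mB : measurable_fun setT B.
  have iw : Q.-integrable setT (EFin \o window).
    have [sone _] := @time_product_ip _ _ _ P (`]a, b]%classic : set R) (`]a, b]%classic : set R)
      (cst 1) (cst 1) (measurable_itv _) (measurable_itv _)
      (lebesgue_oc_lty a b) (lebesgue_oc_lty a b) (sqint_cst P 1) (sqint_cst P 1).
    have := sqintM_integrable sone sQ.
    congr (_.-integrable _ _); apply/funext => z /=; congr EFin.
    rewrite windowE/= indicE mem_setE in_itv/= mul1r.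
    by case: ifP; rewrite ?mul1r ?mulr0.
  have := measurable_fubini_G iw => mI.
  by apply: (measurableT_comp _ mI).
have le : (\int[P]_w (B w ^+ 2)%:E <= ((b - a) ^+ 2 * V)%:E)%E.
  have mw2 : measurable_fun setT (fun z : TO => (window z ^+ 2)%:E).
    by apply/measurable_EFinP; apply: measurable_funX; exact: measurable_window.
  have w20 z : (0 <= (window z ^+ 2)%:E)%E by rewrite lee_fin sqr_ge0.
  apply: (@le_trans _ _ ((b - a)%:E * \int[Q]_z (window z ^+ 2)%:E)%E); last first.
    by rewrite ip_EFin// -EFinM lee_fin expr2 -mulrA ler_wpM2l// subr_ge0.
  rewrite fubini_tonelli2// -ge0_integralZl//; last 3 first.
  - exact: measurable_fun_fubini_tonelli_G.
  - by move=> w _; apply: integral_ge0.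
  - by rewrite lee_fin subr_ge0.
  apply: ge0_le_integral => //.
  - by move=> w _; rewrite lee_fin sqr_ge0.
  - by apply/measurable_EFinP; exact: measurable_funX.
  - apply: emeasurable_funM => //; exact: measurable_fun_fubini_tonelli_G.
  - move=> w _; rewrite /fubini_G ip_EFin// -EFinM lee_fin -e1 BE.
    exact: ip_CS.
have s : sqint P B by apply: sqintP => //; rewrite (le_lt_trans le)// ltry.
by split => //; move: le; rewrite ip_EFin// lee_fin.
Qed.

End window.

Section lipschitz_L2.
Context d (T : measurableType d) (R : realType) (P : probability T R).
Variables (L : R) (g : R -> R).
Hypotheses (L0 : 0 <= L) (hg : L.-lipschitz g).

Let lip2 x y : (g x - g y) ^+ 2 <= L ^+ 2 * (x - y) ^+ 2.
Proof.
rewrite -exprMn -[leLHS]real_normK ?num_real// -[leRHS]real_normK ?num_real//.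
by rewrite ler_sqr ?nnegrE// normrM (ger0_norm L0); exact: lipschitzP.
Qed.

Lemma lipschitz_sqintB (f h : T -> R) : measurable_fun setT f -> measurable_fun setT h ->
  sqint P (fun x => f x - h x) ->
  sqint P (fun x => g (f x) - g (h x)) /\
  ip P (fun x => g (f x) - g (h x)) (fun x => g (f x) - g (h x)) <=
    L ^+ 2 * ip P (fun x => f x - h x) (fun x => f x - h x).
Proof.
move=> mf mh sfh; have mg := lipschitz_measurable hg.
have iL : P.-integrable setT (EFin \o fun x => L ^+ 2 * (f x - h x) ^+ 2).
  rewrite (_ : _ \o _ = (fun x => (L ^+ 2)%:E * ((f x - h x) ^+ 2)%:E)%E)//.
  by apply: integrableZl => //; exact: sfh.2.
have s : sqint P (fun x => g (f x) - g (h x)).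
  apply: (sqint_le _ iL); last by move=> x; exact: lip2.
  by apply: measurable_funB; exact: measurableT_comp.
split => //; rewrite !ip_sqr -RintegralZl//; last exact: sfh.2.
by apply: le_Rintegral => //; exact: s.2.
Qed.

Lemma lipschitz_sqint (f : T -> R) : sqint P f ->
  sqint P (fun x => g (f x)) /\
  ip P (fun x => g (f x)) (fun x => g (f x)) <= 2 * g 0 ^+ 2 + 2 * L ^+ 2 * ip P f f.
Proof.
move=> sf; have s0 : sqint P (fun x => f x - 0) by apply: sqintB => //; exact: sqint0.
have [sd le] := lipschitz_sqintB (h := fun=> 0) sf.1 (measurable_cst _) s0.
have sg : sqint P (fun x => g (f x)).
  have := sqintD sd (sqint_cst P (g 0)); congr sqint; apply/funext => x; ring.
split => //.
have e0 : ip P (fun x => f x - 0) (fun x => f x - 0) = ip P f f.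
  by congr ip; apply/funext => x; rewrite subr0.
rewrite e0 in le.
have : 0 <= ip P (fun x => g (f x) - g 0 - g 0) (fun x => g (f x) - g 0 - g 0) by exact: ip_ge0.
rewrite ipB_sqr//; last exact: sqint_cst.
have ec : ip P (fun=> g 0) (fun=> g 0) = g 0 ^+ 2.
  by rewrite /ip Rintegral_cst//= probability_setT mulr1 expr2.
rewrite ec => h0.
have -> : ip P (fun x => g (f x)) (fun x => g (f x)) =
   ip P (fun x => (g (f x) - g 0) + g 0) (fun x => (g (f x) - g 0) + g 0).
  by congr ip; apply/funext => x; ring.
rewrite ipD_sqr//; last exact: sqint_cst.
rewrite ec; lra.
Qed.

End lipschitz_L2.

(** Young's inequality with a free weight h. Taking h equal to the time step keeps the growth factor
    of the error at 1 + O(h). *)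
Lemma ipD_le d (T : measurableType d) (R : realType) (m : {measure set T -> \bar R})
    (f g : T -> R) (h : R) : 0 < h -> sqint m f -> sqint m g ->
  ip m (fun x => f x + g x) (fun x => f x + g x) <=
  (1 + h) * ip m f f + (1 + h^-1) * ip m g g.
Proof.
move=> h0 sf sg.
have : 0 <= ip m (fun x => h * f x - g x) (fun x => h * f x - g x) by exact: ip_ge0.
have sh := sqintZ h sf.
rewrite ipB_sqr// ipZl// ipZr// ipZl// ipD_sqr// => le.
have {}le : 2 * ip m f g <= h * ip m f f + h^-1 * ip m g g.
  rewrite -(ler_pM2l h0) mulrDr mulVKf ?gt_eqF//.
  by move: le; lra.
lra.
Qed.

(** The norm of a combination depends only on the Gram matrix, so the pairwise isometries of
    [ito_ip] extend to differences of Ito integrals with different horizons. *)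
Lemma ip_isometry3 d d' (T : measurableType d) (T' : measurableType d') (R : realType)
    (m : {measure set T -> \bar R}) (m' : {measure set T' -> \bar R})
    (f1 f2 f3 : T -> R) (g1 g2 g3 : T' -> R) :
  sqint m f1 -> sqint m f2 -> sqint m f3 -> sqint m' g1 -> sqint m' g2 -> sqint m' g3 ->
  ip m f1 f1 = ip m' g1 g1 -> ip m f2 f2 = ip m' g2 g2 -> ip m f3 f3 = ip m' g3 g3 ->
  ip m f1 f2 = ip m' g1 g2 -> ip m f1 f3 = ip m' g1 g3 -> ip m f2 f3 = ip m' g2 g3 ->
  ip m (fun x => f1 x - f2 x - f3 x) (fun x => f1 x - f2 x - f3 x) =
  ip m' (fun x => g1 x - g2 x - g3 x) (fun x => g1 x - g2 x - g3 x).
Proof.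
move=> s1 s2 s3 t1 t2 t3 e11 e22 e33 e12 e13 e23.
have s12 := sqintB s1 s2; have t12 := sqintB t1 t2.
by rewrite !ipB_sqr// !ipBl// e11 e22 e33 e12 e13 e23.
Qed.

Section sde.
Context (R : realType) (d : measure_display) (Omega : measurableType d)
  (P : probability Omega R).
Local Notation mu := (@lebesgue_measure R).
Local Notation TO := (measurableTypeR R * Omega)%type.
Local Notation Q := (mu \x P)%E.
Variables (F : R -> set (set Omega)) (W : R -> Omega -> R).
Hypotheses (hF : usual_filtration P F) (hW : brownian_motion P F W).

Variables (beta vs : R -> R) (L C : R) (X : R -> Omega -> R).
Hypotheses (L0 : 0 <= L) (hb : L.-lipschitz beta) (hs : L.-lipschitz vs).
Hypothesis hX : sde_solution P F W beta vs X.
Hypothesis sX : forall t, 0 <= t -> sqint P (X t) /\ ip P (X t) (X t) <= C.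

Let mb := lipschitz_measurable hb.
Let ms := lipschitz_measurable hs.

Let pX t : 0 <= t -> preim_in (F t) (X t).
Proof. by move=> t0; case: hX => /(_ t t0) + _ _; rewrite measurable_wrtP. Qed.

Let mX t : 0 <= t -> measurable_fun setT (X t).
Proof. by move=> t0; exact: (preim_in_meas hF t0 (pX t0)). Qed.

Let cX : continuous_paths X. Proof. by case: hX. Qed.

Let jX t : measurable_fun ((`[0, t] : set R) `*` setT) (fun z : R * Omega => X z.1 z.2).
Proof. exact: measurable_joint_itv mX cX t. Qed.

(** N is the stochastic integral of vs(X_u) - eta over ]a, b]; its norm is read off on the
    integrands, and its orthogonality to F_a is the martingale property. *)
Lemma noise_window a b Ia Ib (eta : Omega -> R) V : 0 <= a -> a <= b ->
  ito_integral P F W (fun s w => vs (X s w)) a Ia ->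
  ito_integral P F W (fun s w => vs (X s w)) b Ib ->
  preim_in (F a) eta -> sqint P eta ->
  (forall u, a < u <= b -> ip P (fun w => vs (X u w) - eta w) (fun w => vs (X u w) - eta w) <= V) ->
  let N w := Ib w - Ia w - eta w * (W b w - W a w) in
  [/\ sqint P N, ip P N N <= (b - a) * V &
    forall xi, preim_in (F a) xi -> sqint P xi -> ip P xi N = 0].
Proof.
move=> a0 ab hIa hIb pe se hV N; have b0 := le_trans a0 ab.
have hE := ito_incr hF hW a0 ab (lexx b) pe se.
have [sb sa lb la eba] := ito_ip hF hW b0 a0 hIb hIa.
have [_ sE _ lE ebE] := ito_ip hF hW b0 b0 hIb hE.
have [_ _ _ _ ebb] := ito_ip hF hW b0 b0 hIb hIb.
have [_ _ _ _ eaa] := ito_ip hF hW a0 a0 hIa hIa.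
have [_ _ _ _ eEE] := ito_ip hF hW b0 b0 hE hE.
have [_ _ _ _ eaE] := ito_ip hF hW a0 b0 hIa hE.
have sN : sqint P N by apply: sqintB => //; exact: sqintB.
split => //; last first.
  move=> xi px sxi; rewrite ipBr//; last exact: sqintB.
  rewrite ipBr// (ito_mart hF hW a0 ab px sxi hIa hIb) subrr sub0r.
  have hE0 : ito_integral P F W (fun s w => eta w * \1_(`]a, b]) s) a (fun=> 0).
    apply: ito_integral_vanish hE => // w; apply: integral0_eq => s.
    rewrite /= in_itv/= => /andP[_ sa'].
    by rewrite indicE mem_setE in_itv/= ltNge sa' mulr0 expr0n.
  by rewrite (ito_mart hF hW a0 ab px sxi hE0 hE) ipC ip0l oppr0.
rewrite (ip_isometry3 sb sa sE lb la lE ebb eaa eEE eba ebE eaE).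
pose Z u w := vs (X u w) - eta w.
have mZ : measurable_fun ((`[0, b] : set R) `*` setT) (fun z : R * Omega => Z z.1 z.2).
  apply: measurable_funB; first exact: (measurableT_comp ms (@jX b)).
  by apply: measurable_funTS; apply: (measurableT_comp se.1).
have sZ u : a < u <= b -> sqint P (Z u) /\ ip P (Z u) (Z u) <= V.
  move=> au; split; last exact: hV.
  have u0 : 0 <= u by case/andP: au => /ltW/(le_trans a0).
  by apply: sqintB => //; exact: (lipschitz_sqint L0 hs (sX u0).1).1.
have [_ le] := window_sqint a0 ab mZ sZ.
rewrite (_ : (fun _ => _ - _ - _) = window a b Z)//.
apply/funext => z; rewrite (windowE _ _ a0) lift_oc// /lift indicE mem_setE in_itv/=.
case: (ltP a z.1) => az/=; last first.
  by rewrite (le_trans az ab) andbT subrr mulr0 subr0.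
rewrite (le_trans a0 (ltW az))/= subr0.
by case: (z.1 <= b); rewrite ?mulr1 ?mulr0 ?subr0.
Qed.

Lemma path_integrable (g : R -> R) t w : measurable_fun setT g -> L.-lipschitz g -> 0 <= t ->
  mu.-integrable `[0, t] (fun u => (g (X u w))%:E) /\
  exists M, forall u, 0 <= u <= t -> `|g (X u w)| <= M.
Proof.
move=> mg hg t0; have [M hM] := path_bounded t (@cX w).
have bg u : 0 <= u <= t -> `|g (X u w)| <= `|g 0| + L * M.
  move=> ut; have := lipschitzP hg (X u w) 0; rewrite subr0 => h.
  have := ler_wpM2l L0 (hM u ut) => h2.
  rewrite -[g (X u w)](subrK (g 0)) (le_trans (ler_normD _ _))// addrC lerD2l.
  exact: le_trans h h2.
split; last by exists (`|g 0| + L * M).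
have oo : (mu (`[0%R, t]%classic : set R) < +oo)%E.
  by rewrite lebesgue_measure_itv/=; case: ifP => // _; rewrite -EFinD ltry.
apply: (measurable_bounded_integrable _ oo) => //.
  by apply: (measurableT_comp mg); exact: (measurable_section w (@jX t)).
exists (`|g 0| + L * M); split; first exact: num_real.
by move=> x Mx u /=; rewrite in_itv/= => ut; rewrite (le_trans (bg u ut))// ltW.
Qed.

Lemma drift_window a b (xi : Omega -> R) V : 0 <= a -> a <= b -> sqint P xi ->
  (forall u, a < u <= b -> ip P (fun w => beta (X u w) - xi w) (fun w => beta (X u w) - xi w) <= V) ->
  let B w := \int[mu]_(u in `[0, b]) beta (X u w) - \int[mu]_(u in `[0, a]) beta (X u w)
    - xi w * (b - a) in
  sqint P B /\ ip P B B <= (b - a) ^+ 2 * V.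
Proof.
move=> a0 ab sxi hV B; have b0 := le_trans a0 ab.
pose Z u w := beta (X u w) - xi w.
have mZ : measurable_fun ((`[0, b] : set R) `*` setT) (fun z : R * Omega => Z z.1 z.2).
  apply: measurable_funB; first exact: (measurableT_comp mb (@jX b)).
  by apply: measurable_funTS; apply: (measurableT_comp sxi.1).
have sZ u : a < u <= b -> sqint P (Z u) /\ ip P (Z u) (Z u) <= V.
  move=> au; split; last exact: hV.
  have u0 : 0 <= u by case/andP: au => /ltW/(le_trans a0).
  by apply: sqintB => //; exact: (lipschitz_sqint L0 hb (sX u0).1).1.
have loc := lebesgue_oc ab.
have e1E : (\int[mu]_u ((\1_(`]a, b]%classic) u : R))%:E = (b - a)%:E)%E.
  by rewrite -loc -[X in mu X]setIT -integral_indic.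
have ioc : mu.-integrable setT (EFin \o (\1_(`]a, b]) : R -> R)).
  apply/integrableP; split; first by apply/measurable_EFinP; exact: measurable_indic.
  under eq_integral do rewrite /= ger0_norm//.
  by rewrite e1E ltry.
have pZ w : sqint mu (fun u => window a b Z (u, w)).
  have [_ [M hM]] := path_integrable w mb hb b0.
  have mw : measurable_fun setT (fun u : measurableTypeR R => window a b Z (u, w)).
    have mwZ : measurable_fun setT (window a b Z : TO -> R) by exact: measurable_window mZ.
    exact: (measurableT_comp mwZ (@measurable_pair2 _ _ _ _ w)).
  have iM : mu.-integrable setT (EFin \o fun u => (M + `|xi w|) ^+ 2 * (\1_(`]a, b]) : R -> R) u).
    rewrite (_ : _ \o _ = (fun u => ((M + `|xi w|) ^+ 2)%:E * (EFin \o (\1_(`]a, b]) : R -> R)) u)%E)//.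
    exact: integrableZl.
  apply: (sqint_le mw iM) => u; rewrite (windowE _ _ a0)/= indicE mem_setE in_itv/=.
  case: ifPn => aub; last by rewrite expr0n mulr0.
  have u0 : 0 <= u <= b by case/andP: aub => /ltW/(le_trans a0) -> ->.
  rewrite mulr1 -[leLHS]real_normK ?num_real// ler_sqr ?nnegrE//.
    by rewrite /Z (le_trans (ler_normB _ _))// lerD2r hM.
  by rewrite addr_ge0// (le_trans _ (hM u u0)).
have [sB leB] := window_drift a0 ab mZ sZ pZ.
suff -> : B = (fun w => \int[mu]_u window a b Z (u, w)) by split.
rewrite /B.
apply/funext => w /=.
have [ib _] := path_integrable w mb hb b0.
have [ia _] := path_integrable w mb hb a0.
have e1 : \int[mu]_u (\1_(`]a, b]) : R -> R) u = b - a.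
  by rewrite /Rintegral e1E.
rewrite -e1 -RintegralZl// [X in X - _ - _]Rintegral_mkcond [X in _ - X - _]Rintegral_mkcond.
have ip c : mu.-integrable `[0, c] (fun u => (beta (X u w))%:E) ->
    mu.-integrable setT (EFin \o ((fun u => beta (X u w)) \_ `[0, c])).
  move=> ic; rewrite (_ : _ \o _ = (fun u => (beta (X u w))%:E) \_ `[0, c]).
    by rewrite -integrable_mkcond.
  by apply/funext => u; rewrite /= !patchE; case: ifP.
have ib' := ip b ib; have ia' := ip a ia.
have ix : mu.-integrable setT (EFin \o (fun u => xi w * (\1_(`]a, b]) : R -> R) u)).
  rewrite (_ : _ \o _ = (fun u => (xi w)%:E * (EFin \o (\1_(`]a, b]) : R -> R)) u)%E)//.
  exact: integrableZl.
rewrite -RintegralB// -RintegralB//; last first.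
  have iba : mu.-integrable setT ((EFin \o ((fun u => beta (X u w)) \_ `[0%R, b])) \-
     (EFin \o ((fun u => beta (X u w)) \_ `[0%R, a])))%E by exact: integrableB.
  exact: iba.
apply: eq_Rintegral => u _.
rewrite (windowE _ _ a0)/= !patchE !mem_setE !in_itv/= indicE mem_setE in_itv/= /Z.
case: (ltP a u) => au/=; last first.
  by rewrite (le_trans au ab) andbT; case: ifP; rewrite subrr mulr0 subr0.
by rewrite (le_trans a0 (ltW au))/= subr0; case: (u <= b); rewrite ?mulr1 ?mulr0 ?subr0.
Qed.

Lemma sde_noise t : 0 <= t -> exists I, ito_integral P F W (fun s w => vs (X s w)) t I /\
  {ae P, forall w, X t w = X 0 w + \int[mu]_(s in `[0, t]) beta (X s w) + I w}.
Proof. by move=> t0; case: hX => _ _ /(_ t t0). Qed.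

(** The brackets bound E[beta(X_u)^2] and E[vs(X_u)^2]. The factor 4 is two for the noise and two
    for the drift, Young's weight being 1 and b - a at most 1. *)
Definition sde_modulus := 4 * ((2 * beta 0 ^+ 2 + 2 * L ^+ 2 * C) + (2 * vs 0 ^+ 2 + 2 * L ^+ 2 * C)).

(* The error at time b of one Euler step that replaces X_a by Y and freezes the
   coefficients at xi and eta. *)
Definition sde_defect a b (Y xi eta : Omega -> R) (w : Omega) :=
  X b w - (Y w + xi w * (b - a) + eta w * (W b w - W a w)).

(** The defect is the sum of X_a - Y, a noise part and a drift part. The first is F_a-measurable,
    hence orthogonal to the noise, and their squares add without loss; only the drift part costs the
    weighted inequality [ipD_le]. *)
Lemma sde_defect_le a b (Y : Omega -> R) (xi eta : Omega -> R) V h : 0 <= a -> a < b ->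
  preim_in (F a) Y -> sqint P Y -> sqint P xi -> preim_in (F a) eta -> sqint P eta ->
  (forall u, a < u <= b -> ip P (fun w => beta (X u w) - xi w) (fun w => beta (X u w) - xi w) <= V) ->
  (forall u, a < u <= b -> ip P (fun w => vs (X u w) - eta w) (fun w => vs (X u w) - eta w) <= V) ->
  0 < h ->
  ip P (sde_defect a b Y xi eta) (sde_defect a b Y xi eta) <= (1 + h) * (ip P (fun w => X a w - Y w) (fun w => X a w - Y w) + (b - a) * V)
    + (1 + h^-1) * ((b - a) ^+ 2 * V).
Proof.
move=> a0 ltab pY sY sxi pe se hVb hVs h0; set E := sde_defect a b Y xi eta; have ab := ltW ltab; have b0 := le_trans a0 ab.
have [Ia [hIa eIa]] := sde_noise a0; have [Ib [hIb eIb]] := sde_noise b0.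
have [sN leN N0] := noise_window a0 ab hIa hIb pe se hVs.
have [sB leB] := drift_window a0 ab sxi hVb.
have sXa := (sX a0).1; have sXb := (sX b0).1.
have sD := sqintB sXa sY.
have sDN := sqintD sD sN; have sDNB := sqintD sDN sB.
have sE : sqint P E.
  apply: sqintB => //; apply: sqintD; last by have [] := incr_ipM hF hW a0 ab pe pe se se.
  apply: sqintD => //; rewrite (_ : (fun w => _) = (fun w => (b - a) * xi w)); first exact: sqintZ.
  by apply/funext => w; rewrite mulrC.
have EE : {ae P, forall w, E w = X a w - Y w + (Ib w - Ia w - eta w * (W b w - W a w)) +
    (\int[mu]_(u in `[0, b]) beta (X u w) - \int[mu]_(u in `[0, a]) beta (X u w) - xi w * (b - a))}.
  by move: eIa eIb; apply: filterS2 => w ea eb; rewrite /E /sde_defect eb ea; ring.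
rewrite (ip_ae_eq sE.1 sDNB.1 sE.1 EE) ipC (ip_ae_eq sE.1 sDNB.1 sDNB.1 EE).
apply: (le_trans (ipD_le h0 sDN sB)).
rewrite lerD//; last by rewrite ler_wpM2l// addr_ge0// invr_ge0 ltW.
rewrite ler_wpM2l//; first by rewrite addr_ge0// ltW.
rewrite ipD_sqr// N0//.
  by rewrite mulr0 addr0 lerD2l.
apply: preim_inB => //; [exact: (filtration_sigma hF a0)|exact: pX].
Qed.

Lemma sde_modulusP a b : 0 <= a -> a < b -> b - a <= 1 ->
  ip P (fun w => X b w - X a w) (fun w => X b w - X a w) <= sde_modulus * (b - a).
Proof.
move=> a0 ab ba1.
have C0 : 0 <= C by apply: le_trans (sX a0).2; exact: ip_ge0.
pose V := (2 * beta 0 ^+ 2 + 2 * L ^+ 2 * C) + (2 * vs 0 ^+ 2 + 2 * L ^+ 2 * C).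
have hV (g : R -> R) u : L.-lipschitz g -> 2 * g 0 ^+ 2 + 2 * L ^+ 2 * C <= V -> a < u <= b ->
    ip P (fun w => g (X u w) - 0) (fun w => g (X u w) - 0) <= V.
  move=> hg gV /andP[au _]; have u0 := le_trans a0 (ltW au).
  under eq_fun do rewrite subr0.
  apply: le_trans (lipschitz_sqint L0 hg (sX u0).1).2 _; apply: le_trans gV.
  by rewrite lerD2l ler_wpM2l ?mulr_ge0 ?sqr_ge0// (sX u0).2.
have nn x : 0 <= 2 * x ^+ 2 + 2 * L ^+ 2 * C.
  by have := sqr_ge0 x; have := mulr_ge0 (sqr_ge0 L) C0; lra.
have sF := filtration_sigma hF a0.
have vb : 2 * beta 0 ^+ 2 + 2 * L ^+ 2 * C <= V by rewrite lerDl.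
have vv : 2 * vs 0 ^+ 2 + 2 * L ^+ 2 * C <= V by rewrite lerDr.
have hb' u := hV beta u hb vb.
have hs' u := hV vs u hs vv.
(* With Y = X_a and both coefficients frozen at 0, the defect is the increment of X itself. *)
have := sde_defect_le a0 ab (pX a0) (sX a0).1 (sqint0 P) (preim_in_cst sF 0) (sqint0 P) hb' hs' ltr01.
rewrite (_ : sde_defect a b (X a) _ _ = fun w => X b w - X a w); last first.
  by apply/funext => w; rewrite /sde_defect !mul0r !addr0.
rewrite (_ : (fun w => X a w - X a w) = fun=> 0); last by apply/funext => w; rewrite subrr.
rewrite ip0l => /le_trans; apply.
have V0 : 0 <= V by rewrite addr_ge0// nn.
have h0 : 0 <= b - a by rewrite subr_ge0 ltW.
have ba0 : 0 <= 1 - (b - a) by rewrite subr_ge0.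
have hh := mulr_ge0 (mulr_ge0 h0 V0) ba0.
rewrite /sde_modulus -/V invr1; move: (b - a) hh => h hh.
by move: hh; lra.
Qed.

Definition euler a b (Y : Omega -> R) (w : Omega) :=
  Y w + beta (Y w) * (b - a) + vs (Y w) * (W b w - W a w).

Lemma euler_preim a b Y : 0 <= a -> a <= b -> preim_in (F a) Y -> preim_in (F b) (euler a b Y).
Proof.
move=> a0 ab pY; have b0 := le_trans a0 ab; have sF := filtration_sigma hF b0.
have pYb := preim_in_le hF a0 ab pY.
apply: preim_inD => //; first (apply: preim_inD => //; apply: preim_inM => //).
- exact: (preim_in_comp mb pYb).
- exact: preim_in_cst.
- by apply: preim_inM => //; [exact: (preim_in_comp ms pYb)|exact: (preim_in_incr hF hW a0 ab)].
Qed.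

Lemma euler_sqint a b Y : 0 <= a -> a <= b -> preim_in (F a) Y -> sqint P Y ->
  sqint P (euler a b Y).
Proof.
move=> a0 ab pY sY.
have [sb _] := lipschitz_sqint L0 hb sY; have [ss _] := lipschitz_sqint L0 hs sY.
have ps : preim_in (F a) (fun w => vs (Y w)) by exact: (preim_in_comp ms pY).
apply: sqintD; last by have [] := incr_ipM hF hW a0 ab ps ps ss ss.
apply: sqintD => //; rewrite (_ : (fun w => _) = (fun w => (b - a) * beta (Y w))); first exact: sqintZ.
by apply/funext => w; rewrite mulrC.
Qed.

(** Write h = b - a and e for the previous error. Freezing the coefficients at Y costs V = 2 L^2 (om
    + e); with weight h in [sde_defect_le] the bound is (1 + h) e + 2 (1 + h) h V, and h <= 1 gives
    the constants. *)
Lemma euler_error a b Y om : 0 <= a -> a < b -> b - a <= 1 ->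
  preim_in (F a) Y -> sqint P Y ->
  (forall u, a < u <= b -> ip P (fun w => X u w - X a w) (fun w => X u w - X a w) <= om) ->
  ip P (fun w => X b w - euler a b Y w) (fun w => X b w - euler a b Y w) <=
  (1 + (1 + 8 * L ^+ 2) * (b - a)) * ip P (fun w => X a w - Y w) (fun w => X a w - Y w)
    + 8 * L ^+ 2 * (b - a) * om.
Proof.
move=> a0 ltab ba1 pY sY hom; have ab := ltW ltab.
have [sb _] := lipschitz_sqint L0 hb sY; have [ss _] := lipschitz_sqint L0 hs sY.
have ps : preim_in (F a) (fun w => vs (Y w)) by exact: (preim_in_comp ms pY).
set e := ip P (fun w => X a w - Y w) _.
have e0 : 0 <= e by exact: ip_ge0.
have sXa := (sX a0).1.
have hV g u : L.-lipschitz g -> a < u <= b ->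
    ip P (fun w => g (X u w) - g (Y w)) (fun w => g (X u w) - g (Y w)) <= 2 * L ^+ 2 * (om + e).
  move=> hg aub; have u0 : 0 <= u by case/andP: aub => /ltW/(le_trans a0).
  have sXu := (sX u0).1; have sXY := sqintB sXu sY.
  apply: (le_trans (lipschitz_sqintB L0 hg sXu.1 sY.1 sXY).2).
  have -> : 2 * L ^+ 2 * (om + e) = L ^+ 2 * (2 * (om + e)) by ring.
  rewrite ler_wpM2l ?sqr_ge0//.
  rewrite (_ : (fun x => X u x - Y x) = (fun x => (X u x - X a x) + (X a x - Y x))); last first.
    by apply/funext => w; ring.
  have := ipD_le ltr01 (sqintB sXu sXa) (sqintB sXa sY).
  rewrite -/e invr1 => /le_trans; apply.
  by have := hom u aub; lra.
have h0 : 0 < b - a by rewrite subr_gt0.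
have := sde_defect_le a0 ltab pY sY sb ps ss (fun u => hV beta u hb) (fun u => hV vs u hs) h0.
rewrite (_ : sde_defect _ _ _ _ _ = (fun w => X b w - euler a b Y w))// -/e.
move=> /le_trans; apply.
have om0 : 0 <= om.
  by apply: (le_trans (ip_ge0 _ _) (hom b _)); rewrite ltab lexx.
have -> : (1 + (b - a)^-1) * ((b - a) ^+ 2 * (2 * L ^+ 2 * (om + e))) =
    (1 + (b - a)) * ((b - a) * (2 * L ^+ 2 * (om + e))).
  by field; exact: lt0r_neq0.
have q0 : 0 <= L ^+ 2 * (om + e) by rewrite mulr_ge0 ?sqr_ge0// addr_ge0.
have ba0 : 0 <= 1 - (b - a) by rewrite subr_ge0.
have := mulr_ge0 (mulr_ge0 (ltW h0) q0) ba0.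
by move: (b - a) => h; lra.
Qed.

End sde.

(** * Lipschitz test functions determine a law *)

Section ramp.
Context {R : realType}.
Implicit Types x y : R.

(** A piecewise linear approximation from above of the indicator of [x, +oo[, with slope m just
    below x. *)
Definition ramp (m : nat) x y : R := Num.max 0 (Num.min 1 (1 + m%:R * (y - x))).

Lemma ramp_itv m x y : 0 <= ramp m x y <= 1.
Proof. by rewrite /ramp le_max lexx/= ge_max ler01 ge_min lexx. Qed.

Lemma ramp_lipschitz m x : (m%:R).-lipschitz (ramp m x).
Proof.
move=> [y z] _ /=; rewrite /ramp.
have h : `|(1 + m%:R * (y - x)) - (1 + m%:R * (z - x))| <= m%:R * `|y - z|.
  rewrite (_ : _ - _ = m%:R * (y - z)); last by ring.
  by rewrite normrM ger0_norm.
apply: le_trans h; move: (1 + _) (1 + _) => b a.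
have key (u v : R) : u <= v -> `|Num.max 0 (Num.min 1 u) - Num.max 0 (Num.min 1 v)| <= `|u - v|.
  move=> uv; rewrite distrC [leRHS]distrC ger0_norm; last first.
    rewrite subr_ge0 ge_max !le_max lexx/=; apply/orP; right.
    by rewrite le_min !ge_min lexx/= uv orbT.
  rewrite ger0_norm ?subr_ge0//.
  case: (leP 1 u) => ?; case: (leP 1 v) => ?; rewrite ?(max_r ler01);
    case: (leP 0 u) => ?; case: (leP 0 v) => ?; lra.
have [ab|/ltW ba] := leP a b; first exact: key.
by rewrite (distrC a) (distrC (Num.max 0 (Num.min 1 a))); exact: key.
Qed.

Lemma measurable_ramp m x : measurable_fun setT (ramp m x).
Proof. exact: lipschitz_measurable (@ramp_lipschitz m x). Qed.

Lemma ramp_cvg x y : ramp m x y @[m --> \oo] --> (\1_(`[x, +oo[) y : R).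
Proof.
rewrite indicE mem_setE in_itv/= andbT; have [xy|yx] := leP x y.
  apply: cvg_near_cst; apply: nearW => m; rewrite /ramp min_l ?max_r//.
  by rewrite lerDl mulr_ge0// subr_ge0.
apply: cvg_near_cst; near=> m; rewrite /ramp max_l// ge_min; apply/orP; right.
rewrite -lerBrDl sub0r -opprB mulrN lerN2 -ler_pdivrMr ?subr_gt0// div1r.
by near: m; exact: nbhs_infty_ger.
Unshelve. all: by end_near. Qed.

End ramp.

Section lipschitz_determining.
Context d (Omega : measurableType d) (R : realType) (P : probability Omega R).
Variables (Z1 Z2 U : Omega -> R) (M : R).
Hypotheses (mZ1 : measurable_fun setT Z1) (mZ2 : measurable_fun setT Z2).
Hypotheses (bZ1 : forall w, 0 <= Z1 w <= M) (bZ2 : forall w, 0 <= Z2 w <= M).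
Hypothesis mU : measurable_fun setT U.
Local Open Scope ereal_scope.

Lemma ramp_integral_cvg (Z : Omega -> R) x : measurable_fun setT Z ->
  (forall w, 0 <= Z w <= M)%R ->
  \int[P]_w ((Z w)%:E * (ramp m x (U w))%:E) @[m --> \oo] -->
  \int[P]_(w in U @^-1` `[x, +oo[) (Z w)%:E.
Proof.
move=> mZ bZ; rewrite [X in _ --> X]integral_mkcond.
apply: (@dominated_cvg _ _ _ _ _ _ _ _ (EFin \o Z)) => //.
- move=> m; apply: emeasurable_funM; first exact/measurable_EFinP.
  by apply/measurable_EFinP; apply: measurableT_comp => //; exact: measurable_ramp.
- move=> w _.
  have -> : ((fun w => (Z w)%:E) \_ (U @^-1` `[x, +oo[)) w = (Z w * \1_(`[x, +oo[%classic) (U w))%:E.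
    rewrite patchE indicE -[w \in U @^-1` _]/(U w \in `[x, +oo[%classic).
    by case: (U w \in _); rewrite ?mulr1 ?mulr0.
  apply: cvg_EFin; first exact: nearW.
  by apply: cvgM; [exact: cvg_cst|exact: ramp_cvg].
- apply: (@bounded_integrable _ _ _ _ _ M) => // w.
  by have /andP[h1 h2] := bZ w; rewrite ger0_norm.
- move=> m w _; have /andP[h1 h2] := bZ w; have /andP[r0 r1] := ramp_itv m x (U w).
  by rewrite -EFinM lee_fin ger0_norm ?mulr_ge0// ler_piMr.
Qed.

(** The images under U of the measures Z1 P and Z2 P agree on every half-line [x, +oo[, by taking
    limits of ramps; half-lines are stable under intersection and generate the Borel sets. *)
Lemma lipschitz_determining :
  (forall (phi : R -> R) (l : R), l.-lipschitz phi -> (0 <= l)%R -> (forall x, 0 <= phi x <= 1)%R ->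
     \int[P]_w ((Z1 w)%:E * (phi (U w))%:E) = \int[P]_w ((Z2 w)%:E * (phi (U w))%:E)) ->
  forall psi : R -> \bar R, measurable_fun setT psi -> (forall x, 0 <= psi x) ->
     \int[P]_w ((Z1 w)%:E * psi (U w)) = \int[P]_w ((Z2 w)%:E * psi (U w)).
Proof.
move=> hphi psi mpsi psi0.
have iZ (Z : Omega -> R) : measurable_fun setT Z -> (forall w, 0 <= Z w <= M)%R ->
    P.-integrable setT (EFin \o Z).
  move=> mZ bZ; apply: (@bounded_integrable _ _ _ _ _ M) => // w.
  by have /andP[h1 h2] := bZ w; rewrite ger0_norm.
have Z10 w : 0 <= (EFin \o Z1) w by rewrite lee_fin; case/andP: (bZ1 w).
have Z20 w : 0 <= (EFin \o Z2) w by rewrite lee_fin; case/andP: (bZ2 w).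
have [nu1 [E1 I1]] := density_measure (iZ _ mZ1 bZ1) Z10.
have [nu2 [E2 I2]] := density_measure (iZ _ mZ2 bZ2) Z20.
pose Up : {mfun Omega >-> R} := HB.pack U (isMeasurableFun.Build _ _ _ _ U mU).
pose push (nu : {finite_measure set Omega -> \bar R}) : {measure set R -> \bar R} := pushforward nu Up.
have mpsiU : measurable_fun setT (fun w => psi (U w)) by exact: measurableT_comp.
have rew (nu : {finite_measure set Omega -> \bar R}) :
    \int[nu]_w psi (U w) = \int[push mU nu]_x psi x.
  by rewrite [RHS]ge0_integral_pushforward.
rewrite -(I1 _ mpsiU)// -(I2 _ mpsiU)// !rew.
apply: eq_measure_integral => A mA _.
apply: (measure_unique (@RGenCInfty.G R) (fun n => `[- n%:R, +oo[%classic)%R) => //.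
- exact: RGenCInfty.measurableE.
- move=> _ _ [x ->] [y ->]; exists (Num.max x y).
  apply/seteqP; split => z /=; rewrite !in_itv/= !andbT ge_max; first by move=> [-> ->].
  by move=> /andP.
- by move=> n; exists (- n%:R)%R.
- apply/seteqP; split => // x _; exists (Num.bound `|x|%R) => //=; rewrite in_itv/= andbT.
  have /ltW h := archi_boundP (normr_ge0 x).
  by rewrite lerNl (le_trans _ h)// -normrN ler_norm.
- move=> _ [x ->]; rewrite /push /= /pushforward E1 E2.
  have c1 := ramp_integral_cvg (x := x) mZ1 bZ1; have c2 := ramp_integral_cvg (x := x) mZ2 bZ2.
  suff e : (fun m => \int[P]_w ((Z1 w)%:E * (ramp m x (U w))%:E)) =
      (fun m => \int[P]_w ((Z2 w)%:E * (ramp m x (U w))%:E)).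
    by rewrite e in c1; exact: cvg_unique c1 c2.
  apply/funext => m; apply: (hphi _ m%:R%R) => //; first exact: ramp_lipschitz.
  by move=> y; exact: ramp_itv.
- move=> n; rewrite /push /= /pushforward ltey_eq fin_num_measure//.
  by rewrite -[X in measurable X]setTI; exact: (mU measurableT).
Qed.

End lipschitz_determining.

Section markov.
Context (R : realType) (d : measure_display) (Omega : measurableType d)
  (P : probability Omega R).
Local Notation mu := (@lebesgue_measure R).
Variables (F : R -> set (set Omega)) (W : R -> Omega -> R).
Hypotheses (hF : usual_filtration P F) (hW : brownian_motion P F W).
Variables (beta vs : R -> R) (L C : R) (X : R -> Omega -> R).
Hypotheses (L0 : 0 <= L) (hb : L.-lipschitz beta) (hs : L.-lipschitz vs).
Hypothesis hX : sde_solution P F W beta vs X.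
Hypothesis sX : forall t, 0 <= t -> sqint P (X t) /\ ip P (X t) (X t) <= C.

Let mb := lipschitz_measurable hb.
Let ms := lipschitz_measurable hs.

Let pX t : 0 <= t -> preim_in (F t) (X t).
Proof. by move=> t0; case: hX => /(_ t t0) + _ _; rewrite measurable_wrtP. Qed.

Let mX t : 0 <= t -> measurable_fun setT (X t).
Proof. by move=> t0; exact: (preim_in_meas hF t0 (pX t0)). Qed.

(** The increment W_b - W_a is independent of F_a and can be integrated out: E[Z psi(euler)] =
    E[Z Psi(Y)] with Psi independent of Z. One Euler step therefore preserves the equality of
    correlations. *)
Lemma euler_weak a b (Z1 Z2 Y : Omega -> R) : 0 <= a -> a < b ->
  preim_in (F a) Z1 -> preim_in (F a) Z2 -> preim_in (F a) Y ->
  (forall w, 0 <= Z1 w) -> (forall w, 0 <= Z2 w) ->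
  (forall psi : R -> \bar R, measurable_fun setT psi -> (forall x, 0 <= psi x)%E ->
     \int[P]_w ((Z1 w)%:E * psi (Y w)) = \int[P]_w ((Z2 w)%:E * psi (Y w)))%E ->
  forall psi : R -> \bar R, measurable_fun setT psi -> (forall x, 0 <= psi x)%E ->
     (\int[P]_w ((Z1 w)%:E * psi (euler W beta vs a b Y w)) =
      \int[P]_w ((Z2 w)%:E * psi (euler W beta vs a b Y w)))%E.
Proof.
move=> a0 ab pZ1 pZ2 pY Z10 Z20 hZ psi mpsi psi0; have b0 := le_trans a0 (ltW ab).
pose V w := W b w - W a w.
have mV : measurable_fun setT V.
  exact: (preim_in_meas hF b0 (preim_in_incr hF hW a0 (ltW ab))).
have iV : independent_systems P (sigma_of V) (F a).
  by case: hW => _ _ _ /(_ a b a0 ab).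
pose g (z : R * R) := z.1 + beta z.1 * (b - a) + vs z.1 * z.2.
have mg : measurable_fun setT g.
  apply: measurable_funD; first apply: measurable_funD => //.
    by apply: measurable_funM => //; exact: (measurableT_comp mb).
  by apply: measurable_funM => //; exact: (measurableT_comp ms).
have mpg : measurable_fun setT (psi \o g) by exact: measurableT_comp.
pose Psi y := (\int[P]_w' psi (g (y, V w')))%E.
have Psi0 y : (0 <= Psi y)%E by exact: integral_ge0.
have mPsi : measurable_fun setT Psi.
  apply: (measurable_fun_fubini_tonelli_F (m2 := P) (fun z : R * Omega => psi (g (z.1, V z.2)))) => //.
  apply: (measurableT_comp mpg); apply/measurable_fun_pair => //.
  exact: (measurableT_comp mV).
have key (Z : Omega -> R) : preim_in (F a) Z -> (forall w, 0 <= Z w) ->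
    (\int[P]_w ((Z w)%:E * psi (euler W beta vs a b Y w)) = \int[P]_w ((Z w)%:E * Psi (Y w)))%E.
  move=> pZ Z0.
  (* The absolute value makes the integrand nonnegative everywhere, as Tonelli requires; it
     disappears because Z >= 0. *)
  pose f (z : (R * R) * R) := (`|z.1.1|%:E * psi (g (z.1.2, z.2)))%E.
  have mf : measurable_fun setT f.
    apply: emeasurable_funM.
      apply/measurable_EFinP; apply: measurableT_comp => //.
      by apply: (measurableT_comp measurable_fst); exact: measurable_fst.
    apply: (measurableT_comp mpg); apply/measurable_fun_pair => //.
    by apply: (measurableT_comp measurable_snd); exact: measurable_fst.
  have f0 z : (0 <= f z)%E by rewrite mule_ge0.
  have pU : preim_in (F a) (fun w => (Z w, Y w)).
    by apply: preim_in_pair => //; exact: (filtration_sigma hF a0).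
  have := indep_integral (filtration_measurable hF a0) pU mV iV mf f0.
  rewrite /f/=.
  under eq_integral do rewrite ger0_norm//.
  move=> e; rewrite [LHS]e; apply: eq_integral => w _.
  rewrite ger0_norm// ge0_integralZl//.
    by apply: (measurableT_comp mpg); apply/measurable_fun_pair.
  by rewrite lee_fin.
by rewrite !key// hZ.
Qed.

Fixpoint scheme (s h : R) (k : nat) : Omega -> R :=
  if k is k'.+1 then
    euler W beta vs (s + k'%:R * h) (s + k'.+1%:R * h) (scheme s h k')
  else X s.

Section scheme.
Variables (s h : R).
Hypotheses (s0 : 0 <= s) (h0 : 0 < h) (h1 : h <= 1).

Let kt k := s + k%:R * h.

Let kt0 k : 0 <= kt k. Proof. by rewrite addr_ge0// mulr_ge0// ltW. Qed.

Let ktS k : kt k.+1 - kt k = h.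
Proof. by rewrite /kt -natr1; ring. Qed.

Let kt_lt k : kt k < kt k.+1. Proof. by rewrite -subr_gt0 ktS. Qed.

Lemma scheme_adapted k : preim_in (F (kt k)) (scheme s h k) /\ sqint P (scheme s h k).
Proof.
elim: k => [|k [pk sk]] /=.
  by rewrite /kt mul0r addr0; split; [exact: pX|exact: (sX s0).1].
split; first exact: (euler_preim hF hW hb hs (kt0 k) (ltW (kt_lt k)) pk).
exact: (euler_sqint hF hW L0 hb hs (kt0 k) (ltW (kt_lt k)) pk sk).
Qed.

(** The recursion e_(k+1) <= (1 + q h) e_k + q h om with e_0 = 0 has the solution om ((1 + q h)^k -
    1); here q = 1 + 8 L^2 and om bounds the squared variation of X over one step. *)
Lemma scheme_error k :
  ip P (fun w => X (kt k) w - scheme s h k w) (fun w => X (kt k) w - scheme s h k w) <=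
  sde_modulus beta vs L C * h * ((1 + (1 + 8 * L ^+ 2) * h) ^+ k - 1).
Proof.
set om := sde_modulus beta vs L C * h; set q := (1 + 8 * L ^+ 2).
have om0 : 0 <= om.
  have ssh : s < s + h by rewrite ltrDl.
  have := sde_modulusP hF hW L0 hb hs hX sX s0 ssh.
  by rewrite addrAC subrr add0r => /(_ h1); apply: le_trans; exact: ip_ge0.
elim: k => [|k ih] /=.
  rewrite expr0 subrr mulr0 /kt mul0r addr0.
  by under eq_fun do rewrite subrr; rewrite ip0l.
have [pk sk] := scheme_adapted k.
have hom u : kt k < u <= kt k.+1 ->
    ip P (fun w => X u w - X (kt k) w) (fun w => X u w - X (kt k) w) <= om.
  move=> /andP[ku uk].
  have uh : u - kt k <= h by rewrite -(ktS k) lerD2r.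
  apply: (le_trans (sde_modulusP hF hW L0 hb hs hX sX (kt0 k) ku (le_trans uh h1))).
  rewrite /om ler_wpM2l//.
  by move: om0; rewrite /om pmulr_lge0.
have hle : kt k.+1 - kt k <= 1 by rewrite ktS.
have := euler_error hF hW L0 hb hs hX sX (kt0 k) (kt_lt k) hle pk sk hom.
rewrite ktS => /le_trans; apply.
have q0 : 0 <= q by rewrite /q addr_ge0// mulr_ge0// sqr_ge0.
have qh0 : 0 <= 1 + q * h by rewrite addr_ge0// mulr_ge0// ltW.
apply: (@le_trans _ _ ((1 + q * h) * (om * ((1 + q * h) ^+ k - 1)) + q * h * om)).
  rewrite lerD//; first by rewrite ler_wpM2l.
  by rewrite ler_wpM2r// ler_wpM2r ?(ltW h0)// /q lerDr.
by rewrite exprS le_eqVlt; apply/orP; left; apply/eqP; ring.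
Qed.

End scheme.

Lemma scheme_cvg s t : 0 <= s -> s < t ->
  ip P (fun w => scheme s ((t - s) / n.+1%:R) n.+1 w - X t w)
       (fun w => scheme s ((t - s) / n.+1%:R) n.+1 w - X t w) @[n --> \oo] --> 0.
Proof.
move=> s0 st; have ts : 0 < t - s by rewrite subr_gt0.
pose c := sde_modulus beta vs L C * (t - s) * expR ((1 + 8 * L ^+ 2) * (t - s)).
have c0 : c / n.+1%:R @[n --> \oo] --> 0.
  by rewrite -(mulr0 c); apply: cvgM; [exact: cvg_cst|exact: cvg_harmonic].
apply: (squeeze_cvgr _ _ c0); last exact: cvg_cst.
near=> n; rewrite ip_ge0 andTb.
have n0 : 0 < n.+1%:R :> R by rewrite ltr0n.
have h0 : 0 < (t - s) / n.+1%:R by rewrite divr_gt0.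
(* The one-step estimates assume a step of length at most 1, hence n at least t - s. The product of
   growth factors is then bounded by e^(q (t - s)), uniformly in n. *)
have h1 : (t - s) / n.+1%:R <= 1.
  rewrite ler_pdivrMr// mul1r (le_trans _ (_ : n%:R <= _))// ?ler_nat//.
  by near: n; exact: nbhs_infty_ger.
have := scheme_error s0 h0 h1 n.+1.
have -> : s + n.+1%:R * ((t - s) / n.+1%:R) = t.
  by rewrite (mulrC n.+1%:R) divfK ?gt_eqF// addrC subrK.
rewrite (_ : (fun w => X t w - _) = (fun w => -1 * (scheme s ((t - s) / n.+1%:R) n.+1 w - X t w))); last first.
  by apply/funext => w; ring.
have sS := (scheme_adapted s0 h0 n.+1).2.
have sd : sqint P (fun w => scheme s ((t - s) / n.+1%:R) n.+1 w - X t w).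
  by apply: sqintB => //; exact: (sX (le_trans s0 (ltW st))).1.
rewrite ipZl ?ipZr//; last exact: sqintZ.
rewrite mulrA mulrNN mulr1 mul1r => /le_trans; apply.
set q := 1 + 8 * L ^+ 2; set h := (t - s) / n.+1%:R.
have q0 : 0 <= q by rewrite /q addr_ge0// mulr_ge0// sqr_ge0.
have om0 : 0 <= sde_modulus beta vs L C * h.
  have ssh : s < s + h by rewrite ltrDl.
  have := sde_modulusP hF hW L0 hb hs hX sX s0 ssh.
  by rewrite addrAC subrr add0r => /(_ h1); apply: le_trans; exact: ip_ge0.
have -> : c / n.+1%:R = sde_modulus beta vs L C * h * expR (q * (t - s)) by rewrite /c /h -/q; ring.
rewrite ler_wpM2l// lerBlDr (le_trans (_ : _ <= expR (q * (t - s))))//; last by rewrite lerDl.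
have -> : q * (t - s) = n.+1%:R * (q * h).
  by rewrite /h mulrCA (mulrC n.+1%:R) divfK ?gt_eqF.
rewrite expRM_natl lerXn2r ?nnegrE ?expR_ge0//; last exact: expR_ge1Dx.
by rewrite addr_ge0// mulr_ge0// ltW.
Unshelve. all: by end_near. Qed.

Lemma scheme_weak s h (Z1 Z2 : Omega -> R) k : 0 <= s -> 0 < h ->
  preim_in (F s) Z1 -> preim_in (F s) Z2 -> (forall w, 0 <= Z1 w) -> (forall w, 0 <= Z2 w) ->
  (forall psi : R -> \bar R, measurable_fun setT psi -> (forall x, 0 <= psi x)%E ->
     \int[P]_w ((Z1 w)%:E * psi (X s w)) = \int[P]_w ((Z2 w)%:E * psi (X s w)))%E ->
  forall psi : R -> \bar R, measurable_fun setT psi -> (forall x, 0 <= psi x)%E ->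
     (\int[P]_w ((Z1 w)%:E * psi (scheme s h k w)) =
      \int[P]_w ((Z2 w)%:E * psi (scheme s h k w)))%E.
Proof.
move=> s0 h0 pZ1 pZ2 Z10 Z20 hZ; elim: k => [|k ih]; first exact: hZ.
have kh : 0 <= k%:R * h by rewrite mulr_ge0// ltW.
have sk : s <= s + k%:R * h by rewrite lerDl.
apply: euler_weak => //.
- exact: le_trans sk.
- by rewrite ltrD2l ltr_pM2r// ltr_nat.
- exact: (preim_in_le hF s0 sk).
- exact: (preim_in_le hF s0 sk).
- exact: (scheme_adapted s0 h0 k).1.
Qed.

(** The scheme converges only in L^2, which passes through Lipschitz test functions but not through
    measurable ones; [lipschitz_determining] recovers the latter. *)
Lemma sde_weak s t (Z1 Z2 : Omega -> R) M : 0 <= s -> s <= t ->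
  preim_in (F s) Z1 -> preim_in (F s) Z2 ->
  (forall w, 0 <= Z1 w <= M) -> (forall w, 0 <= Z2 w <= M) ->
  (forall psi : R -> \bar R, measurable_fun setT psi -> (forall x, 0 <= psi x)%E ->
     \int[P]_w ((Z1 w)%:E * psi (X s w)) = \int[P]_w ((Z2 w)%:E * psi (X s w)))%E ->
  forall psi : R -> \bar R, measurable_fun setT psi -> (forall x, 0 <= psi x)%E ->
     (\int[P]_w ((Z1 w)%:E * psi (X t w)) = \int[P]_w ((Z2 w)%:E * psi (X t w)))%E.
Proof.
move=> s0; rewrite le_eqVlt => /predU1P[<-//|st] pZ1 pZ2 bZ1 bZ2 hZ; have t0 := le_trans s0 (ltW st).
have Z10 w : 0 <= Z1 w by case/andP: (bZ1 w).
have Z20 w : 0 <= Z2 w by case/andP: (bZ2 w).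
have mZ1 := preim_in_meas hF s0 pZ1; have mZ2 := preim_in_meas hF s0 pZ2.
apply: (lipschitz_determining mZ1 mZ2 bZ1 bZ2 (mX t0)) => phi l hphi l0 bphi.
have mphi := lipschitz_measurable hphi.
have sb (Z : Omega -> R) N : measurable_fun setT Z -> (forall w, 0 <= Z w <= N) -> sqint P Z.
  move=> mZ bZ; apply: (sqint_bounded P (M := N)) => // w.
  by have /andP[h1 h2] := bZ w; rewrite ger0_norm.
have sZ1 := sb _ _ mZ1 bZ1; have sZ2 := sb _ _ mZ2 bZ2.
have sphi (U : Omega -> R) : measurable_fun setT U -> sqint P (fun w => phi (U w)).
  by move=> mU; apply: (sb _ 1) => //; exact: measurableT_comp.
have ipE (Z U : Omega -> R) : sqint P Z -> measurable_fun setT U ->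
    (\int[P]_w ((Z w)%:E * (phi (U w))%:E))%E = (ip P Z (fun w => phi (U w)))%:E.
  move=> sZ mU; under eq_integral do rewrite -EFinM.
  rewrite /ip /Rintegral fineK//; apply: integrable_fin_num => //.
  by apply: sqintM_integrable => //; exact: sphi.
rewrite !ipE//; [|exact: mX..]; congr EFin.
pose h n : R := (t - s) / n.+1%:R.
have h0 n : 0 < h n by rewrite divr_gt0 ?subr_gt0.
pose Y n := scheme s (h n) n.+1.
have sY n : sqint P (Y n) by exact: (scheme_adapted s0 (h0 n) n.+1).2.
have sXt := (sX t0).1.
have cphi : ip P (fun w => phi (Y n w) - phi (X t w)) (fun w => phi (Y n w) - phi (X t w))
    @[n --> \oo] --> 0.
  have c0 := scheme_cvg s0 st.
  have {}c0 : l ^+ 2 * ip P (fun w => Y n w - X t w) (fun w => Y n w - X t w) @[n --> \oo] --> 0.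
    by rewrite -(mulr0 (l ^+ 2)); apply: cvgM; [exact: cvg_cst|exact: c0].
  apply: (squeeze_cvgr _ _ c0); last exact: cvg_cst.
  apply: nearW => n; rewrite ip_ge0 andTb.
  by apply: (lipschitz_sqintB l0 hphi (sY n).1 sXt.1 _).2; exact: sqintB.
have cZ (Z : Omega -> R) : sqint P Z ->
    ip P Z (fun w => phi (Y n w)) @[n --> \oo] --> ip P Z (fun w => phi (X t w)).
  move=> sZ; apply: (ip_cvg (fun=> sZ) (fun n => sphi _ (sY n).1) sZ (sphi _ sXt.1) _ cphi).
  under [X in ip _ X]eq_fun do rewrite subrr.
  by rewrite ip0l; exact: cvg_cst.
have c1 := cZ _ sZ1; have c2 := cZ _ sZ2.
suff e : (fun n => ip P Z1 (fun w => phi (Y n w))) = (fun n => ip P Z2 (fun w => phi (Y n w))).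
  by rewrite e in c1; exact: cvg_unique c1 c2.
apply/funext => n; apply: EFin_inj; rewrite -!ipE//; [|exact: (sY n).1..].
apply: (scheme_weak (psi := fun x => (phi x)%:E) n.+1 s0 (h0 n) pZ1 pZ2 Z10 Z20 hZ).
- exact/measurable_EFinP.
- by move=> x; rewrite lee_fin; case/andP: (bphi x).
Qed.

End markov.

Section sde_markov.
Context (R : realType) (d : measure_display) (Omega : measurableType d)
  (P : probability Omega R).
Variables (F : R -> set (set Omega)) (W : R -> Omega -> R).
Hypotheses (hF : usual_filtration P F) (hW : brownian_motion P F W).
Variables (beta vs : R -> R) (L C : R) (X : R -> Omega -> R).
Hypotheses (L0 : 0 <= L) (hb : L.-lipschitz beta) (hs : L.-lipschitz vs).
Hypothesis hX : sde_solution P F W beta vs X.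
Hypothesis sX : forall t, 0 <= t -> sqint P (X t) /\ ip P (X t) (X t) <= C.

Let pX t : 0 <= t -> preim_in (F t) (X t).
Proof. by move=> t0; case: hX => /(_ t t0) + _ _; rewrite measurable_wrtP. Qed.

Let mX t : 0 <= t -> measurable_fun setT (X t).
Proof. by move=> t0; exact: (preim_in_meas hF t0 (pX t0)). Qed.

(* The conditional law given F_s is tested on A in F_s by comparing 1_A with
   h(X_s) = E[1_A | X_s]: both have the same correlation with functions of X_s,
   hence of X_t. *)
Lemma sde_markov_ge0 s t (phi : R -> R) M : 0 <= s -> s <= t ->
  measurable_fun setT phi -> (forall x, 0 <= phi x <= M) ->
  exists g : R -> R, [/\ measurable_fun setT g, forall x, 0 <= g x <= M &
    forall A, F s A ->
      (\int[P]_(w in A) (phi (X t w))%:E = \int[P]_(w in A) (g (X s w))%:E)%E].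
Proof.
move=> s0 st mphi bphi; have t0 := le_trans s0 st.
have mphiX : measurable_fun setT (fun w => phi (X t w)).
  by apply: measurableT_comp => //; exact: mX.
have [g [mg bg hg]] := cond_exp_bounded P mphiX (mX s0) (fun w => bphi (X t w)).
exists g; split => // A FA; have mA := filtration_measurable hF s0 FA.
have m1 : measurable_fun setT (\1_A : Omega -> R) by exact: measurable_indic.
have b1 w : 0 <= (\1_A : Omega -> R) w <= 1 by rewrite indicE; case: (_ \in _); rewrite ?lexx ?ler01.
have [h [mh bh hh]] := cond_exp_bounded P m1 (mX s0) b1.
have p1 : preim_in (F s) (\1_A : Omega -> R).
  move=> B mB; have sF := filtration_sigma hF s0; have [F0 FC FU] := sF.
  rewrite preimage_indic.
  have FT : F s setT by have := FC _ F0; rewrite setD0.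
  case: ifPn => _; case: ifPn => _ //.
  by have := FC _ FA; rewrite setTD.
have ph : preim_in (F s) (fun w => h (X s w)) by exact: (preim_in_comp mh (pX s0)).
have E (f : Omega -> R) : (\int[P]_(w in A) (f w)%:E = \int[P]_w ((\1_A w)%:E * (f w)%:E))%E.
  rewrite integral_mkcond; apply: eq_integral => w _.
  by rewrite patchE indicE; case: (_ \in _); rewrite ?mul1e ?mul0e.
have mphiE : measurable_fun setT (EFin \o phi) by exact/measurable_EFinP.
have mgE : measurable_fun setT (EFin \o g) by exact/measurable_EFinP.
have mhE : measurable_fun setT (EFin \o h) by exact/measurable_EFinP.
rewrite !E.
(* The chain is E[1_A phi(X_t)] = E[h(X_s) phi(X_t)] = E[h(X_s) g(X_s)] = E[1_A g(X_s)]: this lemma,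
   then the defining property of g, then that of h. *)
have e1 := sde_weak hF hW L0 hb hs hX sX s0 st p1 ph b1 (fun w => bh (X s w)) hh mphiE.
rewrite [LHS]e1; last by move=> x; rewrite lee_fin; case/andP: (bphi x).
under eq_integral do rewrite muleC.
rewrite [LHS](hg (EFin \o h)) //; last by move=> x; rewrite lee_fin; case/andP: (bh x).
under eq_integral do rewrite muleC.
rewrite [RHS](hh (EFin \o g)) //.
by move=> x; rewrite lee_fin; case/andP: (bg x).
Qed.

Lemma sde_markov : markov_process P F X.
Proof.
move=> s t s0 st phi mphi [M hM]; have t0 := le_trans s0 st.
(* Adding the bound M makes the test function nonnegative; the constant is subtracted again at the
   end. *)
have mphiM : measurable_fun setT (fun x => phi x + M) by exact: measurable_funD.
have bphiM x : 0 <= phi x + M <= 2 * M by have := hM x; rewrite ler_norml => /andP[]; lra.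
have [g [mg bg hg]] := sde_markov_ge0 s0 st mphiM bphiM.
have mgM : measurable_fun setT (fun x => g x - M) by exact: measurable_funB.
have iM A : measurable A -> P.-integrable A (EFin \o cst M).
  by move=> mA; exact: finite_measure_integrable_cst.
have ib (f : R -> R) u : 0 <= u -> measurable_fun setT f -> (forall x, 0 <= f x <= 2 * M) ->
    P.-integrable setT (EFin \o fun w => f (X u w)).
  move=> u0 mf bf; apply: (@bounded_integrable _ _ _ _ _ (2 * M)).
    by apply: measurableT_comp => //; exact: mX.
  by move=> w; have /andP[h1 h2] := bf (X u w); rewrite ger0_norm.
have ig := ib g s s0 mg bg; have ip := ib _ t t0 mphiM bphiM.
have gE : (fun w => (g (X s w) - M)%:E) =
    ((EFin \o fun w => g (X s w)) \- (EFin \o cst M))%E.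
  by apply/funext => w; rewrite /= EFinB.
exists (fun x => g x - M); split => //.
  by rewrite gE; apply: integrableB => //; exact: iM.
move=> A FA; have mA := filtration_measurable hF s0 FA.
rewrite gE.
have -> : (fun w => (phi (X t w))%:E) =
    ((EFin \o fun w => (phi (X t w) + M)%R) \- (EFin \o cst M))%E.
  by apply/funext => w; rewrite /= -EFinB addrK.
by rewrite !integralB//; [rewrite hg|exact: integrableS ig|exact: iM|exact: integrableS ip|exact: iM].
Qed.

End sde_markov.

Lemma lipschitz_affine (R : realType) (c mu0 lam L : R) : `|c * lam| <= L ->
  L.-lipschitz (fun x => c * (mu0 - lam * x)).
Proof.
move=> cL [x y] _ /=.
rewrite (_ : _ - _ = (c * lam) * (y - x)); last by ring.
by rewrite normrM distrC ler_wpM2r.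
Qed.

Lemma lipschitz_scale (R : realType) (c l L : R) (g : R -> R) : l.-lipschitz g ->
  `|c| * `|l| <= L -> L.-lipschitz (fun x => c * g x).
Proof.
move=> hg cL [x y] _ /=; rewrite -mulrBr normrM.
apply: (@le_trans _ _ (`|c| * (`|l| * `|x - y|))); last by rewrite mulrA ler_wpM2r.
rewrite ler_wpM2l// (le_trans (lipschitzP hg x y))// ler_wpM2r//.
exact: ler_norm.
Qed.

Theorem theorem2p2 (R : realType) (d : measure_display)
    (Omega : measurableType d) (P : probability Omega R)
    (F : R -> set (set Omega)) (W : R -> Omega -> R)
    (K : R -> R) (lambda mu0 : R) (sigma : R -> R)
    (X : R -> Omega -> R) (v0 sb2 : R)
    (hF : usual_filtration P F)
    (hW : brownian_motion P F W)
    (hK : admissible_kernel K)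
    (hlambda : 0 < lambda)
    (hsigma : exists L : R, L.-lipschitz sigma)
    (hX0 : X 0 \in Lfun P 2%:E)
    (hX0W : independent_systems P (sigma_of (X 0)) (sigma_of_process W))
    (hX : volterra_solution P F W K (fun x => mu0 - lambda * x) sigma X)
    (hv0 : 0 <= v0) (hsb2 : 0 <= sb2)
    (hmean : forall t : R, 0 <= t -> 'E_P[X t]%E = (mu0 / lambda)%:E)
    (hvar : forall t : R, 0 <= t -> 'V_P[X t]%E = v0%:E)
    (hsig2 : forall t : R, 0 <= t ->
       'E_P[(fun w => sigma (X t w) ^+ 2)%R]%E = sb2%:E) :
  (0 < sb2 ->
     let c := 2 * lambda * v0 / sb2 in
     [/\ {ae @lebesgue_measure R, forall t : R, 0 <= t -> K t = c},
         (* the Volterra equation is a standard Brownian SDE *)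
         forall Y : R -> Omega -> R,
           volterra_solution P F W K (fun x => mu0 - lambda * x) sigma Y <->
           sde_solution P F W
             (fun x => c * (mu0 - lambda * x)) (fun x => c * sigma x) Y,
         (* X is a Brownian diffusion *)
         sde_solution P F W
           (fun x => c * (mu0 - lambda * x)) (fun x => c * sigma x) X,
         markov_process P F X &
         forall t : R, 0 <= t ->
           'E_P[X t]%E = (mu0 / lambda)%:E /\ 'V_P[X t]%E = v0%:E])
  /\
  (sb2 = 0 ->
     sigma (mu0 / lambda) = 0 /\
     forall t : R, 0 <= t -> {ae P, forall w, X t w = mu0 / lambda}).
Proof.
have [l hl] := hsigma; have msigma := lipschitz_measurable hl.
split; last first.
  move=> sb0; exact: (stationary_degenerate hF hW hK hlambda msigma hX hsb2 hmean hvar hsig2 sb0).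
move=> sb0 c.
have Kc : {ae @lebesgue_measure R, forall t : R, 0 <= t -> K t = c}.
  exact: (stationary_kernel_const hF hW hK hlambda msigma hX hv0 hsb2 hmean hvar hsig2 sb0).
have mb : measurable_fun setT (fun x : R => mu0 - lambda * x).
  by apply: measurable_funB => //; exact: measurable_funM.
have equiv Y := volterra_sde W hF (kernel_measurable hK) Kc mb msigma Y.
have sdeX := (equiv X).1 hX.
split => //; last by move=> t t0; split; [exact: hmean|exact: hvar].
(* A single nonnegative constant that serves both the drift and the diffusion coefficient; l itself
   may be negative. *)
pose L := `|c * lambda| + `|c| * `|l|.
have L0 : 0 <= L by rewrite addr_ge0// mulr_ge0.
have hb : L.-lipschitz (fun x => c * (mu0 - lambda * x)).
  by apply: lipschitz_affine; rewrite lerDl mulr_ge0.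
have hs : L.-lipschitz (fun x => c * sigma x).
  by apply: (lipschitz_scale hl); rewrite lerDr.
(* This second-moment bound is [ipD_le] with weight 1 applied to X_t as centred part plus mean. *)
apply: (sde_markov hF hW L0 hb hs sdeX (C := (1 + 1) * v0 + (1 + 1^-1) * (mu0 / lambda) ^+ 2)) => t t0.
have [sc ec] := sqint_centered hF hX hmean hvar t0.
have sm := sqint_cst P (mu0 / lambda).
have XE : X t = (fun w => centered lambda mu0 X t w + mu0 / lambda).
  by apply/funext => w; rewrite /centered subrK.
rewrite XE; split; first exact: sqintD.
apply: (le_trans (ipD_le ltr01 sc sm)); rewrite ec.
by rewrite /ip Rintegral_cst//= probability_setT mulr1 -expr2.
Qed.
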